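(* Let $\ell,T>0$, $\Omega=[0,\ell]$, and let the coefficients $\mathbf M,\mathbf C,\mathbf C_\tau,\mathbf E$ and the derived matrices $\mathbf\Gamma=\operatorname{diag}(\mathbf M,\mathbf C)$ and $\mathbf H=\mathbf C_\tau\mathbf C^{-1}$ satisfy the standing hypotheses in the context; in particular $\mathbf\Gamma$ and $\mathbf H$ are time-independent and uniformly symmetric positive definite on $\Omega$. Let $\mathbf q_{\rm ext}=(\mathbf f_e^\top,\mathbf 0_6^\top)^\top\in L^2(0,T;L^2_{\mathbf\Gamma^{-1}}(\Omega)^{12})$. Let $(\mathbf u,\mathbf r_\tau)\in\mathcal X_T\times\mathcal Y_T$, $\mathbf u=(\mathbf u_1^\top,\mathbf u_2^\top)^\top$, be such that the two field equations (F1) and (F2) of the context hold almost everywhere in $(0,\ell)\times(0,T)$, with $\mathbf u(\cdot,0)=\mathbf u_0$. Then the mechanical energy $$E(t)=\tfrac12\int_0^\ell\left(\mathbf u_1^\top\mathbf M\mathbf u_1+\mathbf u_2^\top\mathbf C\mathbf u_2\right)dx=\tfrac12\|\mathbf u(\cdot,t)\|_{\mathbf\Gamma}^2$$ is absolutely continuous and, for almost every $t\in(0,T)$, $$\frac12\frac{d}{dt}\|\mathbf u\|_{\mathbf\Gamma}^2+(\mathbf H^{-1}\mathbf r_\tau,\mathbf r_\tau)_\Omega=\bigl[\mathbf u_1^\top(\mathbf u_2+\mathbf r_\tau)\bigr]_0^\ell+(\mathbf q_{\rm ext},\mathbf u)_\Omega .$$ If, in addition, for each endpoint $x_\delta\in\{0,\ell\}$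 there is a fixed (time-independent) partition $\{1,\dots,6\}=\mathcal I_v(x_\delta)\,\dot\cup\,\mathcal I_t(x_\delta)$ such that the endpoint traces satisfy the homogeneous conditions $$(\mathbf u_1)_i(x_\delta,t)=0\quad(i\in\mathcal I_v(x_\delta)),\qquad(\mathbf u_2+\mathbf r_\tau)_i(x_\delta,t)=0\quad(i\in\mathcal I_t(x_\delta)),$$ then $$\|\mathbf u(\cdot,T)\|_{\mathbf\Gamma}^2+2\int_0^T(\mathbf H^{-1}\mathbf r_\tau(\cdot,t),\mathbf r_\tau(\cdot,t))_\Omega\,dt\le e^T\left(\|\mathbf u_0\|_{\mathbf\Gamma}^2+\int_0^T\|\mathbf q_{\rm ext}(\cdot,t)\|_{\mathbf\Gamma^{-1}}^2\,dt\right).$$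
   Context: Dots denote $\partial_t$, primes denote $\partial_x$. $(\cdot,\cdot)_\Omega$ is the $L^2(\Omega)$ inner product (of vector-valued functions), and $[g]_0^\ell=g(\ell)-g(0)$. Algebra: for $\mathbf a\in\mathbb R^3$, $\tilde{\mathbf a}\in\mathbb R^{3\times3}$ is the skew matrix with $\tilde{\mathbf a}\mathbf b=\mathbf a\times\mathbf b$. For $\mathbf c=(\mathbf c_1^\top,\mathbf c_2^\top)^\top\in\mathbb R^6$ with $\mathbf c_1,\mathbf c_2\in\mathbb R^3$, $$\mathcal L_1(\mathbf c)=\begin{bmatrix}\tilde{\mathbf c}_2&\mathbf 0\\ \tilde{\mathbf c}_1&\tilde{\mathbf c}_2\end{bmatrix},\qquad \mathcal L_2(\mathbf c)=\begin{bmatrix}\mathbf 0&\tilde{\mathbf c}_1\\ \tilde{\mathbf c}_1&\tilde{\mathbf c}_2\end{bmatrix};$$ $\mathcal L_1^\top(\mathbf c)$ denotes the transpose of $\mathcal L_1(\mathbf c)$. Coefficients (standing hypotheses): $\mathbf M,\mathbf C,\mathbf C_\tau:[0,\ell]\to\mathbb R^{6\times6}$ (mass, flexibility, Kelvin–Voigt damping matrices) are time-independent and sufficiently smooth in $x$ (in particular continuous on $[0,\ell]$); $\mathbf M$ and $\mathbf C$ are uniformly symmetric positive definite; $\mathbf H:=\mathbf C_\tau\mathbf C^{-1}$ is uniformly symmetric positive definite ($\mathbf C_\tau$ itself need not be symmetric). ''Uniformly symmetric positive definite'' means symmetric at every $x$ with $z^\top A(x)z\ge c|z|^2$ for some $c>0$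 independent of $x$. The matrix $\mathbf E(x)=\begin{bmatrix}\tilde{\boldsymbol\kappa}_0(x)&\mathbf 0\\ \tilde{\mathbf e}_1&\tilde{\boldsymbol\kappa}_0(x)\end{bmatrix}$, where $\boldsymbol\kappa_0:[0,\ell]\to\mathbb R^3$ is the given sufficiently smooth initial curvature/twist and $\mathbf e_1=(1,0,0)^\top$. $\mathbf\Gamma=\operatorname{diag}(\mathbf M,\mathbf C)\in\mathbb R^{12\times12}$. Unknowns: $\mathbf u_1,\mathbf u_2,\mathbf r_\tau$ are $\mathbb R^6$-valued functions of $(x,t)$, $\mathbf u=(\mathbf u_1^\top,\mathbf u_2^\top)^\top$; $\mathbf f_e$ is the $\mathbb R^6$-valued external load. Field equations. (F1): $$\mathbf M\dot{\mathbf u}_1-\mathbf u_2'-\mathbf r_\tau'=\mathbf E\mathbf u_2+\mathbf E\mathbf r_\tau-\mathcal L_1(\mathbf u_1)\mathbf M\mathbf u_1-\mathcal L_2(\mathbf u_2)\mathbf C\mathbf u_2-\mathcal L_2(\mathbf r_\tau)\mathbf C\mathbf u_2+\mathbf f_e,$$ $$\mathbf C\dot{\mathbf u}_2-\mathbf u_1'=-\mathbf E^\top\mathbf u_1+\mathcal L_1^\top(\mathbf u_1)\mathbf C\mathbf u_2;$$ (F2): $$\mathbf H^{-1}\mathbf r_\tau=\mathbf u_1'-\mathbf E^\top\mathbf u_1+\mathcal L_1^\top(\mathbf u_1)\mathbf C\mathbf u_2 .$$ Function spaces and norms: $\mathcal X_T=H^1(0,T;L^2(\Omega)^{12})\cap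 L^\infty(0,T;H^1(\Omega)^{12})$, $\mathcal Y_T=L^2(0,T;H^1(\Omega)^6)$; $\|\mathbf z\|_{\mathbf\Gamma}^2=(\mathbf z,\mathbf\Gamma\mathbf z)_\Omega$; $\|\mathbf g\|_{\mathbf\Gamma^{-1}}^2=\int_\Omega\mathbf g^\top\mathbf\Gamma^{-1}\mathbf g\,dx$, and $L^2_{\mathbf\Gamma^{-1}}(\Omega)^{12}$ is the space of measurable $\mathbf g$ with finite $\|\mathbf g\|_{\mathbf\Gamma^{-1}}$. *)

(* Defs.v *)
From HB Require Import structures.
From mathcomp Require Import all_boot all_order all_algebra.
From mathcomp Require Import all_classical all_reals all_analysis.
From mathcomp Require Import ring.

Set Implicit Arguments.
Unset Strict Implicit.
Unset Printing Implicit Defensive.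

Import Order.TTheory GRing.Theory Num.Theory.
Import numFieldNormedType.Exports.

Local Open Scope classical_set_scope.
Local Open Scope ring_scope.

Section algebra.
Context {R : realType}.

Definition dotv n (a b : 'cV[R]_n) : R := (a^T *m b) ord0 ord0.

Definition crossv (a b : 'cV[R]_3) : 'cV[R]_3 :=
  let c (v : 'cV[R]_3) k := v (inord k) ord0 in
  \col_(i < 3) [:: c a 1 * c b 2 - c a 2 * c b 1;
                   c a 2 * c b 0 - c a 0 * c b 2;
                   c a 0 * c b 1 - c a 1 * c b 0]`_i.

(* column j of the skew matrix is the cross product with the j-th basis vector *)
Definition skew (a : 'cV[R]_3) : 'M[R]_3 :=
  \matrix_(i < 3, j < 3) crossv a (delta_mx j ord0) i ord0.

Lemma skewE (a b : 'cV[R]_3) : skew a *m b = crossv a b.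
Proof.
apply/colP => i; rewrite mxE.
have I0 : inord 0 = ord0 :> 'I_3 by apply/val_inj; rewrite /= inordK.
have I1 : inord 1 = lift ord0 ord0 :> 'I_3 by apply/val_inj; rewrite /= inordK.
have I2 : inord 2 = lift ord0 (lift ord0 ord0) :> 'I_3.
  by apply/val_inj; rewrite /= inordK.
rewrite !big_ord_recl big_ord0 !mxE I0 I1 I2 ?mxE /=.
have O (c : 'cV[R]_3) k : c k 0 = c k ord0 by congr (c k _); exact: val_inj.
by rewrite !O; case: i => [[|[|[|k]]]] /= k3; [ring|ring|ring|].
Qed.

(* c = (c1^T, c2^T)^T with c1 = usubmx c, c2 = dsubmx c; 3 + 3 is convertible
   to 6 *)
Definition calL1 (c : 'cV[R]_(3 + 3)) : 'M[R]_6 :=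
  block_mx (skew (dsubmx c)) 0
           (skew (usubmx c)) (skew (dsubmx c)).

Definition calL2 (c : 'cV[R]_(3 + 3)) : 'M[R]_6 :=
  block_mx 0                 (skew (usubmx c))
           (skew (usubmx c)) (skew (dsubmx c)).

Definition Emx (kappa0 : 'cV[R]_3) : 'M[R]_6 :=
  block_mx (skew kappa0)            0
           (skew (delta_mx ord0 ord0)) (skew kappa0).

Definition Gammamx (M C : 'M[R]_6) : 'M[R]_(6 + 6) := block_mx M 0 0 C.

Definition Hmx (C Ctau : 'M[R]_6) : 'M[R]_6 := Ctau *m invmx C.

Definition unif_spd (n : nat) (D : set R) (A : R -> 'M[R]_n) : Prop :=
  (forall x, D x -> (A x)^T = A x) /\
  exists2 c : R, 0 < c &
    forall x, D x -> forall z : 'cV[R]_n, c * dotv z z <= dotv z (A x *m z).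

End algebra.

Section spaces.
Context {R : realType}.
Local Notation mu := (@lebesgue_measure R).

(* Space-time fields are functions of x, then t.  Classes modulo equality a.e.
   are handled through (Borel, jointly measurable) representatives. *)
Definition Omega (l : R) : set R := `[0, l].
Definition timeI (T : R) : set R := `]0, T[.

Definition abs_cont (a b : R) (F : R -> R) : Prop :=
  forall e : R, 0 < e -> exists2 d : R, 0 < d &
    forall (n : nat) (s r : 'I_n -> R),
      (forall i, a <= s i /\ s i <= r i /\ r i <= b) ->
      (forall i j, i != j -> `]s i, r i[ `&` `]s j, r j[ = set0) ->
      \sum_(i < n) (r i - s i) < d ->
      \sum_(i < n) `|F (r i) - F (s i)| < e.

(* C^1_c(]a, b[): these test functions define the same weak derivatives as
   C^oo_c *)
Definition test_fun (a b : R) (phi : R -> R) : Prop :=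
  [/\ forall x, derivable phi x 1,
      continuous (derive1 phi) &
      exists c d : R, [/\ a < c, d < b &
        forall x, x \notin `[c, d] -> phi x = 0]].

(* g is the weak derivative of f on ]a, b[; integrability is stated
   separately where this is used *)
Definition weak_deriv (a b : R) (f g : R -> R) : Prop :=
  forall phi, test_fun a b phi ->
    \int[mu]_(x in `]a, b[) (f x * derive1 phi x) =
    - \int[mu]_(x in `]a, b[) (g x * phi x).

Definition inL2 n (l : R) (f : R -> 'cV[R]_n) : Prop :=
  (forall i, measurable_fun (Omega l) (fun x => f x i ord0)) /\
  (\int[mu]_(x in Omega l) (dotv (f x) (f x))%:E < +oo)%E.

Definition ip n (l : R) (f g : R -> 'cV[R]_n) : R :=
  \int[mu]_(x in Omega l) dotv (f x) (g x).

Definition wnorm2 n (l : R) (A : R -> 'M[R]_n) (f : R -> 'cV[R]_n) : R :=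
  ip l f (fun x => A x *m f x).

Definition joint_meas n (l T : R) (u : R -> R -> 'cV[R]_n) : Prop :=
  forall i, measurable_fun
    (Omega l `*` timeI T : set (measurableTypeR R * measurableTypeR R))
    (fun p => u p.1 p.2 i ord0).

(* L^2(0,T; L^2_A(Omega)^n) *)
Definition inL2L2w n (l T : R) (A : R -> 'M[R]_n) (u : R -> R -> 'cV[R]_n) :
    Prop :=
  joint_meas l T u /\
  (\int[mu]_(t in timeI T) \int[mu]_(x in Omega l)
     (dotv (u x t) (A x *m u x t))%:E < +oo)%E.

Definition inL2L2 n (l T : R) (u : R -> R -> 'cV[R]_n) : Prop :=
  inL2L2w l T (fun=> 1%:M) u.

(* The equality of Bochner integrals in L^2(Omega)^n that defines the weak time
   derivative is an equality of functions for a.e. x. *)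
Definition time_deriv n (l T : R) (u ut : R -> R -> 'cV[R]_n) : Prop :=
  inL2L2 l T ut /\
  forall phi, test_fun 0 T phi -> forall i,
    (fun x => \int[mu]_(t in timeI T) (u x t i ord0 * derive1 phi t)) =
    (fun x => - \int[mu]_(t in timeI T) (ut x t i ord0 * phi t))
    %[ae mu in Omega l].

Definition space_deriv n (l T : R) (u ux : R -> R -> 'cV[R]_n) : Prop :=
  joint_meas l T ux /\
  \forall t \ae mu, timeI T t ->
    inL2 l (ux ^~ t) /\
    forall i, weak_deriv 0 l (fun x => u x t i ord0) (fun x => ux x t i ord0).

Definition H1norm2 n (l : R) (f fx : R -> 'cV[R]_n) : \bar R :=
  \int[mu]_(x in Omega l) (dotv (f x) (f x) + dotv (fx x) (fx x))%:E.

Definition in_H1L2 n (l T : R) (u : R -> R -> 'cV[R]_n) : Prop :=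
  inL2L2 l T u /\ exists ut, time_deriv l T u ut.

Definition in_LinfH1 n (l T : R) (u : R -> R -> 'cV[R]_n) : Prop :=
  joint_meas l T u /\
  exists2 ux, space_deriv l T u ux &
    exists K : R, \forall t \ae mu, timeI T t ->
      (H1norm2 l (u ^~ t) (ux ^~ t) <= K%:E)%E.

Definition in_L2H1 n (l T : R) (u : R -> R -> 'cV[R]_n) : Prop :=
  joint_meas l T u /\
  exists2 ux, space_deriv l T u ux &
    (\int[mu]_(t in timeI T) H1norm2 l (u ^~ t) (ux ^~ t) < +oo)%E.

Definition in_XT (l T : R) (u : R -> R -> 'cV[R]_(6 + 6)) : Prop :=
  in_H1L2 l T u /\ in_LinfH1 l T u.

Definition in_YT (l T : R) (r : R -> R -> 'cV[R]_6) : Prop := in_L2H1 l T r.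

(* w is the representative of u in C([0,T]; L^2(Omega)^n) *)
Definition is_time_rep n (l T : R) (u w : R -> R -> 'cV[R]_n) : Prop :=
  [/\ \forall t \ae mu, timeI T t ->
        w ^~ t = u ^~ t %[ae mu in Omega l],
      forall t, t \in `[0, T] -> inL2 l (w ^~ t) &
      forall t, t \in `[0, T] ->
        (fun s => wnorm2 l (fun=> 1%:M) (fun x => w x s - w x t))
          @ within `[0, T] (nbhs t) --> (0 : R)].

(* unique modulo equality a.e. in x at each t in [0,T]; this gives a meaning to
   u(., t) for every t in [0,T] *)
Definition time_rep n (l T : R) (u : R -> R -> 'cV[R]_n) :
    R -> R -> 'cV[R]_n :=
  xget u [set w | is_time_rep l T u w].

(* the continuous representative on [0,l] of a class of functions *)
Definition cont_rep (l : R) (f : R -> R) : R -> R :=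
  xget f [set g | {within Omega l, continuous g} /\
                  f = g %[ae mu in Omega l]].

Definition trace n (l : R) (f : R -> 'cV[R]_n) (x : R) : 'cV[R]_n :=
  \col_i cont_rep l (fun y => f y i ord0) x.

End spaces.

Section beam.
Context {R : realType}.

Definition fst6 (u : R -> R -> 'cV[R]_(6 + 6)) : R -> R -> 'cV[R]_6 :=
  fun x t => usubmx (u x t).

Definition snd6 (u : R -> R -> 'cV[R]_(6 + 6)) : R -> R -> 'cV[R]_6 :=
  fun x t => dsubmx (u x t).

Definition qext (fe : R -> R -> 'cV[R]_6) : R -> R -> 'cV[R]_(6 + 6) :=
  fun x t => col_mx (fe x t) 0.

Definition field_eq1 (M C E : 'M[R]_6) (u1 u2 r fe u1t u2t u1x u2x rx : 'cV[R]_6) :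
    Prop :=
  M *m u1t - u2x - rx =
    E *m u2 + E *m r - calL1 u1 *m M *m u1 - calL2 u2 *m C *m u2
    - calL2 r *m C *m u2 + fe /\
  C *m u2t - u1x = - (E^T *m u1) + (calL1 u1)^T *m C *m u2.

Definition field_eq2 (C E H : 'M[R]_6) (u1 u2 r u1x : 'cV[R]_6) : Prop :=
  invmx H *m r = u1x - E^T *m u1 + (calL1 u1)^T *m C *m u2.

Definition energy (l : R) (M C : R -> 'M[R]_6) (u1 u2 : R -> 'cV[R]_6) : R :=
  2^-1 * \int[@lebesgue_measure R]_(x in Omega l)
           (dotv (u1 x) (M x *m u1 x) + dotv (u2 x) (C x *m u2 x)).

Definition homogeneous_bc (l T : R) (u1 u2 r : R -> R -> 'cV[R]_6) (xd : R) :
    Prop :=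
  exists Iv It : {set 'I_6},
    [/\ (Iv :|: It)%SET = [set: 'I_6]%SET, [disjoint Iv & It]%B &
        \forall t \ae @lebesgue_measure R, timeI T t ->
          (forall i, i \in Iv -> trace l (u1 ^~ t) xd i ord0 = 0) /\
          (forall i, i \in It ->
             trace l (fun x => u2 x t + r x t) xd i ord0 = 0)].

End beam.

(* Main.v *)
(** The equations hold only almost everywhere, so the formal energy computation is
carried out on absolutely continuous representatives.  In one variable, testing a
weak derivative with C^1 steps that sharpen at Lebesgue points shows that the function
is a.e. a constant plus a primitive.  Steps with rational centres suffice; this countable
family is needed in time, where the exceptional null set of x depends on the test
function.  It gives the representative w(x,t) = c(x) + int_0^t u_t(x,s) ds, and the
product rule for primitives (Fubini on a triangle), integrated over x, yields
|w(t)|_Gamma^2 = |w(0)|_Gamma^2 + int_0^t 2 (u, Gamma u_t) ds.  At a.e. fixed t the same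
one-dimensional lemma in x provides the traces and the integration by parts, while the
terms L_1, L_2 and E cancel pointwise.  Young's inequality and Gronwall's lemma applied
to |w(t)|_Gamma^2 + 2 int_0^t (H^-1 r, r) ds conclude. *)

Require Import Defs.
From HB Require Import structures.
From mathcomp Require Import all_boot all_order all_algebra.
From mathcomp Require Import all_classical all_reals all_analysis.
From mathcomp Require Import measurable_realfun.
From mathcomp Require Import ring lra.

Set Implicit Arguments.
Unset Strict Implicit.
Unset Printing Implicit Defensive.

Import Order.TTheory GRing.Theory Num.Theory.
Import numFieldNormedType.Exports.

Local Open Scope classical_set_scope.
Local Open Scope ring_scope.

(** * Pointwise algebra *)

Section algebra.
Context {R : realType}.

(** The value of [u] at a given time and the traces are choices made by [xget] among
    representatives, so nothing can be computed on them directly. An explicit representative is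
    built to show that a choice exists, and uniqueness modulo null sets transfers its properties to
    the chosen one. The hypotheses come with different orders of quantifiers: the equations hold
    a.e. on the rectangle, the weak time derivative is an identity for a.e. x, the space derivatives
    and traces exist for a.e. t. Passing from one order to another rests on Tonelli, hence on joint
    measurability; fields are therefore extended by zero to the whole plane, and the constant of
    integration c(x) is written as a mean, which is visibly measurable in x. Real-valued integrals
    are total and carry no meaning on non-integrable functions, so each linearity step needs an
    integrability proof. The factor exp(T) has rate one because the balance is doubled and Young's
    inequality is used with equal weights: the rate of the squared norm plus twice the dissipation
    is at most the squared load norm plus the squared norm itself. *)

Lemma dotvE n (a b : 'cV[R]_n) : dotv a b = \sum_i a i ord0 * b i ord0.
Proof. by rewrite /dotv mxE; apply: eq_bigr => i _; rewrite mxE. Qed.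

Lemma dotvC n (a b : 'cV[R]_n) : dotv a b = dotv b a.
Proof. by rewrite !dotvE; apply: eq_bigr => i _; rewrite mulrC. Qed.

Lemma dotvDl n (a b c : 'cV[R]_n) : dotv (a + b) c = dotv a c + dotv b c.
Proof. by rewrite /dotv linearD/= mulmxDl mxE. Qed.

Lemma dotvDr n (a b c : 'cV[R]_n) : dotv a (b + c) = dotv a b + dotv a c.
Proof. by rewrite /dotv mulmxDr mxE. Qed.

Lemma dotvNl n (a b : 'cV[R]_n) : dotv (- a) b = - dotv a b.
Proof. by rewrite /dotv linearN/= mulNmx mxE. Qed.

Lemma dotvNr n (a b : 'cV[R]_n) : dotv a (- b) = - dotv a b.
Proof. by rewrite /dotv mulmxN mxE. Qed.

Lemma dotv0r n (a : 'cV[R]_n) : dotv a 0 = 0.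
Proof. by rewrite /dotv mulmx0 mxE. Qed.

Lemma dotvZl n c (a b : 'cV[R]_n) : dotv (c *: a) b = c * dotv a b.
Proof. by rewrite /dotv linearZ/= -scalemxAl mxE. Qed.

Lemma dotvZr n c (a b : 'cV[R]_n) : dotv a (c *: b) = c * dotv a b.
Proof. by rewrite /dotv -scalemxAr mxE. Qed.

Lemma dotv_mulmx m n (A : 'M[R]_(m, n)) (a : 'cV[R]_m) b :
  dotv a (A *m b) = dotv (A^T *m a) b.
Proof. by rewrite /dotv trmx_mul trmxK mulmxA. Qed.

Lemma dotv_mulmxE n (A : 'M[R]_n) (a b : 'cV[R]_n) :
  dotv a (A *m b) = \sum_i \sum_j A i j * (a i ord0 * b j ord0).
Proof.
rewrite dotvE; apply: eq_bigr => i _; rewrite mxE mulr_sumr.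
by apply: eq_bigr => j _; rewrite mulrCA.
Qed.

Lemma dotv_ge0 n (a : 'cV[R]_n) : 0 <= dotv a a.
Proof. by rewrite dotvE; apply: sumr_ge0 => i _; rewrite -expr2 sqr_ge0. Qed.

Lemma dotv_eq0 n (a : 'cV[R]_n) : dotv a a = 0 -> a = 0.
Proof.
rewrite dotvE => /eqP; rewrite psumr_eq0; last first.
  by move=> i _; rewrite -expr2 sqr_ge0.
move=> /allP a0; apply/colP => i; rewrite mxE.
have := a0 i; rewrite mem_index_enum => /(_ isT).
by rewrite mulf_eq0 orbb => /eqP.
Qed.

Lemma dotv_col_mx m n (a c : 'cV[R]_m) (b d : 'cV[R]_n) :
  dotv (col_mx a b) (col_mx c d) = dotv a c + dotv b d.
Proof. by rewrite /dotv tr_col_mx mul_row_col mxE. Qed.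

Lemma dotv_vsubmx m n (a b : 'cV[R]_(m + n)) :
  dotv a b = dotv (usubmx a) (usubmx b) + dotv (dsubmx a) (dsubmx b).
Proof. by rewrite -dotv_col_mx !vsubmxK. Qed.

(** The dimension is spelled 6 on the left so that the lemma rewrites pairings of six-vectors;
    [3 + 3] and 6 are convertible. *)
Lemma dotv33 (a b : 'cV[R]_(3 + 3)) : @dotv R 6 a b =
  dotv (usubmx a) (usubmx b) + dotv (dsubmx a) (dsubmx b).
Proof. by have := dotv_vsubmx a b. Qed.

Lemma dotv_Gammamx (M C : 'M[R]_6) (a b : 'cV[R]_(6 + 6)) :
  dotv a (Gammamx M C *m b) =
  dotv (usubmx a) (M *m usubmx b) + dotv (dsubmx a) (C *m dsubmx b).
Proof.
rewrite -{1}(vsubmxK b) /Gammamx mul_block_col !mul0mx addr0 add0r.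
by rewrite -{1}(vsubmxK a) dotv_col_mx.
Qed.

Lemma crossvC (a b : 'cV[R]_3) : crossv a b = - crossv b a.
Proof.
by apply/colP => i; rewrite !mxE; case: i => [[|[|[|k]]]] //= _; ring.
Qed.

Lemma dotv3E (a b : 'cV[R]_3) : dotv a b =
  a (inord 0) ord0 * b (inord 0) ord0 + a (inord 1) ord0 * b (inord 1) ord0 +
  a (inord 2) ord0 * b (inord 2) ord0.
Proof.
have I0 : inord 0 = ord0 :> 'I_3 by apply/val_inj; rewrite /= inordK.
have I1 : inord 1 = lift ord0 ord0 :> 'I_3 by apply/val_inj; rewrite /= inordK.
have I2 : inord 2 = lift ord0 (lift ord0 ord0) :> 'I_3.
  by apply/val_inj; rewrite /= inordK.
by rewrite dotvE !big_ord_recl big_ord0 I0 I1 I2 addr0 addrA.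
Qed.

Lemma crossv_cycle (a b c : 'cV[R]_3) : dotv a (crossv b c) = dotv c (crossv a b).
Proof. rewrite !dotv3E /crossv !mxE !inordK//=; ring. Qed.

Lemma mul_calL1 (a b : 'cV[R]_(3 + 3)) : calL1 a *m b =
  col_mx (crossv (dsubmx a) (usubmx b))
         (crossv (usubmx a) (usubmx b) + crossv (dsubmx a) (dsubmx b)).
Proof.
rewrite -[in LHS](vsubmxK b); transitivity ((block_mx (Defs.skew (dsubmx a)) 0
   (Defs.skew (usubmx a)) (Defs.skew (dsubmx a)) : 'M[R]_(3 + 3)) *m
   col_mx (usubmx b) (dsubmx b)); first by [].
by rewrite mul_block_col mul0mx addr0 !skewE.
Qed.

Lemma mul_calL2 (a b : 'cV[R]_(3 + 3)) : calL2 a *m b =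
  col_mx (crossv (usubmx a) (dsubmx b))
         (crossv (usubmx a) (usubmx b) + crossv (dsubmx a) (dsubmx b)).
Proof.
rewrite -[in LHS](vsubmxK b); transitivity ((block_mx 0 (Defs.skew (usubmx a))
   (Defs.skew (usubmx a)) (Defs.skew (dsubmx a)) : 'M[R]_(3 + 3)) *m
   col_mx (usubmx b) (dsubmx b)); first by [].
by rewrite mul_block_col mul0mx add0r !skewE.
Qed.

(* The nonlinear terms cancel in the energy balance thanks to this identity
   and the next one. *)
Lemma dotv_calL12 (a b c : 'cV[R]_(3 + 3)) :
  dotv a (calL2 c *m b) = dotv c ((calL1 a)^T *m b).
Proof.
rewrite [RHS]dotv_mulmx trmxK mul_calL1 mul_calL2.
rewrite !dotv33 !col_mxKu !col_mxKd !dotvDr !dotvDl.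
rewrite (crossv_cycle (usubmx a)) (crossv_cycle (dsubmx a)).
rewrite (crossv_cycle (dsubmx a) (dsubmx c)).
by rewrite ![dotv (crossv _ _) _]dotvC; ring.
Qed.

Lemma dotv_calL1_self (a b : 'cV[R]_(3 + 3)) : dotv a (calL1 a *m b) = 0.
Proof.
rewrite mul_calL1 dotv33 col_mxKu col_mxKd dotvDr.
have cc (v : 'cV[R]_3) : crossv v v = 0.
  apply/colP => i; have := congr1 (fun w : 'cV[R]_3 => w i ord0) (crossvC v v).
  by rewrite /= !mxE => h; lra.
rewrite (crossv_cycle (usubmx a)) (crossv_cycle (dsubmx a)).
rewrite (crossv_cycle (dsubmx a) (dsubmx a)) cc dotv0r addr0.
by rewrite (crossvC (usubmx a)) dotvNr addNr.
Qed.

(** The momentum equation is paired with [u1], the kinematic one with [u2] and the damping law with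
    [r]. The [calL1] term is orthogonal to [u1], the two [calL2] terms cancel against the transposed
    [calL1] terms tested with [u2] and with [r], and [E] cancels against its transpose. What
    survives is the x-derivative of [u1^T (u2 + r)], expanded, and the power of the load. *)
Lemma energy_balance (M C H : 'M[R]_6) (kappa : 'cV[R]_3)
    (u ut ux : 'cV[R]_(6 + 6)) (r rx fe : 'cV[R]_6) :
  field_eq1 M C (Emx kappa) (usubmx u) (dsubmx u) r fe (usubmx ut) (dsubmx ut)
    (usubmx ux) (dsubmx ux) rx ->
  field_eq2 C (Emx kappa) H (usubmx u) (dsubmx u) r (usubmx ux) ->
  dotv u (Gammamx M C *m ut) + dotv (invmx H *m r) r =
  dotv (usubmx u) (dsubmx ux + rx) + dotv (usubmx ux) (dsubmx u + r)
  + dotv (col_mx fe 0) u.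
Proof.
move=> [e1 e2] e3.
rewrite dotv_Gammamx.
rewrite e3 -(vsubmxK u) dotv_col_mx !col_mxKu !col_mxKd [dotv 0 _]dotvC dotv0r addr0.
move: (usubmx u) (dsubmx u) (usubmx ut) (dsubmx ut) (usubmx ux) (dsubmx ux) e1 e2.
move=> u1 u2 u1t u2t u1x u2x; rewrite -!mulmxA => e1 e2.
have -> : M *m u1t = u2x + rx + (M *m u1t - u2x - rx).
  by rewrite -[_ - u2x - rx]addrA -opprD [RHS]addrC subrK.
have -> : C *m u2t = u1x + (C *m u2t - u1x) by rewrite [RHS]addrC subrK.
rewrite e1 e2.
have h1 : dotv u1 (calL1 u1 *m (M *m u1)) = 0 := dotv_calL1_self u1 (M *m u1).
have h2 : dotv u1 (calL2 u2 *m (C *m u2)) = dotv u2 ((calL1 u1)^T *m (C *m u2)) :=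
  dotv_calL12 u1 (C *m u2) u2.
have h3 : dotv u1 (calL2 r *m (C *m u2)) = dotv r ((calL1 u1)^T *m (C *m u2)) :=
  dotv_calL12 u1 (C *m u2) r.
have h4 : dotv u2 ((Emx kappa)^T *m u1) = dotv u1 (Emx kappa *m u2).
  by rewrite dotv_mulmx trmxK dotvC.
have h5 : dotv ((Emx kappa)^T *m u1) r = dotv u1 (Emx kappa *m r).
  by rewrite -dotv_mulmx.
move: h1 h2 h3 h4 h5.
move: (calL1 u1 *m _) (calL2 u2 *m _) (calL2 r *m _) ((calL1 u1)^T *m _).
move=> a b c d; move: (Emx kappa *m u2) (Emx kappa *m r) ((Emx kappa)^T *m u1).
move=> e f g h1 h2 h3 h4 h5.
rewrite !(dotvDr, dotvDl, dotvNr, dotvNl) h1 h2 h3 h4 h5.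
by rewrite (dotvC u1x) (dotvC d) (dotvC u1x) (dotvC u1 fe); ring.
Qed.

End algebra.

(** * Coercive matrices and their inverses *)

Section spd.
Context {R : realType}.

(** The quadratic form vanishes on a kernel vector of [A], so coercivity forces that vector to be
    zero. *)
Lemma spd_unit n (A : 'M[R]_n) c : 0 < c ->
  (forall z : 'cV[R]_n, c * dotv z z <= dotv z (A *m z)) -> A \in unitmx.
Proof.
move=> c0 Ac; rewrite -unitmx_tr -row_free_unit; apply/inj_row_free => v vA.
have : dotv v^T (A *m v^T) = 0.
  by rewrite -[A *m _]trmxK trmx_mul trmxK vA trmx0 dotv0r.
move=> h; have := Ac v^T; rewrite h pmulr_rle0// => h0.
rewrite -[v]trmxK (@dotv_eq0 _ _ v^T) ?trmx0//.
by apply/eqP; rewrite eq_le h0 dotv_ge0.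
Qed.

(** With [y = A^-1 z], coercivity reads [c |y|^2 <= y.z], which gives the lower bound. Inserting it
    in [0 <= |z - c y|^2] gives [c y.z <= |z|^2], the upper bound. *)
Lemma spd_inv_bounds n (A : 'M[R]_n) c (z : 'cV[R]_n) : 0 < c ->
  (forall z : 'cV[R]_n, c * dotv z z <= dotv z (A *m z)) ->
  0 <= dotv (invmx A *m z) z <= c^-1 * dotv z z.
Proof.
move=> c0 Ac; have Au := spd_unit c0 Ac; set y := invmx A *m z.
have zE : z = A *m y by rewrite /y mulmxA mulmxV// mul1mx.
have h := Ac y; rewrite -zE in h.
rewrite (le_trans _ h)/=; last by rewrite mulr_ge0 ?dotv_ge0 ?ltW.
have := dotv_ge0 (z - c *: y).
rewrite !(dotvDr, dotvDl, dotvNr, dotvNl, dotvZl, dotvZr) (dotvC z y).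
rewrite ler_pdivlMl// => h2.
have h3 : c * (c * dotv y y) <= c * dotv y z by rewrite ler_pM2l.
lra.
Qed.

(* The A-norm of [A^-1 q -+ u] is nonnegative. *)
Lemma dotv_young n (A : 'M[R]_n) c (q u : 'cV[R]_n) : 0 < c -> A^T = A ->
  (forall z : 'cV[R]_n, c * dotv z z <= dotv z (A *m z)) ->
  2 * `|dotv q u| <= dotv q (invmx A *m q) + dotv u (A *m u).
Proof.
move=> c0 AT Ac; have Au := spd_unit c0 Ac.
have key (v : 'cV[R]_n) : 2 * dotv q v <= dotv q (invmx A *m q) + dotv v (A *m v).
  set y := invmx A *m q; have qE : q = A *m y by rewrite /y mulmxA mulmxV// mul1mx.
  have : 0 <= dotv (y - v) (A *m (y - v)).
    by apply: le_trans (Ac _); rewrite mulr_ge0 ?dotv_ge0 ?ltW.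
  rewrite mulmxBr -qE !(dotvDr, dotvDl, dotvNr, dotvNl) (dotv_mulmx A y) AT -qE.
  by rewrite (dotvC y q) (dotvC v q) => h; lra.
have k1 := key u; have := key (- u).
rewrite mulmxN dotvNr dotvNl dotvNr opprK => k2.
by case: (ger0P (dotv q u)) => _; lra.
Qed.

End spd.

(** * Weak derivatives in one variable *)

Section step_function.
Context {R : realType}.
Implicit Types s t : R.

(** The truncated square, the basic C^1 piece of the quadratic spline [step]. *)
Definition sqpos t : R := Num.max t 0 ^+ 2.

Lemma is_derive_sqpos t : is_derive t 1 sqpos (2 * Num.max t 0).
Proof.
(* The difference quotient misses the limit by at most |h|, since [2 * max t 0] is 2-Lipschitz. *)
have quot h : h != 0 ->
    `|h^-1 *: (sqpos (h *: 1 + t) - sqpos t) - 2 * Num.max t 0| <= `|h|.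
  move=> h0; rewrite /sqpos /GRing.scale/= mulr1.
  have -> : h^-1 * (Num.max (h + t) 0 ^+ 2 - Num.max t 0 ^+ 2) - 2 * Num.max t 0 =
     h^-1 * (Num.max (h + t) 0 ^+ 2 - Num.max t 0 ^+ 2 - 2 * Num.max t 0 * h).
    by field.
  rewrite normrM normfV ler_pdivrMl ?normr_gt0// -normrM -expr2 [leRHS]ger0_norm ?sqr_ge0//.
  rewrite ler_norml; case: (leP t 0) => ht; case: (leP (h + t) 0) => hht;
    apply/andP; split; nra.
have cv : h^-1 *: (sqpos (h *: 1 + t) - sqpos t) @[h --> 0^'] --> 2 * Num.max t 0.
  apply/cvgrPdist_le => e e0; near=> h.
  rewrite distrC (le_trans (quot _ _))//.
    by near: h; exact: nbhs_dnbhs_neq.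
  by near: h; apply: dnbhs0_le.
split; first by apply/cvg_ex; exists (2 * Num.max t 0).
exact: cvg_lim.
Unshelve. all: by end_near. Qed.

(** Half the second difference of the truncated square: a quadratic spline that rises from 0 at -1
    to 1 at 1. It is C^1, which is the regularity that [test_fun] asks for. *)
Definition step t : R := 2^-1 * (sqpos (t + 1) - 2 * sqpos t + sqpos (t - 1)).

(** The hat function [max (1 - |t|) 0], in the form in which it appears as the derivative of
    [step]. *)
Definition tent t : R :=
  Num.max (t + 1) 0 - 2 * Num.max t 0 + Num.max (t - 1) 0.

Lemma is_derive_step t : is_derive t 1 step (tent t).
Proof.
have H1 := is_derive_sqpos (t + 1); have H2 := is_derive_sqpos (t - 1).
have H0 := is_derive_sqpos t.
have D1 : is_derive t 1 (fun s : R => sqpos (s + 1)) (2 * Num.max (t + 1) 0).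
  have := @is_derive1_comp _ sqpos (fun s => s + 1) t _ 1 H1.
  rewrite mulr1; apply.
  by apply: is_derive_eq; rewrite addr0.
have D2 : is_derive t 1 (fun s : R => sqpos (s - 1)) (2 * Num.max (t - 1) 0).
  have := @is_derive1_comp _ sqpos (fun s => s - 1) t _ 1 H2.
  rewrite mulr1; apply.
  by apply: is_derive_eq; rewrite subr0.
rewrite [step](_ : _ = 2^-1 \*: ((fun s : R => sqpos (s + 1)) - 2 \*: sqpos +
    (fun s : R => sqpos (s - 1)))); last by apply/funext.
apply: is_derive_eq.
by rewrite /tent /GRing.scale/=; field.
Qed.

Lemma step_eq0 t : t <= -1 -> step t = 0.
Proof.
move=> t1; rewrite /step /sqpos.
by rewrite !max_r; [ring|lra..].
Qed.

Lemma step_eq1 t : 1 <= t -> step t = 1.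
Proof.
move=> t1; rewrite /step /sqpos.
by rewrite !max_l; [field|lra..].
Qed.

Lemma step_itv t : 0 <= step t <= 1.
Proof.
rewrite /step /sqpos.
by case: (leP (t + 1) 0) => h1; case: (leP (t - 1) 0) => h2;
  case: (leP t 0) => h3; apply/andP; split; nra.
Qed.

Lemma tent_itv t : 0 <= tent t <= 1.
Proof.
rewrite /tent.
by case: (leP (t + 1) 0) => h1; case: (leP (t - 1) 0) => h2;
  case: (leP t 0) => h3; apply/andP; split; lra.
Qed.

Lemma tent_eq0 t : 1 <= `|t| -> tent t = 0.
Proof.
rewrite ler_normr => /orP[] t1; rewrite /tent.
  by rewrite !max_l; [field|lra..].
by rewrite !max_r; [field|lra..].
Qed.

(** The constant 4 = 1 + 2 + 1 adds the slopes of the three positive parts; it is not sharp, but any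
    constant serves. *)
Lemma tent_lipschitz s t : `|tent s - tent t| <= 4 * `|s - t|.
Proof.
have L (x y : R) : `|Num.max x 0 - Num.max y 0| <= `|x - y|.
  rewrite ler_norml; have := ler_norm (x - y); have := ler_norm (- (x - y)).
  rewrite normrN.
  by case: (leP x 0) => h1; case: (leP y 0) => h2; move=> *; apply/andP; split; lra.
have := L (s + 1) (t + 1); have := L (s - 1) (t - 1); have := L s t.
rewrite (_ : s + 1 - (t + 1) = s - t); last ring.
rewrite (_ : s - 1 - (t - 1) = s - t); last ring.
rewrite !ler_norml /tent => /andP[? ?] /andP[? ?] /andP[? ?].
by apply/andP; split; lra.
Qed.

Lemma continuous_tent : continuous tent.
Proof.
move=> t; apply/cvgrPdist_le => e e0; near=> s.
rewrite (le_trans (tent_lipschitz _ _))//.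
rewrite mulrC -ler_pdivlMr//.
near: s; exists (e / 4) => /=; first by rewrite divr_gt0.
by move=> y /ltW.
Unshelve. all: by end_near. Qed.

Lemma continuous_step : continuous step.
Proof.
move=> t; apply: differentiable_continuous; apply/derivable1_diffP.
exact: (@ex_derive _ _ _ _ _ _ _ (is_derive_step t)).
Qed.

Lemma step_lipschitz s t : `|step s - step t| <= `|s - t|.
Proof.
wlog st : s t / s <= t.
  by move=> H; have [/H//|/ltW/H] := leP s t; rewrite distrC (distrC t).
have [||c _ e] := @MVT_segment _ step tent s t st.
- by move=> x _; exact: is_derive_step.
- by apply: continuous_subspaceT; exact: continuous_step.
rewrite distrC e normrM distrC ler_piMl//.
by have /andP[t0 t1] := tent_itv c; rewrite ger0_norm.
Qed.

End step_function.

(** Lets filter lemmas and [near=>] act on a.e. statements for the Lebesgue measure. *)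
Instance ae_lebesgue_filter (R : realType) :
  Filter (almost_everywhere (@lebesgue_measure R)).
Proof. exact: ae_filter_ringOfSetsType. Qed.

(** * Integrability and a.e. comparison for real-valued integrands *)

Section integrable_EFin.
Context d (X : measurableType d) (R : realType) (m : {measure set X -> \bar R}).
Context (D : set X) (mD : measurable D).
Implicit Types f g : X -> R.

Lemma integrable_EFinZl c f : m.-integrable D (EFin \o f) ->
  m.-integrable D (EFin \o (fun x => c * f x)).
Proof. exact: integrableZl. Qed.

Lemma integrable_EFinD f g : m.-integrable D (EFin \o f) ->
  m.-integrable D (EFin \o g) -> m.-integrable D (EFin \o (fun x => f x + g x)).
Proof. exact: integrableD. Qed.

Lemma integrable_EFinB f g : m.-integrable D (EFin \o f) ->
  m.-integrable D (EFin \o g) -> m.-integrable D (EFin \o (fun x => f x - g x)).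
Proof. exact: integrableB. Qed.

Lemma integrable_EFin_sum (I : Type) (r : seq I) (P : pred I) (f : I -> X -> R) :
  (forall i, m.-integrable D (EFin \o f i)) ->
  m.-integrable D (EFin \o (fun x => \sum_(i <- r | P i) f i x)).
Proof.
move=> fi; have := @integrable_sum _ _ _ m D mD I r P (fun i => EFin \o f i) (fun i _ => fi i).
by apply: eq_integrable => // x _; rewrite /= sumEFin.
Qed.

Lemma le_integrable_EFin f g : measurable_fun D f -> (forall x, D x -> `|f x| <= g x) ->
  m.-integrable D (EFin \o g) -> m.-integrable D (EFin \o f).
Proof.
move=> mf fg; apply: le_integrable => //; first exact/measurable_EFinP.
by move=> x Dx; rewrite /= lee_fin (le_trans (fg x Dx))// ler_norm.
Qed.

(** Equality a.e. does not transfer measurability in a sigma-algebra that may fail to be complete,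
    hence the hypothesis on [f]. *)
Lemma ae_eq_integrable_EFin f g : measurable_fun D f ->
  (\forall x \ae m, D x -> f x = g x) ->
  m.-integrable D (EFin \o g) -> m.-integrable D (EFin \o f).
Proof.
move=> mf fg /integrableP[mg gi]; apply/integrableP; split; first exact/measurable_EFinP.
rewrite (ae_eq_integral (abse \o (EFin \o g)))//.
- by apply: measurableT_comp => //; exact/measurable_EFinP.
- exact: measurableT_comp.
- by apply: filterS fg => x /= + Dx => ->.
Qed.

Lemma ae_eq_Rintegral f g : measurable_fun D f -> measurable_fun D g ->
  (\forall x \ae m, D x -> f x = g x) ->
  \int[m]_(x in D) f x = \int[m]_(x in D) g x.
Proof.
move=> mf mg fg; congr fine; apply: ae_eq_integral => //; [exact/measurable_EFinP..|].
by apply: filterS fg => x /= + Dx => ->.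
Qed.

(** The function [max f g] dominates [f] everywhere and equals [g] a.e., which reduces the claim to
    a pointwise comparison. *)
Lemma ae_le_Rintegral f g : m.-integrable D (EFin \o f) ->
  m.-integrable D (EFin \o g) ->
  (\forall x \ae m, D x -> f x <= g x) ->
  \int[m]_(x in D) f x <= \int[m]_(x in D) g x.
Proof.
move=> fi gi fg.
have mf : measurable_fun D f by apply/measurable_EFinP; exact: (measurable_int m).
have mg : measurable_fun D g by apply/measurable_EFinP; exact: (measurable_int m).
have mmax : measurable_fun D (fun x => Num.max (f x) (g x)) by exact: measurable_maxr.
have e : \forall x \ae m, D x -> Num.max (f x) (g x) = g x.
  by apply: filterS fg => x + Dx => /(_ Dx); case: leP => // a b.
rewrite -(ae_eq_Rintegral mmax mg e); apply: le_Rintegral => //.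
  exact: ae_eq_integrable_EFin e gi.
by move=> x _; rewrite le_max lexx.
Qed.

Lemma Rintegral_sum (I : Type) (r : seq I) (P : pred I) (f : I -> X -> R) :
  (forall i, m.-integrable D (EFin \o f i)) ->
  \int[m]_(x in D) (\sum_(i <- r | P i) f i x) =
  \sum_(i <- r | P i) \int[m]_(x in D) f i x.
Proof.
move=> fi; elim: r => [|i r IH].
  under eq_Rintegral do rewrite big_nil.
  by rewrite big_nil Rintegral_cst// mul0r.
under eq_Rintegral do rewrite big_cons.
rewrite big_cons -IH; case: (P i) => //.
by rewrite RintegralD//; exact: integrable_EFin_sum.
Qed.

End integrable_EFin.

Section mollify.
Context {R : realType}.
Local Notation mu := (@lebesgue_measure R).
Implicit Types (f g : R -> R) (p b : R).

(** A step sharpening at [p], minus the same step at the fixed reference point [b / 2]: a single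
    step is not compactly supported, the difference is. *)
Definition step_test b (p : R) (n : nat) (t : R) : R :=
  step (n.+1%:R * (t - p)) - step (n.+1%:R * (t - b / 2)).

Lemma is_derive_step_scale (k p t : R) :
  is_derive t 1 (fun s => step (k * (s - p))) (k * tent (k * (t - p))).
Proof.
rewrite mulrC.
have := @is_derive1_comp _ step (fun s => k * (s - p)) t _ k (is_derive_step _).
apply; apply: is_derive_eq.
by rewrite subr0 /GRing.scale/= mulr1.
Qed.

Lemma derive1_step_test b p n t : derive1 (step_test b p n) t =
  n.+1%:R * tent (n.+1%:R * (t - p)) - n.+1%:R * tent (n.+1%:R * (t - b / 2)).
Proof.
rewrite derive1E.
have H1 := is_derive_step_scale n.+1%:R p t.
have H2 := is_derive_step_scale n.+1%:R (b / 2) t.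
rewrite [step_test _ _ _](_ : _ = (fun s => step (n.+1%:R * (s - p))) -
   (fun s => step (n.+1%:R * (s - b / 2)))); last by apply/funext.
by apply: derive_val.
Qed.

Lemma continuous_tent_scale (k p : R) : continuous (fun t => tent (k * (t - p))).
Proof.
move=> t; apply: (@continuous_comp _ _ _ (fun t => k * (t - p)) tent).
  apply: cvgM; first exact: cvg_cst.
  by apply: cvgB; [exact: cvg_id|exact: cvg_cst].
exact: continuous_tent.
Qed.

Lemma continuous_step_scale (k p : R) : continuous (fun t => step (k * (t - p))).
Proof.
move=> t; apply: (@continuous_comp _ _ _ (fun t => k * (t - p)) step).
  apply: cvgM; first exact: cvg_cst.
  by apply: cvgB; [exact: cvg_id|exact: cvg_cst].
exact: continuous_step.
Qed.

(** Each step varies only within distance [1 / (n + 1)] of its centre; to the left of both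
    transition zones both steps are 0, to the right both are 1, and they cancel. The three
    inequalities keep both zones inside []0, b[]. *)
Lemma test_fun_step_test b p n : n.+1%:R^-1 < p -> p < b - n.+1%:R^-1 ->
  2 * n.+1%:R^-1 < b -> test_fun 0 b (step_test b p n).
Proof.
set k : R := n.+1%:R => p0 pb nb.
have k0 : 0 < k by rewrite ltr0n.
have kk : k * k^-1 = 1 by rewrite mulfV// gt_eqF.
split.
- move=> x.
  have H1 := is_derive_step_scale n.+1%:R p x.
  have H2 := is_derive_step_scale n.+1%:R (b / 2) x.
  rewrite [step_test _ _ _](_ : _ = (fun s => step (n.+1%:R * (s - p))) -
   (fun s => step (n.+1%:R * (s - b / 2)))); last by apply/funext.
  exact: derivableB.
- rewrite (_ : derive1 _ = fun t => k * tent (k * (t - p)) - k * tent (k * (t - b / 2))); last first.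
    by apply/funext => t; rewrite derive1_step_test.
  move=> t; apply: cvgB; apply: cvgM; try exact: cvg_cst.
    exact: continuous_tent_scale.
  exact: continuous_tent_scale.
- exists (Num.min p (b / 2) - k^-1), (Num.max p (b / 2) + k^-1); split.
  + by clear kk; move: p0 pb nb; move: (k^-1) => e; case: (leP p (b / 2)) => h; lra.
  + by clear kk; move: p0 pb nb; move: (k^-1) => e; case: (leP p (b / 2)) => h; lra.
  + move=> x; rewrite in_itv/= negb_and -!ltNge /step_test => /orP[xl|xr].
      have [xp xb] : x <= p - k^-1 /\ x <= b / 2 - k^-1.
        by clear kk; move: xl; move: (k^-1) => e; case: (leP p (b / 2)) => h h2; split; lra.
      by clear kk; rewrite !step_eq0 ?subrr// -/k mulrC -ler_pdivlMr// mulN1r lerBlDr addrC.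
    have [xp xb] : p + k^-1 <= x /\ b / 2 + k^-1 <= x.
      by clear kk; move: xr; move: (k^-1) => e; case: (leP p (b / 2)) => h h2; split; lra.
    by clear kk; rewrite !step_eq1 ?subrr// -/k mulrC -ler_pdivrMr// mul1r lerBrDr addrC.
Qed.

Lemma continuous_bounded_integrableM f h (K : R) : mu.-integrable setT (EFin \o f) ->
  continuous h -> (forall x, `|h x| <= K) ->
  mu.-integrable setT (EFin \o (fun x => f x * h x)).
Proof.
move=> fi hc hK.
have := @integrableMl _ _ _ mu setT measurableT (EFin \o f) h fi.
rewrite /comp/=; apply.
  exact: continuous_measurable_fun.
exists K; split; first exact: num_real.
by move=> y Ky x _ /=; rewrite (le_trans (hK x))// ltW.
Qed.

(* The weak identity says that [mollif f g n p] does not depend on [p]; as n grows it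
   tends to [f p + int_p^oo g] at the Lebesgue points [p] of [f]. *)
Definition mollif f g (n : nat) (p : R) : R :=
  n.+1%:R * (\int[mu]_t (f t * tent (n.+1%:R * (t - p)))) +
  \int[mu]_t (g t * step (n.+1%:R * (t - p))).

Let tent_bnd k p x : `|tent (k * (x - p))| <= 1 :> R.
Proof. by have /andP[t0 t1] := tent_itv (k * (x - p)); rewrite ger0_norm. Qed.

Let step_bnd k p x : `|step (k * (x - p))| <= 1 :> R.
Proof. by have /andP[t0 t1] := step_itv (k * (x - p)); rewrite ger0_norm. Qed.

Let intT f k p : mu.-integrable setT (EFin \o f) ->
  mu.-integrable setT (EFin \o (fun x => f x * tent (k * (x - p)))).
Proof.
move=> fi; apply: (continuous_bounded_integrableM fi _ (tent_bnd k p)).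
exact: continuous_tent_scale.
Qed.

Let intS f k p : mu.-integrable setT (EFin \o f) ->
  mu.-integrable setT (EFin \o (fun x => f x * step (k * (x - p)))).
Proof.
move=> fi; apply: (continuous_bounded_integrableM fi _ (step_bnd k p)).
exact: continuous_step_scale.
Qed.

(** Continuity in the centre at fixed [n], which extends identities from rational centres to real
    ones. The constant deteriorates as [n] grows, but [n] does not move when this is used. *)
Lemma mollif_lipschitz f g n : mu.-integrable setT (EFin \o f) ->
  mu.-integrable setT (EFin \o g) ->
  exists2 K, 0 <= K & forall p q, `|mollif f g n p - mollif f g n q| <= K * `|p - q|.
Proof.
move=> fi gi; set k : R := n.+1%:R.
have k0 : 0 < k by rewrite ltr0n.
have nf := integrable_norm fi; have ng := integrable_norm gi.
exists (k * (4 * k * \int[mu]_t `|f t|) + k * \int[mu]_t `|g t|).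
  by rewrite addr_ge0// !mulr_ge0 ?Rintegral_ge0// ltW.
move=> p q; rewrite /mollif -/k.
have -> (a b c d : R) : k * a + b - (k * c + d) = k * (a - c) + (b - d) by ring.
rewrite mulrDl (le_trans (ler_normD _ _))// lerD//.
  rewrite normrM (gtr0_norm k0) -[leRHS]mulrA ler_pM2l//.
  rewrite -RintegralB//; [|exact: intT|exact: intT].
  apply: (le_trans (le_normr_Rintegral _ _)) => //.
    by apply: integrable_EFinB => //; exact: intT.
  rewrite mulrAC -RintegralZl//.
  apply: le_Rintegral => //.
  - apply: integrable_norm.
    by apply: integrable_EFinB => //; exact: intT.
  - exact: integrable_EFinZl.
  - move=> x _; rewrite -mulrBr normrM mulrC ler_wpM2r//.
    rewrite (le_trans (tent_lipschitz _ _))// -mulrBr normrM (gtr0_norm k0) mulrA ler_wpM2l//.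
      by rewrite mulr_ge0// ltW.
    by rewrite (_ : x - p - (x - q) = q - p)  1?distrC//; ring.
rewrite -RintegralB//; [|exact: intS|exact: intS].
apply: (le_trans (le_normr_Rintegral _ _)) => //.
  by apply: integrable_EFinB => //; exact: intS.
rewrite mulrAC -RintegralZl//.
apply: le_Rintegral => //.
- apply: integrable_norm.
  by apply: integrable_EFinB => //; exact: intS.
- exact: integrable_EFinZl.
- move=> x _; rewrite -mulrBr normrM mulrC ler_wpM2r//.
  rewrite (le_trans (step_lipschitz _ _))// -mulrBr normrM (gtr0_norm k0) ler_wpM2l//.
  by rewrite (_ : x - p - (x - q) = q - p)  1?distrC//; ring.
Qed.

End mollify.

Section weak_derivative.
Context {R : realType}.
Local Notation mu := (@lebesgue_measure R).
Implicit Types (f g : R -> R) (p b : R).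

(** The integrand is the derivative of [step (k * (t - p))], which climbs from 0 to 1 across the
    support [[p - 1/k, p + 1/k]]. *)
Lemma Rintegral_tent_scale (k p : R) : 0 < k ->
  \int[mu]_t (k * tent (k * (t - p))) = 1.
Proof.
move=> k0; have kk : k * k^-1 = 1 by rewrite mulfV// gt_eqF.
have ki : 0 < k^-1 by rewrite invr_gt0.
have -> : \int[mu]_t (k * tent (k * (t - p))) =
    \int[mu]_(t in `[p - k^-1, p + k^-1]) (k * tent (k * (t - p))).
  rewrite [RHS]Rintegral_mkcond; apply: eq_Rintegral => t _.
  rewrite patchE; case: ifPn => //; rewrite notin_setE/= in_itv/= => /negP.
  rewrite negb_and -!ltNge => h; rewrite tent_eq0 ?mulr0//.
  rewrite normrM gtr0_norm// mulrC -ler_pdivrMr// mul1r ler_normr.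
  by case/orP: h => h; apply/orP; [right|left]; lra.
rewrite /Rintegral (@continuous_FTC2 R _ (fun s => step (k * (s - p))))//.
- rewrite -EFinB/= step_eq1 ?step_eq0 ?subr0//.
    by rewrite addrAC subrr add0r mulrN kk.
  by rewrite addrAC subrr add0r kk.
- by rewrite ltrD2l; lra.
- apply: continuous_subspaceT => t; apply: cvgM; first exact: cvg_cst.
  exact: continuous_tent_scale.
- split.
  + by move=> x _; have := is_derive_step_scale k p x => h; exact: ex_derive.
  + by apply: cvg_at_right_filter; exact: continuous_step_scale.
  + by apply: cvg_at_left_filter; exact: continuous_step_scale.
- move=> x _; rewrite derive1E.
  have h := is_derive_step_scale k p x.
  exact: derive_val.
Qed.

(** The scaled hats have mass 1, height [n + 1] and support the closed ball of radius [1 / (n + 1)].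
    The error is thus at most [n + 1] times the integral of [|f - f p|] over that ball, that is
    twice the average there, the ball having length [2 / (n + 1)]. At a Lebesgue point this average
    tends to 0. *)
Lemma cvg_mollif_tent f p : mu.-integrable setT (EFin \o f) -> lebesgue_pt f p ->
  n.+1%:R * (\int[mu]_t (f t * tent (n.+1%:R * (t - p)))) @[n --> \oo] --> f p.
Proof.
move=> fi fp.
have intball (r : R) : mu.-integrable (ball p r) (EFin \o (fun t => f t - f p)).
  apply: integrable_EFinB; first exact: measurable_ball.
    by apply: integrableS fi => //; exact: measurable_ball.
  apply: measurable_bounded_integrable => //; first exact: measurable_ball.
    have [r0|r0] := leP 0 r; first by rewrite /= lebesgue_measure_ball// ltry.
    by rewrite (ball0 _ r).2 ?measure0 ?ltW//.
  by exists `|f p|; split; [exact: num_real|move=> y fy x _; rewrite /= ltW].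
pose d n : R := fine (davg f p (n.+1%:R^-1)).
have dc : d n @[n --> \oo] --> 0.
  have /cvge_at_rightP := fp.
  have h : (forall n : nat, 0 < (n.+1%:R^-1 : R)) /\ (n.+1%:R^-1 : R) @[n --> \oo] --> 0.
    by split => //; exact: cvg_harmonic.
  by move=> /(_ _ h) /fine_cvg.
have dE n : 2 * d n = n.+1%:R * \int[mu]_(t in ball p n.+1%:R^-1) `|f t - f p|.
  rewrite /d /davg /iavg.
  have i0 : 0 < n.+1%:R^-1 :> R by rewrite invr_gt0.
  rewrite lebesgue_measure_ball ?ltW// inver mulrn_eq0/= gt_eqF//.
  rewrite -[X in fine (_ * X)%E]fineK.
    rewrite -EFinM/= mulrA; congr (_ * _).
    by rewrite -[X in _ / X]mulr_natr invfM invrK mulrCA mulfV ?mulr1.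
  apply: integrable_fin_num; first exact: measurable_ball.
  exact: integrable_norm.
have dist n : `|f p - n.+1%:R * (\int[mu]_t (f t * tent (n.+1%:R * (t - p))))| <= 2 * d n.
  rewrite dE; have : 0 < n.+1%:R :> R by rewrite ltr0n.
  move: (n.+1%:R) => k k0.
  have itent : mu.-integrable setT (EFin \o (fun t => k * tent (k * (t - p)))).
    have tE t : k * tent (k * (t - p)) = \1_(`[p - k^-1, p + k^-1]) t * (k * tent (k * (t - p))).
      rewrite indicE; case: (boolP (t \in _)); rewrite ?mul1r// notin_setE/= in_itv/= => /negP.
      rewrite negb_and -!ltNge => h; rewrite tent_eq0 ?mulr0//.
      rewrite normrM gtr0_norm// mulrC -ler_pdivrMr// mul1r ler_normr.
      by case/orP: h => h; apply/orP; [right|left]; lra.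
    rewrite (_ : (fun t => _) = (fun t => \1_(`[p - k^-1, p + k^-1]) t * (k * tent (k * (t - p))))); last first.
      by apply/funext.
    apply: (@continuous_bounded_integrableM _ _ _ k).
    - exact: integrable_indic_itv.
    - by move=> x; apply: cvgM; [exact: cvg_cst|exact: continuous_tent_scale].
    - move=> x; rewrite normrM gtr0_norm// ler_piMr//; first exact: ltW.
      by have /andP[t0 t1] := tent_itv (k * (x - p)); rewrite ger0_norm.
  have iftent : mu.-integrable setT (EFin \o (fun t => f t * tent (k * (t - p)))).
    apply: (@continuous_bounded_integrableM _ _ _ 1) => //; first exact: continuous_tent_scale.
    by move=> x; have /andP[t0 t1] := tent_itv (k * (x - p)); rewrite ger0_norm.
  have -> : f p - k * (\int[mu]_t (f t * tent (k * (t - p)))) =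
       - (\int[mu]_t (k * ((f t - f p) * tent (k * (t - p))))).
    transitivity (- (\int[mu]_t (k * (f t * tent (k * (t - p))) -
       f p * (k * tent (k * (t - p)))))); last first.
      by congr (- _); apply: eq_Rintegral => t _; ring.
    rewrite RintegralB//; [|exact: integrable_EFinZl..].
    by rewrite (RintegralZl _ measurableT iftent) (RintegralZl _ measurableT itent) Rintegral_tent_scale//; ring.
  rewrite normrN.
  have ii : mu.-integrable setT (EFin \o (fun t => k * ((f t - f p) * tent (k * (t - p))))).
    have := integrable_EFinB measurableT (integrable_EFinZl measurableT k iftent)
      (integrable_EFinZl measurableT (f p) itent).
    by apply: eq_integrable => // x _ /=; congr EFin; ring.
  rewrite (le_trans (le_normr_Rintegral _ ii))// -RintegralZl//; [|exact: measurable_ball|]; last first.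
    exact: integrable_norm.
  rewrite [leRHS]Rintegral_mkcond; apply: le_Rintegral => //.
  - exact: integrable_norm.
  - rewrite -restrict_EFin; apply/integrable_restrict => //; first exact: measurable_ball.
    rewrite setTI; apply: integrable_EFinZl; first exact: measurable_ball.
    exact: integrable_norm.
  - move=> t _; rewrite patchE; case: ifPn => [_|].
      rewrite !normrM (gtr0_norm k0) ler_pM2l// ler_piMr//.
      by have /andP[t0 t1] := tent_itv (k * (t - p)); rewrite ger0_norm.
    rewrite notin_setE /ball/= => /negP; rewrite -leNgt => h.
    rewrite tent_eq0 ?mulr0 ?normr0// normrM gtr0_norm// mulrC -ler_pdivrMr// mul1r.
    by rewrite distrC.
apply/cvgrPdist_le => e e0; near=> n.
rewrite (le_trans (dist n))// -ler_pdivlMl//.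
rewrite (le_trans (ler_norm _))//.
near: n.
have /cvgrPdist_le/(_ (2^-1 * e)) := dc.
rewrite mulr_gt0// => /(_ isT); apply: filterS => n.
by rewrite sub0r normrN.
Unshelve. all: by end_near. Qed.

(** Dominated convergence with bound [|g|]: at each [t] other than [p] the sharpening steps are
    eventually equal to 0 or to 1. *)
Lemma cvg_mollif_step g p : mu.-integrable setT (EFin \o g) ->
  \int[mu]_t (g t * step (n.+1%:R * (t - p))) @[n --> \oo] --> \int[mu]_(t in `]p, +oo[) g t.
Proof.
move=> gi; rewrite Rintegral_mkcond.
have mg : measurable_fun setT g by apply/measurable_EFinP; exact: (measurable_int mu).
have gi2 : mu.-integrable setT (EFin \o (g \_ `]p, +oo[)).
  rewrite -restrict_EFin; apply/integrable_restrict => //.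
  by rewrite setTI; apply: integrableS gi.
have [||||| _ _] := @dominated_convergence _ _ _ mu setT measurableT
   (fun n t => (g t * step (n.+1%:R * (t - p)))%:E)
   (EFin \o (g \_ `]p, +oo[)) (EFin \o (fun t => `|g t|)).
- move=> n; apply/measurable_EFinP; apply: measurable_funM => //.
  by apply: continuous_measurable_fun; exact: continuous_step_scale.
- exact: (measurable_int mu).
- have : \forall t \ae mu, t != p.
    exists [set p]; split => //; first exact: lebesgue_measure_set1.
    by move=> x /=; apply: contra_notP => /eqP.
  apply: filterS => t tp _.
  apply: cvg_EFin; first exact: nearW.
  rewrite /= patchE; move: tp; rewrite neq_lt => /orP[tp|pt].
    rewrite memNset//=; last by rewrite in_itv/= andbT; apply/negP; rewrite -leNgt ltW.
    apply: cvg_near_cst.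
    have d0 : 0 < p - t by rewrite subr_gt0.
    have := near_infty_natSinv_lt (PosNum d0); apply: filterS => n /= nd.
    by rewrite step_eq0 ?mulr0// mulrC -ler_pdivlMr// mulN1r -[leLHS]opprB lerN2 ltW.
  rewrite mem_set//=; last by rewrite in_itv/= andbT.
  apply: cvg_near_cst.
  have d0 : 0 < t - p by rewrite subr_gt0.
  have := near_infty_natSinv_lt (PosNum d0); apply: filterS => n /= nd.
  by rewrite step_eq1 ?mulr1// mulrC -ler_pdivrMr// mul1r ltW.
- exact: integrable_norm.
- apply: aeW => t n _; rewrite /= lee_fin normrM ler_piMr//.
  by have /andP[t0 t1] := step_itv (n.+1%:R * (t - p)); rewrite ger0_norm.
- rewrite -[X in _ --> X -> _]fineK; last exact: integrable_fin_num.
  by move/fine_cvg.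
Qed.

End weak_derivative.

(** A nonempty open interval has positive measure, hence is not contained in a null set. This serves
    to pick a good point or a good time near a given one. *)
Lemma ae_exists_itv (R : realType) (a b : R) (P : R -> Prop) : a < b ->
  (\forall t \ae @lebesgue_measure R, P t) -> exists2 t, a < t < b & P t.
Proof.
move=> ab [A [mA A0 PA]]; apply: contrapT => H.
have : (@lebesgue_measure R `]a, b[ <= @lebesgue_measure R A)%E.
  apply: le_measure; rewrite ?inE//.
  move=> x /=; rewrite in_itv/= => xab; apply: PA => /= Px.
  by apply: H; exists x.
by rewrite A0 lebesgue_measure_itv/= lte_fin ab -EFinB lee_fin subr_le0 leNgt ab.
Qed.

Section weak_derivative_primitive.
Context {R : realType}.
Local Notation mu := (@lebesgue_measure R).
Implicit Types (f g : R -> R).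

Lemma locally_integrableT f : mu.-integrable setT (EFin \o f) ->
  locally_integrable setT f.
Proof.
move=> /integrableP[mf fi]; split; [exact/measurable_EFinP|exact: openT|].
move=> K _ cK; apply: le_lt_trans fi; apply: ge0_subset_integral => //.
  exact: compact_measurable.
by apply/measurable_EFinP; apply: measurableT_comp => //; exact/measurable_EFinP.
Qed.

(** At fixed [n] the mollified quantity has the same value at all admissible centres. Letting [n]
    grow at Lebesgue points shows that [f p] plus the integral of [g] beyond [p] is a constant. *)
Lemma weak_deriv_primitive (b : R) f g : 0 < b ->
  mu.-integrable `[0, b] (EFin \o f) -> mu.-integrable `[0, b] (EFin \o g) ->
  (forall (q : rat) n, test_fun 0 b (step_test b (ratr q) n) ->
    \int[mu]_(x in `]0, b[) (f x * derive1 (step_test b (ratr q) n) x) =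
    - \int[mu]_(x in `]0, b[) (g x * step_test b (ratr q) n x)) ->
  exists c, \forall t \ae mu, `[0, b]%classic t ->
    f t = c + \int[mu]_(s in `[0, t]) g s.
Proof.
move=> b0 fi gi wd.
pose F := f \_ `]0, b[; pose G := g \_ `]0, b[.
have sub : `]0, b[ `<=` `[0, b] by exact: subset_itv_oo_cc.
have restr h : mu.-integrable `[0, b] (EFin \o h) ->
    mu.-integrable setT (EFin \o (h \_ `]0, b[)).
  move=> hi; rewrite -restrict_EFin; apply/integrable_restrict => //.
  by rewrite setTI; apply: integrableS hi.
have Fi := restr _ fi; have Gi := restr _ gi.
have good (q : rat) n : n.+1%:R^-1 < ratr q :> R -> ratr q < b - n.+1%:R^-1 ->
    2 * n.+1%:R^-1 < b -> mollif F G n (ratr q) = mollif F G n (b / 2).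
  move=> q0 qb nb; have := wd q n (test_fun_step_test q0 qb nb).
  rewrite [in LHS]Rintegral_mkcond [X in _ = - X -> _]Rintegral_mkcond.
  set k : R := n.+1%:R.
  have -> : (fun x => f x * derive1 (step_test b (ratr q) n) x) \_ `]0, b[ =
     fun x => k * (F x * tent (k * (x - ratr q))) - k * (F x * tent (k * (x - b / 2))).
    apply/funext => x; rewrite /F !patchE; case: ifPn => // _; last by rewrite /point/=; ring.
    by rewrite derive1_step_test -/k; ring.
  have -> : (fun x => g x * (step_test b (ratr q) n) x) \_ `]0, b[ =
     fun x => G x * step (k * (x - ratr q)) - G x * step (k * (x - b / 2)).
    apply/funext => x; rewrite /G !patchE; case: ifPn => // _; last by rewrite /point/=; ring.
    by rewrite /step_test -/k; ring.
  have tentI p : mu.-integrable setT (EFin \o (fun x => F x * tent (k * (x - p)))).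
    apply: (@continuous_bounded_integrableM _ _ _ 1) => //; first exact: continuous_tent_scale.
    by move=> x; have /andP[t0 t1] := tent_itv (k * (x - p)); rewrite ger0_norm.
  have stepI p : mu.-integrable setT (EFin \o (fun x => G x * step (k * (x - p)))).
    apply: (@continuous_bounded_integrableM _ _ _ 1) => //; first exact: continuous_step_scale.
    by move=> x; have /andP[t0 t1] := step_itv (k * (x - p)); rewrite ger0_norm.
  rewrite !RintegralB//; [|exact: integrable_EFinZl..].
  by rewrite !RintegralZl// /mollif -/k; lra.
have goodR p n : n.+1%:R^-1 < p -> p < b - n.+1%:R^-1 ->
    2 * n.+1%:R^-1 < b -> mollif F G n p = mollif F G n (b / 2).
  move=> p0 pb nb; apply/eqP; rewrite -subr_eq0 -normr_le0.
  have [K K0 lipK] := mollif_lipschitz n Fi Gi.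
  apply/ler_addgt0Pr => e e0; rewrite add0r.
  have K1 : 0 < K + 1 by rewrite ltr_wpDl.
  (* The window makes [K * (p - q)] at most [e] and keeps [q] an admissible centre; [K + 1] avoids a
     division by zero. *)
  have [q] : exists q : rat, ratr q \in `](Num.max n.+1%:R^-1 (p - e / (K + 1))), p[.
    apply: rat_in_itvoo; rewrite gt_max p0/= ltrBlDr ltrDl.
    by rewrite divr_gt0.
  rewrite in_itv/= gt_max => /andP[/andP[nq eq] qp].
  rewrite -(good q n)//; last exact: lt_trans pb.
  rewrite (le_trans (lipK _ _))// gtr0_norm ?subr_gt0//.
  have : p - ratr q <= e / (K + 1) by rewrite lerBlDr -lerBlDl ltW.
  rewrite ler_pdivlMr// mulrC; apply: le_trans.
  by rewrite ler_wpM2r ?subr_ge0 ?ltW// ltrDl.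
have lim p : 0 < p < b -> lebesgue_pt F p ->
   mollif F G n (b / 2) @[n --> \oo] --> F p + \int[mu]_(t in `]p, +oo[) G t.
  move=> /andP[p0 pb] Fp.
  have : mollif F G n p @[n --> \oo] --> F p + \int[mu]_(t in `]p, +oo[) G t.
    by apply: cvgD; [exact: cvg_mollif_tent|exact: cvg_mollif_step].
  have d0 : 0 < b - p by rewrite subr_gt0.
  have d1 : 0 < 2^-1 * b by rewrite mulr_gt0.
  apply: cvg_trans; apply: near_eq_cvg; near=> n.
  apply: goodR.
  - near: n; exact: (near_infty_natSinv_lt (PosNum p0)).
  - rewrite ltrBrDr -ltrBrDl; near: n; exact: (near_infty_natSinv_lt (PosNum d0)).
  - by rewrite -ltr_pdivlMl//; near: n; exact: (near_infty_natSinv_lt (PosNum d1)).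
have GE p : 0 < p < b -> \int[mu]_(t in `]p, +oo[) G t =
    \int[mu]_t G t - \int[mu]_(s in `[0, p]) g s.
  move=> /andP[p0 pb].
  have -> : \int[mu]_(s in `[0, p]) g s = \int[mu]_(t in `]-oo, p]) G t.
    rewrite -Rintegral_itv_obnd_cbnd; last first.
      by apply: integrableS gi => //; apply: subset_itv; rewrite bnd_simp// ltW.
    rewrite [LHS]Rintegral_mkcond [RHS]Rintegral_mkcond; apply: eq_Rintegral => x _.
    rewrite /G !patchE; case: ifPn; rewrite ?notin_setE ?inE/= in_itv/=.
      move=> /andP[x0 xp]; rewrite mem_set//= ?mem_set//= in_itv/= ?x0//.
      exact: le_lt_trans pb.
    move/negP => xp; case: ifPn => //; rewrite inE/= in_itv/= => xp2.
    by case: ifPn => //; rewrite inE/= in_itv/= => /andP[x0 _]; move: xp; rewrite x0 xp2.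
  have := @Rintegral_itvB R G -oo%O +oo%O p; rewrite set_itvNyy => -> //.
have ae1 : \forall t \ae mu, lebesgue_pt F t.
  by apply: lebesgue_differentiation; exact: locally_integrableT.
(* The reference point [b / 2] need not be a Lebesgue point. The sequence there converges because it
   eventually coincides with the sequence at some Lebesgue point. *)
have [c climit] : exists c : R, mollif F G n (b / 2) @[n --> \oo] --> c.
  have [p [pb Fp]] : exists p, 0 < p < b /\ lebesgue_pt F p.
    by have [p p0b Fp] := ae_exists_itv b0 ae1; exists p.
  by exists (F p + \int[mu]_(t in `]p, +oo[) G t); exact: lim.
exists (c - \int[mu]_t G t).
have ae0 (x : R) : \forall t \ae mu, t != x.
  exists [set x]; split => //; first exact: lebesgue_measure_set1.
  by move=> y /=; apply: contra_notP => /eqP.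
near=> t; rewrite /= in_itv/= => /andP[t0 tb].
have tb' : 0 < t < b.
  rewrite !lt_neqAle t0 tb !andbT eq_sym; apply/andP; split.
    by near: t.
  by near: t.
have Ft : lebesgue_pt F t by near: t.
have := cvg_unique (@Rhausdorff R) (lim _ tb' Ft) climit; rewrite (GE _ tb').
have FE : F t = f t by rewrite /F patchE mem_set//= in_itv.
by rewrite FE => <-; ring.
Unshelve. all: by end_near. Qed.

End weak_derivative_primitive.

(** * Primitives: product rule, absolute continuity, Gronwall *)

Section fubini_Rintegral.
Context d1 d2 (T1 : measurableType d1) (T2 : measurableType d2) (R : realType).
Context (m1 : {sigma_finite_measure set T1 -> \bar R}).
Context (m2 : {sigma_finite_measure set T2 -> \bar R}).
Variable f : T1 * T2 -> R.
Hypothesis fi : (m1 \x m2)%E.-integrable setT (EFin \o f).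

Let mF : measurable_fun setT (fun x => \int[m2]_y (f (x, y))%:E)%E.
Proof. exact: measurable_fubini_F fi. Qed.

Let mG : measurable_fun setT (fun y => \int[m1]_x (f (x, y))%:E)%E.
Proof. exact: measurable_fubini_G fi. Qed.

(** Where a section is not integrable, [fine] may replace an infinite integral by a default value,
    so the extended and the real-valued integrals agree only a.e. *)
Let FE : ae_eq m1 setT (fun x => \int[m2]_y (f (x, y))%:E)%E
  (EFin \o (fun x => \int[m2]_y f (x, y))).
Proof.
have := ae_integrable1 fi; apply: filterS => x ix _ /=.
by rewrite /Rintegral fineK//; exact: integrable_fin_num.
Qed.

Let GE : ae_eq m2 setT (fun y => \int[m1]_x (f (x, y))%:E)%E
  (EFin \o (fun y => \int[m1]_x f (x, y))).
Proof.
have := ae_integrable2 fi; apply: filterS => x ix _ /=.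
by rewrite /Rintegral fineK//; exact: integrable_fin_num.
Qed.

Let mF' : measurable_fun setT (EFin \o (fun x => \int[m2]_y f (x, y))).
Proof. by apply/measurable_EFinP; apply: measurableT_comp mF. Qed.

Let mG' : measurable_fun setT (EFin \o (fun y => \int[m1]_x f (x, y))).
Proof. by apply/measurable_EFinP; apply: measurableT_comp mG. Qed.

Lemma integrable_Rintegral1 :
  m1.-integrable setT (EFin \o (fun x => \int[m2]_y f (x, y))).
Proof.
have /integrableP[_ iF] := integrable_fubini_F fi.
apply/integrableP; split => //; rewrite (ae_eq_integral (abse \o (fubini_F m2 (EFin \o f))))//.
- exact: measurableT_comp.
- exact: measurableT_comp.
- by apply: filterS FE => x /(_ I) e _; congr (`| _ |%E); exact/esym.
Qed.

Lemma integrable_Rintegral2 :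
  m2.-integrable setT (EFin \o (fun y => \int[m1]_x f (x, y))).
Proof.
have iG : m2.-integrable setT (fubini_G m1 (EFin \o f)).
  apply/integrableP; split => //.
  have := (integrable21ltyP m1 m2 (measurable_int _ fi)).1 fi.
  apply: le_lt_trans; apply: ge0_le_integral => //.
  - exact: measurableT_comp.
  - by apply: (measurable_fun_fubini_tonelli_G (abse \o (EFin \o f))) => //=;
      apply: measurableT_comp => //; exact: measurable_int fi.
  - move=> y _; apply: le_abse_integral => //; apply: measurableT_comp => //.
    exact: measurable_int fi.
have /integrableP[_ {}iG] := iG.
apply/integrableP; split => //; rewrite (ae_eq_integral (abse \o (fubini_G m1 (EFin \o f))))//.
- exact: measurableT_comp.
- exact: measurableT_comp.
- by apply: filterS GE => x /(_ I) e _; congr (`| _ |%E); exact/esym.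
Qed.

Lemma Fubini_Rintegral : \int[m1]_x \int[m2]_y f (x, y) = \int[m2]_y \int[m1]_x f (x, y).
Proof.
rewrite {1}/Rintegral -(ae_eq_integral _ _ _ _ _ FE)//.
rewrite [RHS]/Rintegral -(ae_eq_integral _ _ _ _ _ GE)//.
by rewrite (Fubini fi).
Qed.

End fubini_Rintegral.

Section integration_by_parts_ae.
Context {R : realType}.
Local Notation mu := (@lebesgue_measure R).
Implicit Types (f g : R -> R).

Lemma integrable_tensor (h1 h2 : R -> R) :
  mu.-integrable setT (EFin \o h1) -> mu.-integrable setT (EFin \o h2) ->
  (mu \x mu)%E.-integrable setT (EFin \o (fun p => h1 p.1 * h2 p.2)).
Proof.
move=> h1i h2i.
have mh1 : measurable_fun setT h1 by apply/measurable_EFinP; exact: (measurable_int mu).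
have mh2 : measurable_fun setT h2 by apply/measurable_EFinP; exact: (measurable_int mu).
apply/integrable12ltyP.
  apply/measurable_EFinP; apply: measurable_funM.
    exact: (measurableT_comp mh1).
  exact: (measurableT_comp mh2).
under eq_integral => x _.
  under eq_integral => y _ do rewrite /= normrM EFinM.
  rewrite ge0_integralZl//; last first.
    by apply/measurable_EFinP; exact: measurableT_comp.
  over.
have /integrableP[_ l1] := h1i; have /integrableP[_ l2] := h2i.
rewrite ge0_integralZr//.
- by rewrite lte_mul_pinfty ?integral_ge0// ge0_fin_numE// integral_ge0.
- by apply/measurable_EFinP; exact: measurableT_comp.
- exact: integral_ge0.
Qed.

(** The product is the integral of [f s * g r] over a square, cut along its diagonal into [A] (where
    [r <= s]) and [B] (where [s < r]). Each triangle gives one of the two terms. *)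
Lemma Rintegral_primitiveM (b : R) f g : 0 <= b ->
  mu.-integrable `[0, b] (EFin \o f) -> mu.-integrable `[0, b] (EFin \o g) ->
  (\int[mu]_(s in `[0, b]) f s) * (\int[mu]_(s in `[0, b]) g s) =
  \int[mu]_(s in `[0, b]) (f s * (\int[mu]_(r in `[0, s]) g r)) +
  \int[mu]_(s in `[0, b]) ((\int[mu]_(r in `[0, s]) f r) * g s).
Proof.
move=> b0 fi gi.
pose F := f \_ `[0, b]; pose G := g \_ `[0, b].
have restr h : mu.-integrable `[0, b] (EFin \o h) ->
    mu.-integrable setT (EFin \o (h \_ `[0, b])).
  move=> hi; rewrite -restrict_EFin; apply/integrable_restrict => //.
  by rewrite setTI.
have Fi := restr _ fi; have Gi := restr _ gi.
pose K (p : measurableTypeR R * measurableTypeR R) := F p.1 * G p.2.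
have Ki : (mu \x mu)%E.-integrable setT (EFin \o K) by exact: integrable_tensor.
pose A (p : measurableTypeR R * measurableTypeR R) := if p.2 <= p.1 then K p else 0.
pose B (p : measurableTypeR R * measurableTypeR R) := if p.2 <= p.1 then 0 else K p.
have mK : measurable_fun setT K by apply/measurable_EFinP; exact: (measurable_int (mu \x mu)%E).
have mle : measurable_fun setT (fun p : measurableTypeR R * measurableTypeR R => p.2 <= p.1).
  by apply: measurable_fun_ler.
have mA : measurable_fun setT A by apply: measurable_fun_ifT.
have mB : measurable_fun setT B by apply: measurable_fun_ifT.
have AK p : `|A p| <= `|K p| by rewrite /A; case: ifP => // _; rewrite normr0.
have BK p : `|B p| <= `|K p| by rewrite /B; case: ifP => // _; rewrite normr0.
have Ai : (mu \x mu)%E.-integrable setT (EFin \o A).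
  by apply: le_integrable Ki => //; [exact/measurable_EFinP|move=> p _; rewrite lee_fin].
have Bi : (mu \x mu)%E.-integrable setT (EFin \o B).
  by apply: le_integrable Ki => //; [exact/measurable_EFinP|move=> p _; rewrite lee_fin].
have intA : \int[mu]_x \int[mu]_y A (x, y) =
    \int[mu]_(s in `[0, b]) (f s * (\int[mu]_(r in `[0, s]) g r)).
  rewrite [RHS]Rintegral_mkcond; apply: eq_Rintegral => x _.
  rewrite patchE; case: ifPn => [|xb]; last first.
    (* The right-hand 0 is written as an integral over the empty set, so that the two integrands can
       be compared pointwise. *)
    rewrite -[RHS](Rintegral_set0 mu (cst 0)) [RHS]Rintegral_mkcond.
    apply: eq_Rintegral => y _; rewrite /A /K /F/= !patchE (negbTE xb) mul0r; case: ifP; by case: ifP.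
  rewrite inE/= in_itv/= => /andP[x0 xb].
  rewrite [in RHS]Rintegral_mkcond -RintegralZl//; last first.
    rewrite -restrict_EFin; apply/integrable_restrict => //.
    by rewrite setTI; apply: integrableS gi => //; apply: subset_itv; rewrite bnd_simp.
  apply: eq_Rintegral => y _; rewrite /A /K /F /G/= !patchE/=.
  rewrite mem_set/= ?in_itv/= ?x0//; case: ifPn => yx.
    congr (_ * _); case: ifPn; rewrite ?notin_setE ?inE/= in_itv/=.
      by move=> /andP[y0 yb]; rewrite mem_set//= in_itv/= y0.
    move=> /negP; rewrite (le_trans yx xb) andbT => y0.
    by rewrite memNset//= in_itv/= (negbTE y0).
  rewrite memNset ?mulr0//= in_itv/= (negbTE yx) andbF//.
have intB : \int[mu]_x \int[mu]_y B (x, y) =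
    \int[mu]_(s in `[0, b]) ((\int[mu]_(r in `[0, s]) f r) * g s).
  (* On this triangle the variable of [f] is the bounded one and has to be integrated first. *)
  rewrite (Fubini_Rintegral Bi).
  rewrite [RHS]Rintegral_mkcond; apply: eq_Rintegral => y _.
  rewrite patchE; case: ifPn => [|yb]; last first.
    rewrite -[RHS](Rintegral_set0 mu (cst 0)) [RHS]Rintegral_mkcond.
    apply: eq_Rintegral => x _; rewrite /B /K /G/= !patchE (negbTE yb) mulr0; case: ifP; by case: ifP.
  rewrite inE/= in_itv/= => /andP[y0 yb].
  have fy : mu.-integrable `[0, y[ (EFin \o f).
    by apply: integrableS fi => //; apply: subset_itv; rewrite bnd_simp.
  (* Removing the endpoint [y] matches the strict inequality that defines [B]. *)
  rewrite -Rintegral_itv_bndo_bndc//.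
  rewrite [in RHS]Rintegral_mkcond -RintegralZr//; last first.
    rewrite -restrict_EFin; apply/integrable_restrict => //.
    by rewrite setTI.
  apply: eq_Rintegral => x _; rewrite /B /K /F /G/= !patchE/=.
  rewrite [X in _ * (if X then _ else _)]mem_set/= ?in_itv/= ?y0//; case: ifPn => yx.
    by rewrite memNset ?mul0r//= in_itv/= ltNge yx andbF.
  congr (_ * _); rewrite -ltNge in yx; case: ifPn; rewrite ?notin_setE ?inE/= in_itv/=.
    by move=> /andP[x0 xb]; rewrite mem_set//= in_itv/= x0.
  move=> /negP; rewrite (ltW (lt_le_trans yx yb)) andbT => x0.
  by rewrite memNset//= in_itv/= (negbTE x0).
rewrite -intA -intB -RintegralD//; [|exact: integrable_Rintegral1..].
rewrite (Rintegral_mkcond mu _ f) (Rintegral_mkcond mu _ g) -/F -/G.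
rewrite -(RintegralZr _ measurableT Fi); apply: eq_Rintegral => x _.
have Kx : mu.-integrable setT (EFin \o (fun y => K (x, y))).
  exact: (integrable_EFinZl measurableT (F x) Gi).
rewrite -(RintegralZl _ measurableT Gi) -RintegralD//.
- by apply: eq_Rintegral => y _; rewrite /A /B /K/=; case: ifP; rewrite ?addr0 ?add0r.
- apply: le_integrable Kx => //; last by move=> y _; rewrite lee_fin.
  by apply/measurable_EFinP; apply: (measurableT_comp mA); exact: pair1_measurable.
- apply: le_integrable Kx => //; last by move=> y _; rewrite lee_fin.
  by apply/measurable_EFinP; apply: (measurableT_comp mB); exact: pair1_measurable.
Qed.

Lemma continuous_primitive (b : R) f : 0 <= b ->
  mu.-integrable `[0, b] (EFin \o f) ->
  {within `[0, b], continuous (fun t => \int[mu]_(s in `[0, t]) f s)}.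
Proof. exact: parameterized_integral_continuous. Qed.

Lemma within_continuous_bounded (a b : R) (h : R -> R) :
  {within `[a, b], continuous h} ->
  exists2 K, 0 < K & forall x, a <= x <= b -> `|h x| <= K.
Proof.
move=> hc.
have /compact_bounded[M [_ HM]] := continuous_compact hc (@segment_compact R a b).
exists (Num.max 1 (M + 1)); first by rewrite lt_max ltr01.
move=> x xab; apply: HM; first by rewrite lt_max ltrDl ltr01 orbT.
by exists x => //=; rewrite in_itv.
Qed.

Lemma within_continuous_integrableM (a b : R) f h :
  mu.-integrable `[a, b] (EFin \o f) -> {within `[a, b], continuous h} ->
  mu.-integrable `[a, b] (EFin \o (fun x => f x * h x)).
Proof.
move=> fi hc.
have := @integrableMl _ _ _ mu `[a, b] _ (EFin \o f) h fi.
rewrite /comp/=; apply => //.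
  exact: subspace_continuous_measurable_fun.
have [K _ HK] := within_continuous_bounded hc.
exists K; split; first exact: num_real.
by move=> y Ky x /=; rewrite in_itv/= => /HK/le_trans; apply; exact: ltW.
Qed.

(** Expanding the constants [c] and [d] leaves the product of two pure primitives, which is the case
    of [Rintegral_primitiveM]. *)
Lemma Rintegral_by_parts (b t : R) (c d : R) f g : 0 <= t <= b ->
  mu.-integrable `[0, b] (EFin \o f) -> mu.-integrable `[0, b] (EFin \o g) ->
  let F s := c + \int[mu]_(r in `[0, s]) f r in
  let G s := d + \int[mu]_(r in `[0, s]) g r in
  F t * G t = c * d + \int[mu]_(s in `[0, t]) (f s * G s + F s * g s).
Proof.
move=> /andP[t0 tb] fi gi F G.
have sub : `[0, t] `<=` `[0, b] by apply: subset_itv; rewrite bnd_simp.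
have {}fi : mu.-integrable `[0, t] (EFin \o f) by exact: integrableS fi.
have {}gi : mu.-integrable `[0, t] (EFin \o g) by exact: integrableS gi.
have fcg := within_continuous_integrableM fi (continuous_primitive t0 gi).
have gcf := within_continuous_integrableM gi (continuous_primitive t0 fi).
have fcg' : mu.-integrable `[0, t]
    (EFin \o (fun s => (\int[mu]_(r in `[0, s]) f r) * g s)).
  by apply: eq_integrable gcf => // s _; rewrite /= mulrC.
have -> : \int[mu]_(s in `[0, t]) (f s * G s + F s * g s) =
    \int[mu]_(s in `[0, t]) (d * f s + c * g s +
      (f s * (\int[mu]_(r in `[0, s]) g r) + (\int[mu]_(r in `[0, s]) f r) * g s)).
  by apply: eq_Rintegral => s _; rewrite /F /G; ring.
have dfi : mu.-integrable `[0, t] (EFin \o (fun s => d * f s)) by exact: integrable_EFinZl.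
have cgi : mu.-integrable `[0, t] (EFin \o (fun s => c * g s)) by exact: integrable_EFinZl.
rewrite RintegralD//; [|exact: integrable_EFinD|exact: integrable_EFinD].
rewrite (RintegralD _ dfi cgi)// (RintegralD _ fcg fcg')//.
rewrite (RintegralZl _ _ fi)// (RintegralZl _ _ gi)//.
rewrite -Rintegral_primitiveM// /F /G; ring.
Qed.

(** Cauchy-Schwarz against the constant 1. With [I] the integral of [f] and [Q] that of its square,
    the integral of [((t - s) f - I)^2] is nonnegative and equals [(t - s) ((t - s) Q - I^2)]. *)
Lemma sqr_Rintegral_le (s t : R) f : s <= t ->
  mu.-integrable `[s, t] (EFin \o f) -> mu.-integrable `[s, t] (EFin \o (fun x => f x ^+ 2)) ->
  (\int[mu]_(x in `[s, t]) f x) ^+ 2 <= (t - s) * \int[mu]_(x in `[s, t]) (f x ^+ 2).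
Proof.
rewrite le_eqVlt => /predU1P[->|st] fi f2i.
  by rewrite set_itv1 !Rintegral_set1 expr0n/= mulr0.
set I := \int[mu]_(x in _) f x; set Q := \int[mu]_(x in _) _.
have d0 : 0 < t - s by rewrite subr_gt0.
have : 0 <= \int[mu]_(x in `[s, t]) (((t - s) * f x - I) ^+ 2).
  by apply: Rintegral_ge0 => x _; exact: sqr_ge0.
have ci c : mu.-integrable `[s, t] (EFin \o (cst c)).
  apply: measurable_bounded_integrable => //.
    by rewrite /= lebesgue_measure_itv/= lte_fin st -EFinB ltry.
  by exists `|c|; split; [exact: num_real|move=> y fy x _; rewrite /= ltW].
have -> : \int[mu]_(x in `[s, t]) (((t - s) * f x - I) ^+ 2) =
    \int[mu]_(x in `[s, t]) ((t - s) ^+ 2 * f x ^+ 2 - 2 * (t - s) * I * f x + I ^+ 2).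
  by apply: eq_Rintegral => x _; ring.
rewrite RintegralD//; [|by apply: integrable_EFinB => //; exact: integrable_EFinZl|exact: ci].
rewrite RintegralB//; [|exact: integrable_EFinZl..].
rewrite (RintegralZl _ _ fi)// (RintegralZl _ _ f2i)// Rintegral_cst//.
rewrite (_ : fine _ = t - s); last first.
  by rewrite /= lebesgue_measure_itv/= lte_fin st -EFinB.
rewrite -/I -/Q => h.
by rewrite -(ler_pM2l d0); nra.
Qed.

(** With [Z] the primitive of [z], the function [exp(-t) (K + Z t)] has derivative
    [exp(-t) (z t - (K + Z t)) <= 0] and starts at [K]. Hence [z T <= K + Z T <= exp(T) K]. *)
Lemma gronwall_integral (T K : R) (z : R -> R) : 0 < T ->
  {within `[0, T], continuous z} ->
  (forall t, 0 <= t <= T -> z t <= K + \int[mu]_(s in `[0, t]) z s) ->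
  z T <= expR T * K.
Proof.
move=> T0 zc zK.
have zi : mu.-integrable `[0, T] (EFin \o z).
  by apply: continuous_compact_integrable => //; exact: segment_compact.
pose Z t := \int[mu]_(s in `[0, t]) z s.
pose phi t := expR (- t) * (K + Z t).
have dZ t : t \in `]0, T[ -> is_derive t 1 Z (z t).
  rewrite in_itv/= => /andP[t0 tT].
  have [] := @continuous_FTC1_closed _ z 0 t T tT zi t0.
    have /(continuous_within_itvP _ T0)[zc' _ _] := zc.
    by apply: zc'; rewrite in_itv/= t0.
  by move=> dz <-; rewrite derive1E; exact/derivableP.
have Zc : {within `[0, T], continuous Z} by apply: continuous_primitive => //; exact: ltW.
have [||c] := @MVT_segment _ phi (fun t => expR (- t) * (z t - (K + Z t))) 0 T (ltW T0).
- move=> t tT; have := dZ t tT => h.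
  rewrite /phi (_ : (fun t => _) = (fun t => expR (- t)) * (cst K + Z)); last exact/funext.
  apply: is_derive_eq.
  by rewrite /GRing.scale/= (_ : (cst K + Z) t = K + Z t)//; ring.
- have ec : {within `[0, T], continuous (fun t : R => expR (- t))}.
    apply: continuous_subspaceT => t.
    by apply: continuous_comp; [exact: opp_continuous|exact: continuous_expR].
  move=> t; apply: cvgM; first exact: ec.
  by apply: cvgD; [exact: cvg_cst|exact: Zc].
rewrite in_itv/= => /andP[c0 cT] e.
have : phi T <= phi 0.
  rewrite -subr_le0 e subr0 pmulr_lle0// pmulr_rle0 ?expR_gt0// subr_le0.
  by apply: zK; rewrite c0.
rewrite /phi /Z set_itv1 Rintegral_set1 oppr0 expR0 mul1r addr0 => h.
apply: (le_trans (zK T _)); first by rewrite lexx ltW.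
by rewrite -ler_pdivrMl ?expR_gt0// -expRN.
Qed.

Lemma primitiveB (b s r : R) (h : R -> R) : mu.-integrable `[0, b] (EFin \o h) ->
  0 <= s -> s <= r -> r <= b ->
  \int[mu]_(x in `[0, r]) h x - \int[mu]_(x in `[0, s]) h x = \int[mu]_(x in `]s, r[) h x.
Proof.
move=> hi s0 sr rb.
have hr : mu.-integrable `[0, r] (EFin \o h).
  by apply: integrableS hi => //; apply: subset_itv; rewrite bnd_simp.
rewrite Rintegral_itvB ?bnd_simp// -Rintegral_itv_bndo_bndc//.
by apply: integrableS hi => //; apply: subset_itv; rewrite bnd_simp// ltW.
Qed.

(** The increments of [F] over disjoint intervals sum to at most the integral of [|h|] over their
    union [A], which is small when the measure of [A] is small. *)
Lemma abs_cont_primitive (b c : R) (h F : R -> R) : mu.-integrable `[0, b] (EFin \o h) ->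
  (forall t, 0 <= t <= b -> F t = c + \int[mu]_(s in `[0, t]) h s) ->
  abs_cont 0 b F.
Proof.
move=> hi FE e e0; pose H := h \_ `[0, b].
have Hi : mu.-integrable setT (EFin \o H).
  by rewrite -restrict_EFin; apply/integrable_restrict => //; rewrite setTI.
have [d [d0 Hd]] := integral_normr_continuous Hi e0.
exists d => // n s r sr disj sd.
pose A := \big[setU/set0]_(i < n) `]s i, r i[%classic.
have mA : measurable A by apply: bigsetU_measurable.
have intA (f : R -> R) : measurable_fun setT f ->
    (\int[mu]_(x in A) (f x)%:E = \sum_(i < n) \int[mu]_(x in `]s i, r i[) (f x)%:E)%E.
  move=> mf; apply: integral_bigsetU_EFin => //.
  - exact: index_enum_uniq.
  - move=> i j _ _ /set0P/eqP ij; apply: contrapT => /eqP/disj.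
    exact: ij.
  - by apply: (@measurable_funS _ _ _ _ setT) => //; exact/measurable_EFinP.
have muA : (mu A < d%:E)%E.
  have -> : mu A = (\int[mu]_(x in A) 1%:E)%E.
    by rewrite integral_cst// mul1e.
  rewrite (intA (fun=> 1))//.
  have len i : (\int[mu]_(x in `]s i, r i[) 1%:E = (r i - s i)%:E)%E.
    rewrite integral_cst// mul1e /= lebesgue_measure_itv/= lte_fin.
    have [_ [+ _]] := sr i; rewrite le_eqVlt => /predU1P[->|->//].
    by rewrite ltxx subrr.
  under eq_bigr do rewrite len.
  by rewrite sumEFin lte_fin.
apply: le_lt_trans (Hd A mA muA).
have mH : measurable_fun setT H by apply/measurable_EFinP; exact: (measurable_int mu).
have Hin i : mu.-integrable `]s i, r i[ (EFin \o (fun x => `|H x|)).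
  by apply: integrableS (integrable_norm Hi).
rewrite -lee_fin -sumEFin /Rintegral fineK; last first.
  apply: integrable_fin_num => //.
  by apply: integrableS (integrable_norm Hi).
rewrite (intA (fun x => `|H x|)); last exact: measurableT_comp.
apply: lee_sum => i _; have [s0 [sri rb]] := sr i.
rewrite -[leRHS]fineK ?integrable_fin_num// lee_fin.
rewrite !FE ?s0 ?rb ?(le_trans sri) ?(le_trans s0)//.
rewrite opprD addrACA subrr add0r (primitiveB hi)//.
have -> : \int[mu]_(x in `]s i, r i[) h x = \int[mu]_(x in `]s i, r i[) H x.
  apply: eq_Rintegral => x; rewrite inE/= in_itv/= => /andP[sx xr].
  rewrite /H patchE mem_set//= in_itv/= (le_trans s0 (ltW sx)).
  exact: le_trans (ltW xr) rb.
by apply: le_normr_Rintegral => //; exact: integrableS Hi.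
Qed.

End integration_by_parts_ae.

(** * Fields on the space-time rectangle *)

Section product_ae.
Context d1 d2 (T1 : measurableType d1) (T2 : measurableType d2) (R : realType).
Context (m1 : {sigma_finite_measure set T1 -> \bar R}).
Context (m2 : {sigma_finite_measure set T2 -> \bar R}).

(** Tonelli applies to the positive and negative parts separately, and [fine] is measurable, so the
    default value taken at non-integrable sections does no harm. *)
Lemma measurable_Rintegral1 (f : T1 * T2 -> R) : measurable_fun setT f ->
  measurable_fun setT (fun x => \int[m2]_y f (x, y)).
Proof.
move=> mf.
have mF : measurable_fun setT (EFin \o f) by exact/measurable_EFinP.
rewrite /Rintegral; apply: measurableT_comp => //.
rewrite (_ : (fun x => _) = (fun x => (\int[m2]_y (EFin \o f)^\+ (x, y)) -
    (\int[m2]_y (EFin \o f)^\- (x, y)))%E); last first.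
  apply/funext => x; rewrite integralE; congr (_ - _)%E;
    by apply: eq_integral => y _; rewrite ?funeposE ?funenegE.
apply: emeasurable_funB.
  by apply: (measurable_fun_fubini_tonelli_F ((EFin \o f)^\+)%E) => //; exact: measurable_funepos.
by apply: (measurable_fun_fubini_tonelli_F ((EFin \o f)^\-)%E) => //; exact: measurable_funeneg.
Qed.

Let negl_integral0 d (X : measurableType d) (m : {measure set X -> \bar R}) (g : X -> \bar R) :
  measurable_fun setT g -> (forall x, 0 <= g x)%E ->
  (\int[m]_x g x = 0)%E <-> \forall x \ae m, g x = 0%E.
Proof.
move=> mg g0; have := ae_eq_integral_abs m measurableT mg.
have -> : (\int[m]_x `|g x| = \int[m]_x g x)%E.
  by apply: eq_integral => x _; rewrite gee0_abs.
move=> [h1 h2]; split.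
  by move=> /h1; apply: filterS => x /(_ I).
by move=> h; apply: h2; apply: filterS h.
Qed.

Let ae_iter (f : T1 * T2 -> \bar R) : measurable_fun setT f ->
  (forall p, 0 <= f p)%E -> (\int[m2]_y \int[m1]_x f (x, y) = 0)%E ->
  \forall y \ae m2, \forall x \ae m1, f (x, y) = 0%E.
Proof.
move=> mf f0 int0.
have mG := measurable_fun_fubini_tonelli_G (m1 := m1) f mf f0.
have G0 : (forall y, 0 <= fubini_G m1 f y)%E by move=> y; exact: integral_ge0.
have := (negl_integral0 m2 mG G0).1 int0.
apply: filterS => y y0.
have mfy : measurable_fun setT (fun x => f (x, y)) by exact: measurable_fun_pair1.
exact: (negl_integral0 m1 mfy (fun x => f0 (x, y))).1 y0.
Qed.

(** Tonelli for the indicator of a measurable null set that contains the exceptional points. *)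
Lemma ae_prod_ysection (P : set (T1 * T2)) : (\forall p \ae (m1 \x m2)%E, P p) ->
  \forall y \ae m2, \forall x \ae m1, P (x, y).
Proof.
move=> [N [mN N0 PN]].
have mF : measurable_fun setT (EFin \o (\1_N : T1 * T2 -> R)).
  by apply/measurable_EFinP; exact: measurable_indic.
have := @ae_iter _ mF; rewrite -(fubini_tonelli2 (EFin \o \1_N))//=.
rewrite integral_indic// setIT => /(_ _ N0) H.
have := H (fun p => ltac:(by rewrite lee_fin)); apply: filterS => y.
apply: filterS => x; rewrite indicE; case: (boolP (_ \in _)) => [_ []/eqP|].
  by rewrite oner_eq0.
by rewrite notin_setE => xyN _; apply: contrapT => /PN.
Qed.

(** Both iterated integrals of [|f|] are equal by Tonelli, so one vanishes with the other. This is
    where joint measurability pays for the exchange of the two a.e. quantifiers. *)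
Lemma ae_swap (f : T1 * T2 -> R) : measurable_fun setT f ->
  (\forall x \ae m1, \forall y \ae m2, f (x, y) = 0) ->
  \forall y \ae m2, \forall x \ae m1, f (x, y) = 0.
Proof.
move=> mf f0.
have mF : measurable_fun setT (fun p => (`|f p|%:E)).
  by apply/measurable_EFinP; exact: measurableT_comp.
have F0 p : (0 <= `|f p|%:E)%E by rewrite lee_fin.
have : \forall y \ae m2, \forall x \ae m1, (`|f (x, y)|%:E = 0)%E.
  apply: (ae_iter mF F0).
  rewrite -(fubini_tonelli (fun p => `|f p|%:E))//.
  have mG := measurable_fun_fubini_tonelli_F (m2 := m2) _ mF F0.
  apply/(negl_integral0 m1 mG); first by move=> x; exact: integral_ge0.
  apply: filterS f0 => x f0.
  have mfx : measurable_fun setT (fun y => `|f (x, y)|%:E) by exact: (measurable_fun_pair2 x mF).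
  apply/(negl_integral0 m2 mfx) => //.
  by apply: filterS f0 => y ->; rewrite normr0.
by apply: filterS => y; apply: filterS => x [] /eqP; rewrite normr_eq0 => /eqP.
Qed.

End product_ae.

Section fields.
Context {R : realType} (l T : R).
Local Notation mu := (@lebesgue_measure R).
Local Notation RR := (measurableTypeR R * measurableTypeR R)%type.
Local Notation D := (Omega l `*` timeI T : set RR).

(** Extension by zero outside the rectangle, so that results on the full product space and on its
    sections apply. *)
Definition cut (a : R -> R -> R) (p : RR) : R := ((fun p => a p.1 p.2) \_ D) p.

Lemma cutE a x t : Omega l x -> timeI T t -> cut a (x, t) = a x t.
Proof. by move=> xl tT; rewrite /cut patchE mem_set. Qed.

Lemma cut_out a x t : ~ (Omega l x /\ timeI T t) -> cut a (x, t) = 0.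
Proof. by move=> xt; rewrite /cut patchE memNset. Qed.

Let mD : measurable D.
Proof. by apply: measurableX; exact: measurable_itv. Qed.

Lemma measurable_cut (a : R -> R -> R) :
  measurable_fun D (fun p => a p.1 p.2) -> measurable_fun setT (cut a).
Proof. by move=> ma; apply/(measurable_restrictT _ mD). Qed.

Lemma integrable_cut (F : R -> R -> R) :
  measurable_fun D (fun p => F p.1 p.2) ->
  (forall x t, Omega l x -> timeI T t -> 0 <= F x t) ->
  (\int[mu]_(t in timeI T) \int[mu]_(x in Omega l) (F x t)%:E < +oo)%E ->
  (mu \x mu)%E.-integrable setT (EFin \o cut F).
Proof.
move=> mF F0 Foo.
have mc : measurable_fun setT (EFin \o cut F) by apply/measurable_EFinP; exact: measurable_cut.
apply/(integrable21ltyP _ _ mc); apply: le_lt_trans Foo.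
rewrite [leRHS]integral_mkcond le_eqVlt; apply/orP; left; apply/eqP.
apply: eq_integral => t _; rewrite patchE; case: ifPn => tT.
  rewrite [RHS]integral_mkcond; apply: eq_integral => x _.
  rewrite patchE; case: ifPn => xl /=.
    by rewrite cutE ?ger0_norm ?F0//; exact: set_mem.
  by rewrite cut_out ?normr0// => -[xl' _]; move: xl; rewrite mem_set.
rewrite -[RHS](integral0 mu setT); apply: eq_integral => x _ /=.
by rewrite cut_out ?normr0// => -[_ tT']; move: tT; rewrite mem_set.
Qed.

(* [a] belongs to L^2(Omega x ]0,T[) *)
Definition sqfield (a : R -> R -> R) : Prop :=
  measurable_fun D (fun p => a p.1 p.2) /\
  (mu \x mu)%E.-integrable setT (EFin \o (fun p => cut a p ^+ 2)).

Lemma inL2L2_sqfield n (u : R -> R -> 'cV[R]_n) i : inL2L2 l T u ->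
  sqfield (fun x t => u x t i ord0).
Proof.
move=> [ju uoo]; split; first exact: ju.
have msum : measurable_fun D (fun p => dotv (u p.1 p.2) (u p.1 p.2)).
  rewrite (_ : (fun p => _) = (fun p => \sum_j u p.1 p.2 j ord0 * u p.1 p.2 j ord0)); last first.
    by apply/funext => p; rewrite /dotv mxE; apply: eq_bigr => j _; rewrite mxE.
  by apply: measurable_sum => j; apply: measurable_funM; exact: ju.
have := @integrable_cut (fun x t => dotv (u x t) (u x t)) msum.
have nn (v : 'cV[R]_n) : dotv v v = \sum_j v j ord0 ^+ 2.
  by rewrite /dotv mxE; apply: eq_bigr => j _; rewrite mxE.
have H : (\int[mu]_(t in timeI T) \int[mu]_(x in Omega l) (dotv (u x t) (u x t))%:E < +oo)%E.
  have e x t : dotv (u x t) (1%:M *m u x t) = dotv (u x t) (u x t) by rewrite mul1mx.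
  by under eq_integral do under eq_integral do rewrite -e.
move=> /(_ _ H) I1.
have /le_integrable_EFin : (mu \x mu)%E.-integrable setT
   (EFin \o cut (fun x t => dotv (u x t) (u x t))).
  by apply: I1 => x t _ _; rewrite nn; apply: sumr_ge0 => j _; rewrite sqr_ge0.
apply => //.
  apply: measurable_funX; apply: measurable_cut; exact: ju.
move=> [x t] _; rewrite ger0_norm ?sqr_ge0//.
have [[xl tT]|out] := pselect (Omega l x /\ timeI T t).
  rewrite !cutE// nn (bigD1 i)//= lerDl.
  by apply: sumr_ge0 => j _; rewrite sqr_ge0.
by rewrite !cut_out// expr0n.
Qed.

End fields.

(** * The representative that is continuous in time *)

Section time_representative.
Context {R : realType} (l T : R) (hT : 0 < T).
Local Notation mu := (@lebesgue_measure R).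
Local Notation RR := (measurableTypeR R * measurableTypeR R)%type.
Local Notation cut := (cut l T).
Local Notation sqfield := (sqfield l T).
Implicit Types a b : R -> R -> R.

Lemma measurable_cutT a : sqfield a -> measurable_fun setT (cut a).
Proof. by move=> [ma _]; exact: measurable_cut. Qed.

Lemma integrable_cutM a b : sqfield a -> sqfield b ->
  (mu \x mu)%E.-integrable setT (EFin \o (fun p => cut a p * cut b p)).
Proof.
move=> sa sb; have mca := measurable_cutT sa; have mcb := measurable_cutT sb.
apply: (@le_integrable_EFin _ _ _ _ _ _ _ (fun p => cut a p ^+ 2 + cut b p ^+ 2)) => //.
- exact: measurable_funM.
- move=> p _; have := sqr_ge0 (`|cut a p| - `|cut b p|).
  rewrite sqrrB !real_normK ?num_real// normrM.
  have := mulr_ge0 (normr_ge0 (cut a p)) (normr_ge0 (cut b p)); lra.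
- by apply: integrable_EFinD => //; [exact: sa.2|exact: sb.2].
Qed.

Lemma integrable_itv_cst (s t c : R) : mu.-integrable `[s, t] (EFin \o (fun=> c)).
Proof.
apply: measurable_bounded_integrable => //.
  by rewrite /= lebesgue_measure_itv/=; case: ifP => // _; rewrite -EFinB ltry.
by exists `|c|; split; [exact: num_real|move=> y fy x _; rewrite /= ltW].
Qed.

Lemma sq_integrable_itv (f : R -> R) (s t : R) : measurable_fun setT f ->
  mu.-integrable setT (EFin \o (fun x => f x ^+ 2)) -> mu.-integrable `[s, t] (EFin \o f).
Proof.
move=> mf f2; apply: (@le_integrable_EFin _ _ _ mu `[s, t] _ f (fun x => 1 + f x ^+ 2)) => //.
- exact: measurable_funS mf.
- move=> x _; have := sqr_ge0 (`|f x| - 1).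
  by rewrite sqrrB real_normK ?num_real// mulr1 expr1n; have := sqr_ge0 `|f x|; rewrite real_normK ?num_real//; lra.
- apply: integrable_EFinD => //; first exact: integrable_itv_cst.
  exact: integrableS f2.
Qed.

(* [time_mean] is the value of the a.e. constant [a - time_prim b]; defining it as a
   mean makes it measurable in x. *)
Definition time_prim b x t : R := \int[mu]_(s in `[0, t]) cut b (x, s).

Definition time_mean a b x : R :=
  T^-1 * \int[mu]_(s in `[0, T]) (cut a (x, s) - time_prim b x s).

(** When [b] is the weak time derivative of [a], this is the representative of [a] that is
    absolutely continuous in time for a.e. x. *)
Definition time_ac a b x t : R := time_mean a b x + time_prim b x t.

Lemma measurable_time_prim b : sqfield b ->
  measurable_fun setT (fun p : RR => time_prim b p.1 p.2).
Proof.
move=> sb; have mcb := measurable_cutT sb.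
(* The variable endpoint of integration becomes a condition on the triple (x, t, s), and
   measurability follows from integrating out [s] over the whole line. *)
rewrite (_ : (fun p => _) = (fun p : RR => \int[mu]_s
   (if (0 <= s) && (s <= p.2) then cut b (p.1, s) else 0))); last first.
  apply/funext => p; rewrite /time_prim Rintegral_mkcond; apply: eq_Rintegral => s _.
  by rewrite patchE mem_setE in_itv.
apply: (@measurable_Rintegral1 _ _ _ _ _ mu (fun q : RR * measurableTypeR R =>
   if (0 <= q.2) && (q.2 <= q.1.2) then cut b (q.1.1, q.2) else 0)).
apply: measurable_fun_ifT => //.
- apply: measurable_and.
    by apply: measurable_fun_ler.
  apply: measurable_fun_ler => //.
  by apply: (measurableT_comp measurable_snd); exact: measurable_fst.
- apply: (measurableT_comp mcb); apply: measurable_fun_pair => //.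
  by apply: (measurableT_comp measurable_fst); exact: measurable_fst.
Qed.

Lemma measurable_time_mean a b : sqfield a -> sqfield b ->
  measurable_fun setT (time_mean a b).
Proof.
move=> sa sb; apply: measurable_funM => //.
rewrite (_ : (fun x => _) = (fun x => \int[mu]_s
   (if (0 <= s) && (s <= T) then cut a (x, s) - time_prim b x s else 0))); last first.
  apply/funext => x; rewrite Rintegral_mkcond; apply: eq_Rintegral => s _.
  by rewrite patchE mem_setE in_itv.
apply: (@measurable_Rintegral1 _ _ _ _ _ mu (fun q : RR =>
   if (0 <= q.2) && (q.2 <= T) then cut a q - time_prim b q.1 q.2 else 0)).
apply: measurable_fun_ifT => //.
  by apply: measurable_and; apply: measurable_fun_ler.
by apply: measurable_funB; [exact: measurable_cutT|exact: measurable_time_prim].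
Qed.

Lemma measurable_time_ac a b : sqfield a -> sqfield b ->
  measurable_fun setT (fun p : RR => time_ac a b p.1 p.2).
Proof.
move=> sa sb; apply: measurable_funD; last exact: measurable_time_prim.
by apply: (measurableT_comp (measurable_time_mean sa sb)); exact: measurable_fst.
Qed.

Lemma time_ac0 a b x : time_ac a b x 0 = time_mean a b x.
Proof. by rewrite /time_ac /time_prim set_itv1 Rintegral_set1 addr0. Qed.

Lemma ae_sq_section a : sqfield a ->
  \forall x \ae mu, mu.-integrable setT (EFin \o (fun t => cut a (x, t) ^+ 2)).
Proof. by move=> [_ /ae_integrable1]. Qed.

Lemma ae_sq_section_itv a s t : sqfield a ->
  \forall x \ae mu, mu.-integrable `[s, t] (EFin \o (fun t => cut a (x, t))).
Proof.
move=> sa; apply: filterS (ae_sq_section sa) => x; apply: sq_integrable_itv.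
by apply: (measurable_fun_pair2 x); exact: measurable_cutT.
Qed.

Section weak_time_derivative.
Variables a b : R -> R -> R.
Hypotheses (sa : sqfield a) (sb : sqfield b).
Hypothesis wd : forall phi, test_fun 0 T phi ->
  (fun x => \int[mu]_(t in timeI T) (a x t * derive1 phi t)) =
  (fun x => - \int[mu]_(t in timeI T) (b x t * phi t)) %[ae mu in Omega l].

Lemma ae_time_primitive : \forall x \ae mu, Omega l x ->
  exists c, \forall t \ae mu, `[0, T]%classic t -> cut a (x, t) = c + time_prim b x t.
Proof.
(* The pairs (q, n) are coded by natural numbers, so that one null set of x serves for all of them;
   codes of no pair and inadmissible steps are vacuous. *)
have wdn : \forall x \ae mu, forall k : nat, Omega l x -> forall (q : rat) n,
    unpickle k = Some (q, n) -> test_fun 0 T (step_test T (ratr q) n) ->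
    \int[mu]_(t in `]0, T[) (cut a (x, t) * derive1 (step_test T (ratr q) n) t) =
    - \int[mu]_(t in `]0, T[) (cut b (x, t) * step_test T (ratr q) n t).
  apply: ae_foralln => k; case e : (unpickle k) => [[q n]|]; last first.
    by apply: filterS (filterT : \forall x \ae mu, True).
  have [tf|ntf] := pselect (test_fun 0 T (step_test T (ratr q) n)); last first.
    by apply: filterS (filterT : \forall x \ae mu, True) => x _ _ ? ? [<- <-].
  apply: filterS (wd tf) => x + xl => /(_ xl) wdx ? ? [<- <-] _.
  transitivity (\int[mu]_(t in timeI T) (a x t * derive1 (step_test T (ratr q) n) t)).
    by apply: eq_Rintegral => t; rewrite inE => tT; rewrite cutE.
  rewrite wdx; congr (- _).
  by apply: eq_Rintegral => t; rewrite inE => tT; rewrite cutE.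
apply: filterS3 wdn (ae_sq_section_itv 0 T sa) (ae_sq_section_itv 0 T sb) => x H ai bi xl.
apply: weak_deriv_primitive => // q n tf.
exact: (H (pickle (q, n)) xl q n (pickleK _)).
Qed.

(** Averaging the identity [a - time_prim b = c] over [[0, T]] identifies the constant [c] with
    [time_mean]. *)
Lemma ae_time_ac : \forall x \ae mu, Omega l x ->
  mu.-integrable `[0, T] (EFin \o (fun t => cut b (x, t))) /\
  \forall t \ae mu, `[0, T]%classic t -> cut a (x, t) = time_ac a b x t.
Proof.
apply: filterS3 ae_time_primitive (ae_sq_section_itv 0 T sa) (ae_sq_section_itv 0 T sb).
move=> x H ai bi xl; split => //; have [c cE] := H xl.
suff -> : time_ac a b x = fun t => c + time_prim b x t by [].
apply/funext => t; rewrite /time_ac /time_mean; congr (_ + _).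
rewrite (@ae_eq_Rintegral _ _ _ _ _ _ (fun s => cut a (x, s) - time_prim b x s) (fun=> c))//.
- rewrite Rintegral_cst//= lebesgue_measure_itv/= lte_fin hT -EFinB/= subr0.
  by rewrite mulrCA mulVf ?mulr1// gt_eqF.
- apply: measurable_funS measurableT _ _ => //; apply: measurable_funB.
    by apply: (measurable_fun_pair2 x); exact: measurable_cutT.
  by have := measurable_fun_pair2 x (measurable_time_prim sb).
- by apply: filterS cE => s + sT => /(_ sT) ->; rewrite addrK.
Qed.

Lemma ae_time_ac_swap : \forall t \ae mu, timeI T t ->
  \forall x \ae mu, Omega l x -> time_ac a b x t = a x t.
Proof.
have mf : measurable_fun setT (fun p : RR => cut a p - cut (time_ac a b) p).
  apply: measurable_funB; apply: measurable_cut; first exact: sa.1.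
  exact: measurable_funS (measurable_time_ac sa sb).
have := @ae_swap _ _ _ _ _ mu mu _ mf; move=> /(_ _)/filterS; apply.
  move=> t H tT; apply: filterS H => x + xl.
  by rewrite !cutE// => /subr0_eq ->.
apply: filterS ae_time_ac => x H.
have [xl|nxl] := pselect (Omega l x); last first.
  by apply: filterS (filterT : \forall x \ae mu, True) => t _; rewrite !cut_out ?subr0// => -[].
have [_ {}H] := H xl; apply: filterS H => t.
have [tT|ntT] := pselect (timeI T t); last by rewrite !cut_out ?subr0// => -[].
move=> H; rewrite H ?cutE ?subrr//.
by move: tT; rewrite /timeI/= !in_itv/= => /andP[/ltW -> /ltW].
Qed.

End weak_time_derivative.
End time_representative.

(** The function [min |f| g] is dominated by [|g|] everywhere and equals [|f|] a.e. on [D]. *)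
Lemma ae_le_integrable_EFin d (X : measurableType d) (R : realType)
    (m : {measure set X -> \bar R}) (D : set X) (f g : X -> R) : measurable D ->
  measurable_fun D f -> (\forall x \ae m, D x -> `|f x| <= g x) ->
  m.-integrable D (EFin \o g) -> m.-integrable D (EFin \o f).
Proof.
move=> mD mf fg gi.
have mg : measurable_fun D g by apply/measurable_EFinP; exact: (measurable_int m).
have mn : measurable_fun D (fun x => `|f x|) by exact: measurableT_comp.
have hi : m.-integrable D (EFin \o (fun x => Num.min `|f x| (g x))).
  apply: (le_integrable_EFin mD _ _ (integrable_norm gi)) => /=.
    exact: measurable_minr.
  move=> x _; case: (leP `|f x| (g x)) => //.
  by rewrite normr_id => /le_trans; apply; exact: ler_norm.
have ni : m.-integrable D (EFin \o (fun x => `|f x|)).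
  apply: ae_eq_integrable_EFin hi => //.
  by apply: filterS fg => x + Dx => /(_ Dx) /min_idPl ->.
exact: (le_integrable_EFin mD mf _ ni).
Qed.

Section time_representative_L2.
Context {R : realType} (l T : R) (hT : 0 < T).
Local Notation mu := (@lebesgue_measure R).
Local Notation RR := (measurableTypeR R * measurableTypeR R)%type.
Local Notation cut := (cut l T).
Local Notation sqfield := (sqfield l T).
Local Notation time_prim := (time_prim l T).
Local Notation time_ac := (time_ac l T).
Implicit Types a b : R -> R -> R.

Definition sqnorm b : R := \int[mu]_x \int[mu]_r (cut b (x, r) ^+ 2).

(** Cauchy-Schwarz in time at a.e. x. Integrated over x, it makes [time_ac] Hölder continuous in
    time with exponent 1/2, with values in L^2. *)
Lemma ae_sqr_time_primB b (s t : R) : sqfield b -> 0 <= s <= T -> 0 <= t <= T ->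
  \forall x \ae mu, (time_prim b x s - time_prim b x t) ^+ 2 <=
     `|s - t| * \int[mu]_r (cut b (x, r) ^+ 2).
Proof.
move=> sb; wlog st : s t / s <= t.
  move=> H hs ht; have [/H|/ltW/H] := leP s t; first exact.
  move=> /(_ ht hs); apply: filterS => x.
  by rewrite -sqrrN opprB distrC.
move=> /andP[s0 sT] /andP[t0 tT].
apply: filterS2 (ae_sq_section sb) (ae_sq_section_itv 0 T sb) => x b2 b1.
have sub : `[s, t] `<=` `[0, T] by apply: subset_itv; rewrite bnd_simp.
rewrite -sqrrN opprB /time_prim (primitiveB b1)// ler0_norm ?subr_le0// opprB.
have b1' : mu.-integrable `[s, t] (EFin \o (fun r => cut b (x, r))) by exact: integrableS b1.
have b1'' : mu.-integrable `[s, t[ (EFin \o (fun r => cut b (x, r))).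
  by apply: integrableS b1' => //; apply: subset_itv; rewrite bnd_simp.
have b1''' : mu.-integrable `]s, t[ (EFin \o (fun r => cut b (x, r))).
  by apply: integrableS b1' => //; apply: subset_itv; rewrite bnd_simp.
rewrite Rintegral_itv_obnd_cbnd// Rintegral_itv_bndo_bndc//.
have b2' : mu.-integrable `[s, t] (EFin \o (fun r => cut b (x, r) ^+ 2)) by exact: integrableS b2.
apply: le_trans (sqr_Rintegral_le st b1' b2') _.
rewrite ler_wpM2l ?subr_ge0// Rintegral_mkcond.
apply: le_Rintegral => //.
- rewrite -restrict_EFin; apply/integrable_restrict => //; by rewrite setTI.
- by move=> r _; rewrite patchE; case: ifP => // _; exact: sqr_ge0.
Qed.

Variables a b : R -> R -> R.
Hypotheses (sa : sqfield a) (sb : sqfield b).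
Hypothesis wd : forall phi, test_fun 0 T phi ->
  (fun x => \int[mu]_(t in timeI T) (a x t * derive1 phi t)) =
  (fun x => - \int[mu]_(t in timeI T) (b x t * phi t)) %[ae mu in Omega l].

Lemma measurable_time_ac_section t : measurable_fun setT (time_ac a b ^~ t).
Proof. by have := measurable_fun_pair1 t (measurable_time_ac sa sb). Qed.

Lemma sqr_time_acB s t : 0 <= s <= T -> 0 <= t <= T ->
  mu.-integrable (Omega l) (EFin \o (fun x => (time_ac a b x s - time_ac a b x t) ^+ 2)) /\
  \int[mu]_(x in Omega l) ((time_ac a b x s - time_ac a b x t) ^+ 2) <= `|s - t| * sqnorm b.
Proof.
move=> hs ht; have mO : measurable (Omega l) by exact: measurable_itv.
have dE x : time_ac a b x s - time_ac a b x t = time_prim b x s - time_prim b x t.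
  by rewrite /time_ac opprD addrACA subrr add0r.
have Bi : mu.-integrable setT (EFin \o (fun x => `|s - t| * \int[mu]_r (cut b (x, r) ^+ 2))).
  by apply: integrable_EFinZl => //; exact: (integrable_Rintegral1 sb.2).
have m2 : measurable_fun setT (fun x => (time_ac a b x s - time_ac a b x t) ^+ 2).
  by apply: measurable_funX; apply: measurable_funB; exact: measurable_time_ac_section.
have le2 := ae_sqr_time_primB sb hs ht.
have i2 : mu.-integrable setT (EFin \o (fun x => (time_ac a b x s - time_ac a b x t) ^+ 2)).
  apply: (ae_le_integrable_EFin _ _ _ Bi) => //.
  by apply: filterS le2 => x h _; rewrite ger0_norm ?sqr_ge0// dE.
split; first exact: integrableS i2.
rewrite /sqnorm -RintegralZl//; last exact: (integrable_Rintegral1 sb.2).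
rewrite Rintegral_mkcond; apply: ae_le_Rintegral => //.
  by rewrite -restrict_EFin; apply/integrable_restrict => //; rewrite setTI; exact: integrableS i2.
apply: filterS le2 => x + _; rewrite patchE -dE; case: ifP => // _.
by apply: le_trans; exact: sqr_ge0.
Qed.

(** At a.e. time [time_ac] agrees with [a] and the section of [a] is square integrable. One such
    time [t0] is fixed, and the bound on increments carries integrability from [t0] to every [t]. *)
Lemma sqr_time_ac_integrable t : 0 <= t <= T ->
  mu.-integrable (Omega l) (EFin \o (fun x => time_ac a b x t ^+ 2)).
Proof.
move=> ht; have mO : measurable (Omega l) by exact: measurable_itv.
have ae2 : \forall t \ae mu, mu.-integrable setT (EFin \o (fun x => cut a (x, t) ^+ 2)).
  exact: (ae_integrable2 sa.2).
have [t0 t0T [a2 ac]] := ae_exists_itv hT (filterI ae2 (ae_time_ac_swap hT sa sb wd)).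
have t0I : timeI T t0 by rewrite /timeI/= in_itv.
have ht0 : 0 <= t0 <= T by case/andP: t0T => /ltW -> /ltW.
have i0 : mu.-integrable (Omega l) (EFin \o (fun x => time_ac a b x t0 ^+ 2)).
  apply: (@ae_eq_integrable_EFin _ _ _ mu (Omega l) _ _ (fun x => cut a (x, t0) ^+ 2)) => //.
  - apply: measurable_funX; exact: measurable_funS (measurable_time_ac_section t0).
  - by apply: filterS (ac t0I) => x + xl => /(_ xl) ->; rewrite cutE.
  - exact: integrableS a2.
have [id _] := sqr_time_acB ht ht0.
apply: (@le_integrable_EFin _ _ _ mu (Omega l) _ _
   (fun x => 2 * (time_ac a b x t - time_ac a b x t0) ^+ 2 + 2 * time_ac a b x t0 ^+ 2)) => //.
- apply: measurable_funX; exact: measurable_funS (measurable_time_ac_section t).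
- move=> x _; rewrite ger0_norm ?sqr_ge0//.
  (* The two sides differ by [(p - 2 q)^2]. *)
  have sq (p q : R) : p ^+ 2 <= 2 * (p - q) ^+ 2 + 2 * q ^+ 2.
    by have := sqr_ge0 (p - 2 * q); lra.
  exact: sq.
- by apply: integrable_EFinD => //; apply: integrable_EFinZl.
Qed.

End time_representative_L2.

(** * Uniqueness of the representative continuous in time *)

Section time_rep_unique.
Context {R : realType} (n : nat) (l T : R) (hT : 0 < T).
Local Notation mu := (@lebesgue_measure R).
Implicit Types f g : R -> 'cV[R]_n.

Let mO : measurable (Omega l). Proof. exact: measurable_itv. Qed.

Lemma measurable_dotv d (X : measurableType d) (D : set X) (f g : X -> 'cV[R]_n) :
  (forall i, measurable_fun D (fun x => f x i ord0)) ->
  (forall i, measurable_fun D (fun x => g x i ord0)) ->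
  measurable_fun D (fun x => dotv (f x) (g x)).
Proof.
move=> mf mg; under eq_fun do rewrite dotvE.
by apply: measurable_sum => i; exact: measurable_funM.
Qed.

Lemma measurable_mulmx d (X : measurableType d) (D : set X) m (A : X -> 'M[R]_(m, n))
    (f : X -> 'cV[R]_n) i :
  (forall i j, measurable_fun D (fun x => A x i j)) ->
  (forall i, measurable_fun D (fun x => f x i ord0)) ->
  measurable_fun D (fun x => (A x *m f x) i ord0).
Proof.
move=> mA mf; under eq_fun do rewrite mxE.
by apply: measurable_sum => j; exact: measurable_funM.
Qed.

Lemma inL2P f : inL2 l f <-> (forall i, measurable_fun (Omega l) (fun x => f x i ord0)) /\
  mu.-integrable (Omega l) (EFin \o (fun x => dotv (f x) (f x))).
Proof.
split=> -[mf fi]; split => //.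
  apply/integrableP; split; first by apply/measurable_EFinP; exact: measurable_dotv.
  by under eq_integral do rewrite /= ger0_norm ?dotv_ge0//.
have /integrableP[_] := fi.
by under eq_integral do rewrite /= ger0_norm ?dotv_ge0//.
Qed.

Lemma inL2B f g : inL2 l f -> inL2 l g -> inL2 l (fun x => f x - g x).
Proof.
move=> /inL2P[mf fi] /inL2P[mg gi]; apply/inL2P.
have mfg i : measurable_fun (Omega l) (fun x => (f x - g x) i ord0).
  by under eq_fun do rewrite !mxE; exact: measurable_funB.
split => //.
apply: (@le_integrable_EFin _ _ _ mu (Omega l) _ _
   (fun x => 2 * dotv (f x) (f x) + 2 * dotv (g x) (g x))) => //.
- exact: measurable_dotv.
- move=> x _; rewrite ger0_norm ?dotv_ge0//.
  have := dotv_ge0 (f x + g x).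
  by rewrite !(dotvDr, dotvDl, dotvNr, dotvNl) (dotvC (g x) (f x)); lra.
- by apply: integrable_EFinD => //; apply: integrable_EFinZl.
Qed.

Lemma wnorm2_1 f : wnorm2 l (fun=> 1%:M) f = \int[mu]_(x in Omega l) dotv (f x) (f x).
Proof. by apply: eq_Rintegral => x _; rewrite mul1mx. Qed.

Lemma inL2_dotv f g : inL2 l f -> inL2 l g ->
  mu.-integrable (Omega l) (EFin \o (fun x => dotv (f x) (g x))).
Proof.
move=> /inL2P[mf fi] /inL2P[mg gi].
apply: (@le_integrable_EFin _ _ _ mu (Omega l) _ _
   (fun x => dotv (f x) (f x) + dotv (g x) (g x))) => //.
- exact: measurable_dotv.
- move=> x _; have := dotv_ge0 (f x + g x); have := dotv_ge0 (f x - g x).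
  rewrite !(dotvDr, dotvDl, dotvNr, dotvNl) (dotvC (g x) (f x)).
  have := dotv_ge0 (f x); have := dotv_ge0 (g x).
  by case: (ger0P (dotv (f x) (g x))) => _; lra.
- exact: integrable_EFinD.
Qed.

Lemma wnorm2_triangle f g h : inL2 l f -> inL2 l g -> inL2 l h ->
  \int[mu]_(x in Omega l) dotv (f x - h x) (f x - h x) <=
  2 * \int[mu]_(x in Omega l) dotv (f x - g x) (f x - g x) +
  2 * \int[mu]_(x in Omega l) dotv (g x - h x) (g x - h x).
Proof.
move=> fi gi hi.
have /inL2P[_ fg] := inL2B fi gi; have /inL2P[_ gh] := inL2B gi hi.
have /inL2P[_ fh] := inL2B fi hi.
rewrite -(RintegralZl _ _ fg)// -(RintegralZl _ _ gh)// -RintegralD//;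
  [|exact: integrable_EFinZl..].
apply: le_Rintegral => //.
  by apply: integrable_EFinD => //; exact: integrable_EFinZl.
move=> x _; have -> : f x - h x = (f x - g x) + (g x - h x) by rewrite addrA subrK.
move: (f x - g x) (g x - h x) => p q.
have := dotv_ge0 (p - q).
by rewrite !(dotvDr, dotvDl, dotvNr, dotvNl) (dotvC q p); lra.
Qed.

(** Arbitrarily close to [t] there is a time [s] at which both representatives agree with [u], hence
    with each other; continuity of both at [t] then makes their distance at [t] arbitrarily
    small. *)
Lemma is_time_rep_unique (u v w : R -> R -> 'cV[R]_n) :
  is_time_rep l T u v -> is_time_rep l T u w ->
  forall t, t \in `[0, T] -> v ^~ t = w ^~ t %[ae mu in Omega l].
Proof.
move=> [vu vL vc] [wu wL wc] t tT.
have vw : inL2 l (fun x => v x t - w x t) by apply: inL2B; [exact: vL|exact: wL].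
have /inL2P[mvw vwi] := vw.
suff : \int[mu]_(x in Omega l) dotv (v x t - w x t) (v x t - w x t) <= 0.
  move=> N0.
  have e0 : (\int[mu]_(x in Omega l) `|(dotv (v x t - w x t) (v x t - w x t))%:E| = 0)%E.
    under eq_integral do rewrite /= ger0_norm ?dotv_ge0//.
    rewrite -[LHS]fineK; last exact: integrable_fin_num.
    apply: congr1; apply/eqP; rewrite eq_le; apply/andP; split; first exact: N0.
    by apply: Rintegral_ge0 => x _; exact: dotv_ge0.
  have me : measurable_fun (Omega l) (EFin \o (fun x => dotv (v x t - w x t) (v x t - w x t))).
    exact: (measurable_int mu).
  have := (ae_eq_integral_abs mu mO me).1 e0; apply: filterS => x + xl.
  by move=> /(_ xl) [/dotv_eq0/subr0_eq].
apply/ler_addgt0Pr => e e0; rewrite add0r.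
(* The squared triangle inequality doubles each of the two errors, whence a quarter of [e] for
   each. *)
have e4 : 0 < e / 4 by rewrite divr_gt0.
have /cvgrPdist_lt/(_ _ e4) [d1 /= d10 H1] := vc t tT.
have /cvgrPdist_lt/(_ _ e4) [d2 /= d20 H2] := wc t tT.
pose d := Num.min d1 d2; have d0 : 0 < d by rewrite lt_min d10.
move: (tT); rewrite in_itv/= => /andP[t0 tT'].
(* The truncations keep [s] strictly inside []0, T[], which matters when [t] is 0 or [T]. *)
have lt12 : Num.max 0 (t - d) < Num.min T (t + d).
  by rewrite gt_max !lt_min hT/=; apply/andP; split; [|apply/andP; split]; lra.
have [s] := ae_exists_itv lt12 (filterI vu wu).
rewrite gt_max lt_min => /andP[/andP[s0 st1] /andP[sT st2]] [vs ws].
have sI : timeI T s by rewrite /timeI/= in_itv/= s0.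
have sT' : s \in `[0, T] by rewrite in_itv/= !ltW.
have sd : `|t - s| < d by rewrite ltr_norml; apply/andP; split; lra.
have dd1 : d <= d1 by rewrite ge_min lexx.
have dd2 : d <= d2 by rewrite ge_min lexx orbT.
have h1 := H1 s; have h2 := H2 s.
move: h1 h2; rewrite !wnorm2_1 !sub0r !normrN => h1 h2.
have {}h1 := h1 (lt_le_trans sd dd1) sT'.
have {}h2 := h2 (lt_le_trans sd dd2) sT'.
have := wnorm2_triangle (vL t tT) (vL s sT') (wL t tT).
have -> : \int[mu]_(x in Omega l) dotv (v x s - w x t) (v x s - w x t) =
   \int[mu]_(x in Omega l) dotv (w x s - w x t) (w x s - w x t).
  apply: ae_eq_Rintegral => //.
  - by have /inL2P[_ /(measurable_int mu)/measurable_EFinP] := inL2B (vL s sT') (wL t tT).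
  - by have /inL2P[_ /(measurable_int mu)/measurable_EFinP] := inL2B (wL s sT') (wL t tT).
  - by apply: filterS2 (vs sI) (ws sI) => x + + xl => /(_ xl) -> /(_ xl) ->.
have -> : \int[mu]_(x in Omega l) dotv (v x t - v x s) (v x t - v x s) =
   \int[mu]_(x in Omega l) dotv (v x s - v x t) (v x s - v x t).
  by apply: eq_Rintegral => x _; rewrite -opprB dotvNl dotvNr opprK.
move: h1 h2; rewrite !ger0_norm; try by apply: Rintegral_ge0 => x _; exact: dotv_ge0.
lra.
Qed.

End time_rep_unique.

(** * Product rule in time and evolution of weighted norms *)

Section energy_time.
Context {R : realType} (l T : R) (hT : 0 < T).
Local Notation mu := (@lebesgue_measure R).
Local Notation RR := (measurableTypeR R * measurableTypeR R)%type.
Local Notation cut := (cut l T).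
Local Notation sqfield := (sqfield l T).
Local Notation time_ac := (time_ac l T).

Definition weakly_diff (a b : R -> R -> R) : Prop :=
  [/\ sqfield a, sqfield b & forall phi, test_fun 0 T phi ->
  (fun x => \int[mu]_(t in timeI T) (a x t * derive1 phi t)) =
  (fun x => - \int[mu]_(t in timeI T) (b x t * phi t)) %[ae mu in Omega l]].

Let mO : measurable (Omega l). Proof. exact: measurable_itv. Qed.

Section scalar_product_rule.
Variables (g : R -> R) (K : R) (a b a' b' : R -> R -> R).
Hypotheses (mg : measurable_fun (Omega l) g) (gK : forall x, Omega l x -> `|g x| <= K).
Hypotheses (wab : weakly_diff a b) (wab' : weakly_diff a' b').

(** The time derivative of [g a a'], where [b] and [b'] are the weak derivatives of [a] and [a'];
    here a prime marks a second field and not a derivative. *)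
Definition product_rate (p : RR) : R :=
  (g \_ (Omega l)) p.1 * (cut b p * cut a' p + cut a p * cut b' p).

Let mgO : measurable_fun setT (g \_ (Omega l)).
Proof. by apply/(measurable_restrictT _ mO). Qed.

Lemma integrable_product_rate : (mu \x mu)%E.-integrable setT (EFin \o product_rate).
Proof.
have [sa sb _] := wab; have [sa' sb' _] := wab'.
have ba := integrable_cutM sb sa'; have ab := integrable_cutM sa sb'.
have bai : (mu \x mu)%E.-integrable setT
   (EFin \o (fun p => cut b p * cut a' p + cut a p * cut b' p)).
  exact: integrable_EFinD.
apply: (@le_integrable_EFin _ _ _ (mu \x mu)%E setT _ _
  (fun p => `|K| * `|cut b p * cut a' p + cut a p * cut b' p|)) => //.
- apply: measurable_funM; first by apply: (measurableT_comp mgO); exact: measurable_fst.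
  by apply/measurable_EFinP; exact: (measurable_int (mu \x mu)%E).
- move=> p _; rewrite /product_rate normrM ler_wpM2r// patchE; case: ifPn => xl.
    by rewrite (le_trans (gK _))//; [exact: set_mem|exact: ler_norm].
  by rewrite normr0.
- by apply: integrable_EFinZl => //; exact: integrable_norm.
Qed.

Lemma time_acM_integrable t : 0 <= t <= T ->
  mu.-integrable (Omega l) (EFin \o (fun x => g x * (time_ac a b x t * time_ac a' b' x t))).
Proof.
move=> ht; have [sa sb wd] := wab; have [sa' sb' wd'] := wab'.
have i1 := sqr_time_ac_integrable hT sa sb wd ht.
have i2 := sqr_time_ac_integrable hT sa' sb' wd' ht.
apply: (@le_integrable_EFin _ _ _ mu (Omega l) _ _
  (fun x => `|K| * (time_ac a b x t ^+ 2 + time_ac a' b' x t ^+ 2))) => //.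
- apply: measurable_funM => //; apply: measurable_funM.
    exact: measurable_funS (measurable_time_ac_section sa sb t).
  exact: measurable_funS (measurable_time_ac_section sa' sb' t).
- move=> x xl; rewrite normrM ler_pM//; first by rewrite (le_trans (gK xl))// ler_norm.
  have pq (p q : R) : `|p * q| <= p ^+ 2 + q ^+ 2.
    have := sqr_ge0 (p - q); have := sqr_ge0 (p + q); have := sqr_ge0 p; have := sqr_ge0 q.
    by case: (ger0P (p * q)) => _; lra.
  exact: pq.
- by apply: integrable_EFinZl => //; exact: integrable_EFinD.
Qed.

(** At a.e. x this is integration by parts in time; the weight [g] depends on x alone and multiplies
    it. Integration over x and Fubini then move the time integral outside. *)
Lemma time_ac_product_rule t : 0 <= t <= T ->
  \int[mu]_(x in Omega l) (g x * (time_ac a b x t * time_ac a' b' x t)) =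
  \int[mu]_(x in Omega l) (g x * (time_ac a b x 0 * time_ac a' b' x 0)) +
  \int[mu]_(s in `[0, t]) \int[mu]_x product_rate (x, s).
Proof.
move=> ht; have [sa sb wd] := wab; have [sa' sb' wd'] := wab'.
(* Cutting the rate to [0 <= s <= t] turns both integrals into integrals over whole lines, the form
   in which Fubini is available. *)
pose pw (p : RR) := if (0 <= p.2) && (p.2 <= t) then product_rate p else 0.
have pwi : (mu \x mu)%E.-integrable setT (EFin \o pw).
  apply: le_integrable (integrable_product_rate) => //.
    apply/measurable_EFinP; apply: measurable_fun_ifT => //.
      by apply: measurable_and; apply: measurable_fun_ler.
    by apply/measurable_EFinP; exact: (measurable_int _ integrable_product_rate).
  by move=> p _; rewrite /pw/=; case: ifP => // _; rewrite lee_fin normr0.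
have -> : \int[mu]_(s in `[0, t]) \int[mu]_x product_rate (x, s) =
    \int[mu]_s \int[mu]_x pw (x, s).
  rewrite Rintegral_mkcond; apply: eq_Rintegral => s _.
  rewrite patchE mem_setE in_itv /pw/=; case: ifP => // _.
  by rewrite Rintegral_cst// mul0r.
rewrite -(Fubini_Rintegral pwi).
have -> : \int[mu]_x \int[mu]_s pw (x, s) = \int[mu]_(x in Omega l) \int[mu]_s pw (x, s).
  rewrite [RHS]Rintegral_mkcond; apply: eq_Rintegral => x _.
  rewrite patchE; case: ifPn => // xl.
  rewrite -[RHS](Rintegral_set0 mu (cst 0)) [RHS]Rintegral_mkcond.
  apply: eq_Rintegral => s _; rewrite /pw /product_rate !patchE (negbTE xl) mul0r /=.
  by rewrite if_same; case: ifP.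
have h0 : (0 : R) <= 0 <= T by apply/andP; split => //; exact: ltW.
have pwx : mu.-integrable (Omega l) (EFin \o (fun x => \int[mu]_s pw (x, s))).
  by apply: integrableS (integrable_Rintegral1 pwi).
rewrite -(RintegralD _ (time_acM_integrable h0) pwx)//.
apply: ae_eq_Rintegral => //.
- by apply/measurable_EFinP; exact: (measurable_int _ (time_acM_integrable ht)).
- apply: measurable_funD; apply/measurable_EFinP.
    exact: (measurable_int _ (time_acM_integrable h0)).
  exact: (measurable_int _ pwx).
have ba : \forall x \ae mu, mu.-integrable setT (EFin \o (fun t => cut b (x, t) * cut a' (x, t))).
  exact: ae_integrable1 (integrable_cutM sb sa').
have ab : \forall x \ae mu, mu.-integrable setT (EFin \o (fun t => cut a (x, t) * cut b' (x, t))).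
  exact: ae_integrable1 (integrable_cutM sa sb').
have baab : \forall x \ae mu,
    mu.-integrable setT (EFin \o (fun t => cut b (x, t) * cut a' (x, t))) /\
    mu.-integrable setT (EFin \o (fun t => cut a (x, t) * cut b' (x, t))).
  by apply: filterS2 ba ab.
apply: filterS3 (ae_time_ac hT sa sb wd) (ae_time_ac hT sa' sb' wd') baab.
move=> x H H' [{}ba {}ab] xl.
have [bi acE] := H xl; have [bi' acE'] := H' xl.
have := @Rintegral_by_parts _ T t (time_mean l T a b x) (time_mean l T a' b' x) _ _ ht bi bi'.
rewrite !time_ac0 => ->; rewrite mulrDr; congr (_ + _).
have sub : `[0, t] `<=` `[0, T].
  by case/andP: ht => _ tT; apply: subset_itv; rewrite bnd_simp.
have mc c : sqfield c -> measurable_fun `[0, t] (fun s => cut c (x, s)).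
  by move=> sc; apply: measurable_funS measurableT _ _ => //;
    apply: (measurable_fun_pair2 x (measurable_cutT sc)).
have mac c d : sqfield c -> sqfield d -> measurable_fun `[0, t] (time_ac c d x).
  by move=> sc sd; apply: measurable_funS measurableT _ _ => //;
    have := measurable_fun_pair2 x (measurable_time_ac sc sd).
(* Under the time integral the absolutely continuous representatives may be replaced by the original
   fields. *)
rewrite (@ae_eq_Rintegral _ _ _ _ _ _ _ (fun s => cut b (x, s) * cut a' (x, s) +
    cut a (x, s) * cut b' (x, s)))//; first last.
- apply: filterS2 acE acE' => s + + st => /(_ (sub _ st)) -> /(_ (sub _ st)) -> //.
- by apply: measurable_funD; apply: measurable_funM; exact: mc.
- by apply: measurable_funD; apply: measurable_funM; (exact: mc || exact: mac).
rewrite -RintegralZl//; last first.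
  by apply: integrable_EFinD => //; [exact: integrableS ba|exact: integrableS ab].
rewrite Rintegral_mkcond; apply: eq_Rintegral => s _.
rewrite patchE mem_setE in_itv /pw /product_rate/= patchE mem_set//.
Qed.

End scalar_product_rule.

Section vector_product_rule.
Variables (n : nat) (A : R -> 'M[R]_n) (K : R) (u ut : R -> R -> 'cV[R]_n).
Hypotheses (mA : forall i j, measurable_fun (Omega l) (fun x => A x i j)).
Hypotheses (AK : forall x i j, Omega l x -> `|A x i j| <= K).
Hypotheses (hu : inL2L2 l T u) (hut : time_deriv l T u ut).

Definition ac_rep x t : 'cV[R]_n :=
  \col_i time_ac (fun x t => u x t i ord0) (fun x t => ut x t i ord0) x t.

Let wdi i : weakly_diff (fun x t => u x t i ord0) (fun x t => ut x t i ord0).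
Proof.
have [h1 h2] := hut; split; [exact: inL2L2_sqfield|exact: inL2L2_sqfield|].
by move=> phi tphi; exact: h2.
Qed.

Let ac_repE x t i : ac_rep x t i ord0 =
  time_ac (fun x t => u x t i ord0) (fun x t => ut x t i ord0) x t.
Proof. by rewrite mxE. Qed.

Let mac t i : measurable_fun (Omega l) (fun x => ac_rep x t i ord0).
Proof.
have [sa sb wd] := wdi i; under eq_fun do rewrite ac_repE.
exact: measurable_funS (measurable_time_ac_section sa sb t).
Qed.

Lemma ac_rep_inL2 t : 0 <= t <= T -> inL2 l (ac_rep ^~ t).
Proof.
move=> ht; apply/inL2P; split => //.
under eq_fun do rewrite dotvE.
apply: integrable_EFin_sum => // i.
have [sa sb wd] := wdi i.
by under eq_fun do rewrite ac_repE -expr2; exact: sqr_time_ac_integrable.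
Qed.

Lemma ae_ac_rep : \forall t \ae mu, timeI T t ->
  ac_rep ^~ t = u ^~ t %[ae mu in Omega l].
Proof.
have : \forall t \ae mu, forall i : 'I_n, timeI T t -> \forall x \ae mu, Omega l x ->
    time_ac (fun x t => u x t i ord0) (fun x t => ut x t i ord0) x t = u x t i ord0.
  by apply: filter_forall => i; have [sa sb wd] := wdi i; exact: ae_time_ac_swap.
apply: filterS => t H tT.
have : \forall x \ae mu, forall i : 'I_n, Omega l x ->
    time_ac (fun x t => u x t i ord0) (fun x t => ut x t i ord0) x t = u x t i ord0.
  by apply: filter_forall => i; exact: H.
by apply: filterS => x {}H xl; apply/colP => i; rewrite ac_repE H.
Qed.

(** Continuity comes from the bound of the squared L^2 increments by [|s - t| * B], where [B] is the
    squared norm of [ut] on the rectangle. *)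
Lemma ac_rep_is_time_rep : is_time_rep l T u ac_rep.
Proof.
split; first exact: ae_ac_rep.
  by move=> t; rewrite in_itv/=; exact: ac_rep_inL2.
move=> t; rewrite in_itv/= => ht.
pose B := \sum_(i < n) sqnorm l T (fun x t => ut x t i ord0).
have B0 : 0 <= B.
  apply: sumr_ge0 => i _; apply: Rintegral_ge0 => x _.
  by apply: Rintegral_ge0 => s _; exact: sqr_ge0.
have bnd s : 0 <= s <= T -> wnorm2 l (fun=> 1%:M) (fun x => ac_rep x s - ac_rep x t) <=
    `|s - t| * B.
  move=> hs; rewrite wnorm2_1 /B mulr_sumr.
  under eq_Rintegral do rewrite dotvE.
  rewrite Rintegral_sum//; last first.
    move=> i; have [sa sb wd] := wdi i.
    under eq_fun do rewrite !mxE -expr2.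
    exact: (sqr_time_acB sa sb hs ht).1.
  apply: ler_sum => i _; have [sa sb wd] := wdi i.
  under eq_Rintegral do rewrite !mxE -expr2.
  exact: (sqr_time_acB sa sb hs ht).2.
apply/cvgrPdist_le => e e0.
have B1 : 0 < B + 1 by rewrite ltr_wpDl.
exists (e / (B + 1)) => /=; first by rewrite divr_gt0.
move=> s /= ste; rewrite in_itv/= => hs.
rewrite sub0r normrN ger0_norm; last first.
  by rewrite wnorm2_1; apply: Rintegral_ge0 => x _; exact: dotv_ge0.
rewrite (le_trans (bnd s hs))//.
move: ste; rewrite distrC ltr_pdivlMr// => /ltW; apply: le_trans.
by rewrite ler_wpM2l// lerDl.
Qed.

(** The quadratic form is expanded entry by entry, and the scalar product rule is applied with
    weight [A i j]. The rate [h] is integrable on the line; its formula in terms of [u] and [ut] is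
    known only for a.e. t, when the sections are integrable. *)
Lemma wnorm2_ac_rep : exists h : R -> R,
  [/\ mu.-integrable setT (EFin \o h),
      forall t, 0 <= t <= T -> wnorm2 l A (ac_rep ^~ t) =
        wnorm2 l A (ac_rep ^~ 0) + \int[mu]_(s in `[0, t]) h s &
      \forall t \ae mu, timeI T t -> h t = \int[mu]_(x in Omega l)
        (dotv (ut x t) (A x *m u x t) + dotv (u x t) (A x *m ut x t))].
Proof.
pose pw i j := product_rate (fun x => A x i j) (fun x t => u x t i ord0) (fun x t => ut x t i ord0)
   (fun x t => u x t j ord0) (fun x t => ut x t j ord0).
have pwi i j : (mu \x mu)%E.-integrable setT (EFin \o pw i j).
  by apply: integrable_product_rate => // x xl; exact: AK.
pose h s := \sum_(i < n) \sum_(j < n) \int[mu]_x pw i j (x, s).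
have ki i j : mu.-integrable setT (EFin \o (fun s => \int[mu]_x pw i j (x, s))).
  exact: integrable_Rintegral2.
exists h; split.
- by apply: integrable_EFin_sum => // i; apply: integrable_EFin_sum.
- have wE t : 0 <= t <= T -> wnorm2 l A (ac_rep ^~ t) = \sum_(i < n) \sum_(j < n)
      \int[mu]_(x in Omega l) (A x i j *
      (time_ac (fun x t => u x t i ord0) (fun x t => ut x t i ord0) x t *
       time_ac (fun x t => u x t j ord0) (fun x t => ut x t j ord0) x t)).
    move=> ht.
    have Ai i j := time_acM_integrable (mA i j) (fun x => @AK x i j) (wdi i) (wdi j) ht.
    under eq_bigr do rewrite -Rintegral_sum//.
    rewrite -Rintegral_sum//; last by move=> i; exact: integrable_EFin_sum.
    apply: eq_Rintegral => x _; rewrite dotv_mulmxE.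
    by apply: eq_bigr => i _; apply: eq_bigr => j _; rewrite !ac_repE.
  have h0 : (0 : R) <= 0 <= T by apply/andP; split => //; exact: ltW.
  have kit t i j : mu.-integrable `[0, t] (EFin \o (fun s => \int[mu]_x pw i j (x, s))).
    by apply: integrableS (ki i j).
  move=> t ht; rewrite !wE// /h Rintegral_sum//; last first.
    by move=> i; apply: integrable_EFin_sum.
  rewrite -big_split; apply: eq_bigr => i _ /=; rewrite Rintegral_sum//.
  rewrite -big_split; apply: eq_bigr => j _ /=.
  by rewrite (time_ac_product_rule (mA i j) (fun x => @AK x i j) (wdi i) (wdi j) ht).
- have ae2 : \forall t \ae mu, forall i : 'I_n, forall j : 'I_n,
      mu.-integrable setT (EFin \o (fun x => pw i j (x, t))).
    by apply: filter_forall => i; apply: filter_forall => j; exact: (ae_integrable2 (pwi i j)).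
  apply: filterS ae2 => t pt tT; rewrite /h.
  under eq_bigr do rewrite -Rintegral_sum//.
  rewrite -Rintegral_sum//; last by move=> i; exact: integrable_EFin_sum.
  rewrite [RHS]Rintegral_mkcond; apply: eq_Rintegral => x _; rewrite patchE /pw /product_rate/=.
  case: ifPn => xl; last first.
    by apply: big1 => i _; apply: big1 => j _; rewrite patchE (negbTE xl) mul0r.
  rewrite !dotv_mulmxE -big_split; apply: eq_bigr => i _ /=.
  rewrite -big_split; apply: eq_bigr => j _ /=.
  by rewrite patchE xl !cutE ?mulrDr//; exact: set_mem.
Qed.

End vector_product_rule.
End energy_time.

(** * Traces and integration by parts in space *)

Lemma measurable_Omega (R : realType) (l : R) : measurable (Omega l).
Proof. exact: measurable_itv. Qed.
#[local] Hint Extern 0 (measurable (Omega _)) => solve [exact: measurable_Omega] : core.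

Section traces.
Context {R : realType} (l : R) (hl : 0 < l).
Local Notation mu := (@lebesgue_measure R).
Implicit Types f g : R -> R.

(** Near a point of disagreement continuity keeps [f - g] away from zero, and every relative
    neighbourhood in [[0, l]] contains a nonempty open interval because [0 < l]. Endpoints are
    included, and that is where the traces live. *)
Lemma within_continuous_ae_eq f g : {within Omega l, continuous f} ->
  {within Omega l, continuous g} -> f = g %[ae mu in Omega l] ->
  forall x, Omega l x -> f x = g x.
Proof.
move=> fc gc fg x xl; apply: contrapT => /eqP; rewrite -subr_eq0 -normr_gt0 => e0.
have hc : {within Omega l, continuous (fun x => f x - g x)}.
  by move=> y; apply: cvgB; [exact: fc|exact: gc].
have /cvgrPdist_lt/(_ _ e0) h := hc x.
have [V [d /= d0 dV] UV] := (nbhs_subspace_ex _ xl).1 h.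
move: (xl); rewrite /Omega/= in_itv/= => /andP[x0 xl'].
have lt12 : Num.max 0 (x - d) < Num.min l (x + d).
  by rewrite gt_max !lt_min hl/=; apply/andP; split; [|apply/andP; split]; lra.
have [y] := ae_exists_itv lt12 fg.
rewrite gt_max lt_min => /andP[/andP[y0 yx1] /andP[yl yx2]] fgy.
have yO : Omega l y by rewrite /Omega/= in_itv/= !ltW.
have : (V `&` Omega l) y.
  by split => //; apply: dV; rewrite /= ltr_norml; apply/andP; split; lra.
by rewrite -UV => -[]; rewrite /= /from_subspace (fgy yO) subrr subr0 ltxx.
Qed.

(** The witness [g] makes the choice of [cont_rep] a genuine continuous representative, and
    uniqueness then fixes its values. *)
Lemma cont_repE f g : {within Omega l, continuous g} ->
  f = g %[ae mu in Omega l] -> forall x, Omega l x -> cont_rep l f x = g x.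
Proof.
move=> gc fg; have [rc fr] : [set g | {within Omega l, continuous g} /\
    f = g %[ae mu in Omega l]] (cont_rep l f) by apply: xgetPex; exists g.
apply: within_continuous_ae_eq => //.
by apply: filterS2 fr fg => x + + xl => /(_ xl) <- /(_ xl).
Qed.

(** [f] belongs to W^{1,1} of the interval with derivative [g], in the form from which traces can be
    read. *)
Definition primitive_ae f g : Prop :=
  mu.-integrable (Omega l) (EFin \o g) /\
  exists c, \forall x \ae mu, Omega l x -> f x = c + \int[mu]_(s in `[0, x]) g s.

(** The traction trace is the trace of the sum of two fields, so the sum itself must be shown to be
    a primitive. *)
Lemma primitive_aeD f1 g1 f2 g2 : primitive_ae f1 g1 -> primitive_ae f2 g2 ->
  primitive_ae (fun x => f1 x + f2 x) (fun x => g1 x + g2 x).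
Proof.
move=> [i1 [c1 e1]] [i2 [c2 e2]]; split.
  by apply: integrable_EFinD => //; exact: measurable_itv.
exists (c1 + c2); apply: filterS2 e1 e2 => x + + xl => /(_ xl) -> /(_ xl) ->.
move: xl; rewrite /Omega/= in_itv/= => /andP[x0 xl].
have sub : `[0, x] `<=` Omega l by apply: subset_itv; rewrite bnd_simp.
have {}i1 : mu.-integrable `[0, x] (EFin \o g1) by exact: integrableS i1.
have {}i2 : mu.-integrable `[0, x] (EFin \o g2) by exact: integrableS i2.
by rewrite RintegralD// addrACA.
Qed.

Lemma weak_deriv_primitive_ae f g : mu.-integrable (Omega l) (EFin \o f) ->
  mu.-integrable (Omega l) (EFin \o g) -> weak_deriv 0 l f g -> primitive_ae f g.
Proof.
move=> fi gi wd; split => //.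
by apply: weak_deriv_primitive => // q n; exact: wd.
Qed.

Lemma cont_rep_primitive f g c : mu.-integrable (Omega l) (EFin \o g) ->
  (\forall x \ae mu, Omega l x -> f x = c + \int[mu]_(s in `[0, x]) g s) ->
  forall x, Omega l x -> cont_rep l f x = c + \int[mu]_(s in `[0, x]) g s.
Proof.
move=> gi fE; apply: cont_repE => //.
have gc := continuous_primitive (ltW hl) gi.
by move=> x; apply: cvgD; [exact: cvg_cst|exact: gc].
Qed.

(** The integral does not see null sets, so [f1] and [f2] may be replaced by the primitives, which
    are at the same time their continuous representatives. *)
Lemma primitive_ae_by_parts f1 g1 f2 g2 : primitive_ae f1 g1 -> primitive_ae f2 g2 ->
  measurable_fun (Omega l) f1 -> measurable_fun (Omega l) f2 ->
  \int[mu]_(x in Omega l) (f1 x * g2 x + g1 x * f2 x) =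
  cont_rep l f1 l * cont_rep l f2 l - cont_rep l f1 0 * cont_rep l f2 0.
Proof.
move=> [i1 [c1 e1]] [i2 [c2 e2]] m1 m2.
have l0 : Omega l 0 by rewrite /Omega/= in_itv/= lexx ltW.
have ll : Omega l l by rewrite /Omega/= in_itv/= lexx ltW.
rewrite !(cont_rep_primitive i1 e1)// !(cont_rep_primitive i2 e2)//.
have := @Rintegral_by_parts R l l c1 c2 g1 g2; rewrite ltW ?lexx// => /(_ isT i1 i2) ->.
rewrite !set_itv1 !Rintegral_set1 !addr0 [c1 * c2 + _]addrC addrK.
have mg1 : measurable_fun (Omega l) g1 by apply/measurable_EFinP; exact: (measurable_int mu).
have mg2 : measurable_fun (Omega l) g2 by apply/measurable_EFinP; exact: (measurable_int mu).
have mp g c : mu.-integrable (Omega l) (EFin \o g) ->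
    measurable_fun (Omega l) (fun s => c + \int[mu]_(r in `[0, s]) g r).
  move=> gi; apply: measurable_funD => //; apply: subspace_continuous_measurable_fun => //.
  by have := continuous_primitive (ltW hl) gi.
apply: ae_eq_Rintegral => //.
- by apply: measurable_funD; exact: measurable_funM.
- by apply: measurable_funD; apply: measurable_funM => //; exact: mp.
- by apply: filterS2 e1 e2 => x + + xl => /(_ xl) -> /(_ xl) ->; rewrite addrC.
Qed.

End traces.

Section trace_by_parts.
Context {R : realType} (l : R) (hl : 0 < l).
Local Notation mu := (@lebesgue_measure R).

Let mO : measurable (Omega l). Proof. exact: measurable_itv. Qed.

Lemma inL2_coord_integrable n (f : R -> 'cV[R]_n) i : inL2 l f ->
  mu.-integrable (Omega l) (EFin \o (fun x => f x i ord0)).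
Proof.
move=> /inL2P[mf fi].
apply: (@le_integrable_EFin _ _ _ mu (Omega l) _ _ (fun x => 1 + dotv (f x) (f x))) => //.
- exact: mf.
- move=> x _; rewrite dotvE (bigD1 i)//= -expr2.
  have : 0 <= \sum_(j < n | j != i) f x j ord0 * f x j ord0.
    by apply: sumr_ge0 => j _; rewrite -expr2 sqr_ge0.
  have := sqr_ge0 (f x i ord0 - 1); have := sqr_ge0 (f x i ord0 + 1).
  by case: (ger0P (f x i ord0)) => _; lra.
- by apply: integrable_EFinD => //; exact: integrable_itv_cst.
Qed.

Lemma trace_by_parts n (v vx z zx : R -> 'cV[R]_n) :
  inL2 l v -> inL2 l vx -> inL2 l z -> inL2 l zx ->
  (forall i, primitive_ae l (fun x => v x i ord0) (fun x => vx x i ord0)) ->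
  (forall i, primitive_ae l (fun x => z x i ord0) (fun x => zx x i ord0)) ->
  \int[mu]_(x in Omega l) (dotv (v x) (zx x) + dotv (vx x) (z x)) =
  dotv (trace l v l) (trace l z l) - dotv (trace l v 0) (trace l z 0).
Proof.
move=> /[dup] vL [mv _] /[dup] vxL [mvx _] /[dup] zL [mz _] /[dup] zxL [mzx _] pv pz.
rewrite !dotvE -sumrB.
under eq_Rintegral do rewrite !dotvE -big_split/=.
have sq (f : R -> 'cV[R]_n) i : inL2 l f -> mu.-integrable (Omega l) (EFin \o (fun x => f x i ord0 ^+ 2)).
  move=> /inL2P[mf fi].
  apply: (@le_integrable_EFin _ _ _ mu (Omega l) _ _ (fun x => dotv (f x) (f x))) => //.
    by apply: measurable_funX; exact: mf.
  move=> x _; rewrite ger0_norm ?sqr_ge0// dotvE (bigD1 i)//= -expr2 lerDl.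
  by apply: sumr_ge0 => j _; rewrite -expr2 sqr_ge0.
have pr (f g : R -> 'cV[R]_n) i : inL2 l f -> inL2 l g ->
    mu.-integrable (Omega l) (EFin \o (fun x => f x i ord0 * g x i ord0)).
  move=> fL gL; apply: (@le_integrable_EFin _ _ _ mu (Omega l) _ _
     (fun x => f x i ord0 ^+ 2 + g x i ord0 ^+ 2)) => //.
  - by apply: measurable_funM; [exact: fL.1|exact: gL.1].
  - move=> x _; set p := f x i ord0; set q := g x i ord0.
    have := sqr_ge0 (p - q); have := sqr_ge0 (p + q); have := sqr_ge0 p; have := sqr_ge0 q.
    by case: (ger0P (p * q)) => _; lra.
  - by apply: integrable_EFinD => //; exact: sq.
rewrite Rintegral_sum//; last by move=> i; apply: integrable_EFinD => //; exact: pr.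
apply: eq_bigr => i _; rewrite !mxE.
by rewrite (primitive_ae_by_parts hl (pv i) (pz i)).
Qed.

End trace_by_parts.

(** * Measurability of inverse matrices *)

(** Inversion is total with value 0 at 0, where it is discontinuous; that single point is treated
    apart. *)
Lemma measurable_invr (R : realType) : measurable_fun setT (@GRing.inv R).
Proof.
have m0 : measurable [set (0 : R)] by exact: measurable_set1.
rewrite -(setUv [set (0 : R)]); apply/measurable_funU => //; first exact: measurableC.
split; first exact: measurable_fun_set1.
apply: open_continuous_measurable_fun; first exact: closed_openC.
by move=> x; rewrite inE/= => /eqP x0; exact: inv_continuous.
Qed.

Section matrix_fields.
Context {R : realType} d (X : measurableType d) (D : set X).

Lemma measurable_det n (A : X -> 'M[R]_n) :
  (forall i j, measurable_fun D (fun x => A x i j)) ->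
  measurable_fun D (fun x => \det (A x)).
Proof.
move=> mA; apply: measurable_sum => s; apply: measurable_funM => //.
by apply: measurable_prod => i _; exact: mA.
Qed.

Lemma measurable_invmx n (A : X -> 'M[R]_n) : measurable D ->
  (forall i j, measurable_fun D (fun x => A x i j)) ->
  (forall x, D x -> A x \in unitmx) ->
  forall i j, measurable_fun D (fun x => invmx (A x) i j).
Proof.
move=> mD mA Au i j.
(* The cofactor formula, valid because [A x] is invertible on [D]; elsewhere [invmx] returns its
   argument. *)
apply: (eq_measurable_fun (fun x => (\det (A x))^-1 * ((-1) ^+ (j + i) *
    \det (row' j (col' i (A x)))))).
  by move=> x /set_mem Dx; rewrite /invmx Au// !mxE.
apply: measurable_funM.
  exact: (measurableT_comp (@measurable_invr R) (measurable_det mA)).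
apply: measurable_funM => //; apply: measurable_det => i' j'.
by under eq_fun do rewrite !mxE; exact: mA.
Qed.

End matrix_fields.

Lemma within_continuous_coord (R : realType) (l : R) n (A : R -> 'M[R]_n) i j :
  {within Omega l, continuous A} -> {within Omega l, continuous (fun x => A x i j)}.
Proof.
move=> Ac x; apply: (cvg_comp A (fun M : 'M[R]_n => M i j)); first exact: Ac.
exact: coord_continuous.
Qed.

Section slice.
Context {R : realType} (l : R) (hl : 0 < l).
Local Notation mu := (@lebesgue_measure R).

Lemma inL2D n (f g : R -> 'cV[R]_n) : inL2 l f -> inL2 l g -> inL2 l (fun x => f x + g x).
Proof.
move=> fL gL.
have mN : inL2 l (fun x => - g x).
  have [mg gi] := gL; split.
    by move=> i; under eq_fun do rewrite mxE; apply: measurable_funN; exact: mg.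
  by under eq_integral do rewrite dotvNl dotvNr opprK.
have := inL2B fL mN; by under eq_fun do rewrite opprK.
Qed.

Lemma inL2_usubmx m n (f : R -> 'cV[R]_(m + n)) : inL2 l f -> inL2 l (fun x => usubmx (f x)).
Proof.
move=> /inL2P[mf fi]; apply/inL2P.
have mu1 i : measurable_fun (Omega l) (fun x => usubmx (f x) i ord0).
  by under eq_fun do rewrite mxE; exact: mf.
split => //; apply: (@le_integrable_EFin _ _ _ mu (Omega l) _ _ (fun x => dotv (f x) (f x))) => //.
  exact: measurable_dotv.
by move=> x _; rewrite ger0_norm ?dotv_ge0// [leRHS]dotv_vsubmx lerDl dotv_ge0.
Qed.

Lemma inL2_dsubmx m n (f : R -> 'cV[R]_(m + n)) : inL2 l f -> inL2 l (fun x => dsubmx (f x)).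
Proof.
move=> /inL2P[mf fi]; apply/inL2P.
have mu1 i : measurable_fun (Omega l) (fun x => dsubmx (f x) i ord0).
  by under eq_fun do rewrite mxE; exact: mf.
split => //; apply: (@le_integrable_EFin _ _ _ mu (Omega l) _ _ (fun x => dotv (f x) (f x))) => //.
  exact: measurable_dotv.
by move=> x _; rewrite ger0_norm ?dotv_ge0// [leRHS]dotv_vsubmx lerDr dotv_ge0.
Qed.

End slice.

(** * Young's inequality and the energy balance at a fixed time *)

Section slice_balance.
Context {R : realType} (l : R) (hl : 0 < l).
Local Notation mu := (@lebesgue_measure R).

Lemma integrable_quadratic n (A : R -> 'M[R]_n) K (f g : R -> 'cV[R]_n) :
  (forall i j, measurable_fun (Omega l) (fun x => A x i j)) ->
  (forall x i j, Omega l x -> `|A x i j| <= K) ->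
  inL2 l f -> inL2 l g ->
  mu.-integrable (Omega l) (EFin \o (fun x => dotv (f x) (A x *m g x))).
Proof.
move=> mA AK /inL2P[mf fi] /inL2P[mg gi].
under eq_fun do rewrite dotv_mulmxE.
apply: integrable_EFin_sum => // i; apply: integrable_EFin_sum => // j.
apply: (@le_integrable_EFin _ _ _ mu (Omega l) _ _
   (fun x => `|K| * (dotv (f x) (f x) + dotv (g x) (g x)))) => //.
- by apply: measurable_funM; [exact: mA|apply: measurable_funM; [exact: mf|exact: mg]].
- move=> x xl; rewrite normrM ler_pM//; first by rewrite (le_trans (AK x i j xl))// ler_norm.
  have sq (v : 'cV[R]_n) k : v k ord0 ^+ 2 <= dotv v v.
    rewrite dotvE (bigD1 k)//= -expr2 lerDl.
    by apply: sumr_ge0 => k' _; rewrite -expr2 sqr_ge0.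
  have pq (p q : R) : `|p * q| <= p ^+ 2 + q ^+ 2.
    have := sqr_ge0 (p - q); have := sqr_ge0 (p + q); have := sqr_ge0 p; have := sqr_ge0 q.
    by case: (ger0P (p * q)) => _; lra.
  by rewrite (le_trans (pq _ _))// lerD.
- by apply: integrable_EFinZl => //; exact: integrable_EFinD.
Qed.

Section young.
Variables (n : nat) (A : R -> 'M[R]_n) (K c : R) (q u : R -> 'cV[R]_n).
Hypotheses (mA : forall i j, measurable_fun (Omega l) (fun x => A x i j)).
Hypotheses (AK : forall x i j, Omega l x -> `|A x i j| <= K).
Hypotheses (c0 : 0 < c) (AT : forall x, Omega l x -> (A x)^T = A x).
Hypotheses (Ac : forall x, Omega l x -> forall z, c * dotv z z <= dotv z (A x *m z)).
Hypotheses (mq : forall i, measurable_fun (Omega l) (fun x => q x i ord0)).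
Hypotheses (qi : mu.-integrable (Omega l) (EFin \o (fun x => dotv (q x) (invmx (A x) *m q x)))).
Hypotheses (uL : inL2 l u).

Let young_bound_integrable : mu.-integrable (Omega l)
  (EFin \o (fun x => dotv (q x) (invmx (A x) *m q x) + dotv (u x) (A x *m u x))).
Proof. by apply: integrable_EFinD => //; exact: integrable_quadratic mA AK uL uL. Qed.

(** The load is controlled only in the norm weighted by the inverse of [A], so integrability is
    drawn from the pointwise Young bound. *)
Lemma integrable_dotv_young : mu.-integrable (Omega l) (EFin \o (fun x => dotv (q x) (u x))).
Proof.
apply: (le_integrable_EFin _ _ _ young_bound_integrable) => //.
- by apply: measurable_dotv => //; exact: uL.1.
- move=> x xl; have := dotv_young (q x) (u x) c0 (AT xl) (Ac xl).
  by have := normr_ge0 (dotv (q x) (u x)); lra.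
Qed.

Lemma ip_young : 2 * ip l q u <= wnorm2 l (fun x => invmx (A x)) q + wnorm2 l A u.
Proof.
rewrite /wnorm2 /ip -RintegralD//; last exact: integrable_quadratic mA AK uL uL.
rewrite -RintegralZl//; last exact: integrable_dotv_young.
apply: le_Rintegral => //; first by apply: integrable_EFinZl => //; exact: integrable_dotv_young.
move=> x xl; have := dotv_young (q x) (u x) c0 (AT xl) (Ac xl).
by have := ler_norm (dotv (q x) (u x)); lra.
Qed.

End young.

Lemma energy_balance_slice (M C H : R -> 'M[R]_6) (kappa : R -> 'cV[R]_3) K c
    (u ut ux : R -> 'cV[R]_(6 + 6)) (r rx fe : R -> 'cV[R]_6) :
  let Gam x := Gammamx (M x) (C x) in let q x := col_mx (fe x) 0 in
  (forall i j, measurable_fun (Omega l) (fun x => Gam x i j)) ->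
  (forall x i j, Omega l x -> `|Gam x i j| <= K) ->
  0 < c -> (forall x, Omega l x -> (Gam x)^T = Gam x) ->
  (forall x, Omega l x -> forall z, c * dotv z z <= dotv z (Gam x *m z)) ->
  inL2 l u -> inL2 l ut -> inL2 l ux -> inL2 l r -> inL2 l rx ->
  (forall i, measurable_fun (Omega l) (fun x => fe x i ord0)) ->
  mu.-integrable (Omega l) (EFin \o (fun x => dotv (q x) (invmx (Gam x) *m q x))) ->
  mu.-integrable (Omega l) (EFin \o (fun x => dotv (invmx (H x) *m r x) (r x))) ->
  (forall i, weak_deriv 0 l (fun x => u x i ord0) (fun x => ux x i ord0)) ->
  (forall i, weak_deriv 0 l (fun x => r x i ord0) (fun x => rx x i ord0)) ->
  (\forall x \ae mu, Omega l x ->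
    field_eq1 (M x) (C x) (Emx (kappa x)) (usubmx (u x)) (dsubmx (u x)) (r x) (fe x)
      (usubmx (ut x)) (dsubmx (ut x)) (usubmx (ux x)) (dsubmx (ux x)) (rx x) /\
    field_eq2 (C x) (Emx (kappa x)) (H x) (usubmx (u x)) (dsubmx (u x)) (r x)
      (usubmx (ux x))) ->
  2^-1 * \int[mu]_(x in Omega l) (dotv (ut x) (Gam x *m u x) + dotv (u x) (Gam x *m ut x)) +
    ip l (fun x => invmx (H x) *m r x) r =
  (dotv (trace l (fun x => usubmx (u x)) l) (trace l (fun x => dsubmx (u x) + r x) l) -
   dotv (trace l (fun x => usubmx (u x)) 0) (trace l (fun x => dsubmx (u x) + r x) 0)) +
  ip l q u.
Proof.
move=> Gam q mG GK c0 GT Gc uL utL uxL rL rxL mfe Fi Di wu wr eqs.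
have [[mu_ _] [mut _] [mux _] [mr _] [mrx _]] := And5 uL utL uxL rL rxL.
have mq i : measurable_fun (Omega l) (fun x => q x i ord0).
  rewrite /q; case: (split_ordP i) => j ->.
    by under eq_fun do rewrite col_mxEu; exact: mfe.
  by under eq_fun do rewrite col_mxEd mxE; exact: measurable_cst.
have uGut := integrable_quadratic mG GK uL utL.
have qu := integrable_dotv_young mG GK c0 GT Gc mq Fi uL.
have prim n (f g : R -> 'cV[R]_n) : inL2 l f -> inL2 l g ->
    (forall i, weak_deriv 0 l (fun x => f x i ord0) (fun x => g x i ord0)) ->
    forall i, primitive_ae l (fun x => f x i ord0) (fun x => g x i ord0).
  by move=> fL gL fg i; apply: weak_deriv_primitive_ae => //; exact: inL2_coord_integrable.
have pu := prim _ _ _ uL uxL wu; have pr := prim _ _ _ rL rxL wr.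
have u1L := inL2_usubmx uL; have u2L := inL2_dsubmx uL.
have u1xL := inL2_usubmx uxL; have u2xL := inL2_dsubmx uxL.
have zL := inL2D u2L rL; have zxL := inL2D u2xL rxL.
have tr := trace_by_parts hl u1L u1xL zL zxL.
(* The traces are traded for the integral of the pointwise x-derivative, so that both sides become
   integrals over the beam. *)
rewrite -tr; first last.
- move=> i; have := primitive_aeD (pu (rshift 6 i)) (pr i).
  by congr primitive_ae; apply/funext => x; rewrite !mxE.
- by move=> i; have := pu (lshift 6 i); congr primitive_ae; apply/funext => x; rewrite !mxE.
(* By symmetry of [Gam] the two terms of the rate are equal, so half their sum is the pairing that
   [energy_balance] provides. *)
rewrite -[X in 2^-1 * X](_ : 2 * \int[mu]_(x in Omega l) dotv (u x) (Gam x *m ut x) = _); last first.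
  rewrite -RintegralZl//; apply: eq_Rintegral => x; rewrite inE => xl.
  by rewrite (dotv_mulmx _ (ut x)) GT// (dotvC _ (u x)); ring.
rewrite mulrA mulVf ?mul1r// /ip.
have i3 := inL2_dotv u1L zxL; have i4 := inL2_dotv u1xL zL.
rewrite -!RintegralD//; last exact: integrable_EFinD.
apply: ae_eq_Rintegral => //.
- by apply: measurable_funD; apply/measurable_EFinP; [exact: (measurable_int _ uGut)|exact: (measurable_int _ Di)].
- apply: measurable_funD; last by apply/measurable_EFinP; exact: (measurable_int _ qu).
  by apply: measurable_funD; apply/measurable_EFinP; [exact: (measurable_int _ i3)|exact: (measurable_int _ i4)].
- by apply: filterS eqs => x + xl => /(_ xl)[e1 e2]; exact: energy_balance e1 e2.
Qed.

End slice_balance.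

(** * The energy balance *)

Section coefficients.
Context {R : realType} (l : R).

Lemma within_continuous_mx_bounded n (A : R -> 'M[R]_n) :
  {within Omega l, continuous A} ->
  exists K, forall x i j, Omega l x -> `|A x i j| <= K.
Proof.
move=> Ac; have Kij i j := within_continuous_bounded (within_continuous_coord (i := i) (j := j) Ac).
pose K i j := projT1 (cid2 (Kij i j)).
exists (\sum_i \sum_j `|K i j|) => x i j.
rewrite /Omega/= in_itv/= => xl.
have := projT2 (cid2 (Kij i j)) => -[_ /(_ x xl)] /le_trans; apply.
rewrite (bigD1 i)//= (bigD1 j)//= -addrA (le_trans (ler_norm _))// lerDl.
by rewrite addr_ge0// sumr_ge0// => k _; rewrite sumr_ge0.
Qed.

Lemma measurable_within_coord n (A : R -> 'M[R]_n) i j :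
  {within Omega l, continuous A} -> measurable_fun (Omega l) (fun x => A x i j).
Proof.
by move=> Ac; apply: subspace_continuous_measurable_fun => //; exact: within_continuous_coord.
Qed.

Lemma measurable_Gammamx (M C : R -> 'M[R]_6) i j :
  (forall i j, measurable_fun (Omega l) (fun x => M x i j)) ->
  (forall i j, measurable_fun (Omega l) (fun x => C x i j)) ->
  measurable_fun (Omega l) (fun x => Gammamx (M x) (C x) i j).
Proof.
move=> mM mC; rewrite /Gammamx.
case: (split_ordP i) => i' ->; case: (split_ordP j) => j' ->.
- by under eq_fun do rewrite block_mxEul; exact: mM.
- by under eq_fun do rewrite block_mxEur mxE; exact: measurable_cst.
- by under eq_fun do rewrite block_mxEdl mxE; exact: measurable_cst.
- by under eq_fun do rewrite block_mxEdr; exact: mC.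
Qed.

Lemma Gammamx_bounded (M C : R -> 'M[R]_6) K1 K2 :
  (forall x i j, Omega l x -> `|M x i j| <= K1) ->
  (forall x i j, Omega l x -> `|C x i j| <= K2) ->
  forall x i j, Omega l x -> `|Gammamx (M x) (C x) i j| <= `|K1| + `|K2|.
Proof.
move=> M1 C2 x i j xl; rewrite /Gammamx.
have k1 := le_trans (M1 x _ _ xl) (ler_norm K1).
have k2 := le_trans (C2 x _ _ xl) (ler_norm K2).
case: (split_ordP i) => i' ->; case: (split_ordP j) => j' ->.
- by rewrite block_mxEul (le_trans (k1 _ _))// lerDl.
- by rewrite block_mxEur mxE normr0 addr_ge0.
- by rewrite block_mxEdl mxE normr0 addr_ge0.
- by rewrite block_mxEdr (le_trans (k2 _ _))// lerDr.
Qed.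

(** The two blocks do not interact, so the smaller of the two coercivity constants works. *)
Lemma Gammamx_spd (M C : R -> 'M[R]_6) : unif_spd (Omega l) M -> unif_spd (Omega l) C ->
  unif_spd (Omega l) (fun x => Gammamx (M x) (C x)).
Proof.
move=> [MT [c1 c10 Mc]] [CT [c2 c20 Cc]]; split.
  by move=> x xl; rewrite /Gammamx (@tr_block_mx _ 6 6 6 6) !trmx0 MT// CT.
exists (Num.min c1 c2); first by rewrite lt_min c10.
move=> x xl z; rewrite dotv_Gammamx dotv_vsubmx mulrDr lerD//.
  rewrite (le_trans _ (Mc x xl _))// ler_wpM2r ?dotv_ge0// ge_min lexx//.
by rewrite (le_trans _ (Cc x xl _))// ler_wpM2r ?dotv_ge0// ge_min lexx orbT.
Qed.

End coefficients.

Section sections.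
Context {R : realType} (l T : R).
Local Notation mu := (@lebesgue_measure R).
Local Notation RR := (measurableTypeR R * measurableTypeR R)%type.
Local Notation D := (Omega l `*` timeI T : set RR).
Local Notation cut := (cut l T).
Local Notation sqfield := (sqfield l T).

Lemma measurable_section (a : R -> R -> R) t : measurable_fun D (fun p => a p.1 p.2) ->
  timeI T t -> measurable_fun (Omega l) (a ^~ t).
Proof.
move=> /measurable_cut mc tT.
have := measurable_fun_pair1 t mc => /(measurable_funS measurableT (@subsetT _ (Omega l))).
by apply: eq_measurable_fun => x /set_mem xl; rewrite /= cutE.
Qed.

Lemma Rintegral_cut_section (a : R -> R -> R) t : timeI T t ->
  \int[mu]_x cut a (x, t) = \int[mu]_(x in Omega l) a x t.
Proof.
move=> tT; rewrite [RHS]Rintegral_mkcond; apply: eq_Rintegral => x _.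
rewrite patchE; case: ifPn => xl; first by rewrite cutE//; exact: set_mem.
by rewrite cut_out// => -[xl' _]; move: xl; rewrite mem_set.
Qed.

Lemma ae_integrable_section (a : R -> R -> R) :
  (mu \x mu)%E.-integrable setT (EFin \o cut a) ->
  \forall t \ae mu, timeI T t -> mu.-integrable (Omega l) (EFin \o (a ^~ t)).
Proof.
move=> ai; have : \forall t \ae mu, mu.-integrable setT (EFin \o (fun x => cut a (x, t))).
  exact: ae_integrable2 ai.
apply: filterS => t it tT.
have : mu.-integrable (Omega l) (EFin \o (fun x => cut a (x, t))) by exact: integrableS it.
by apply: eq_integrable => // x /set_mem xl; rewrite /= cutE.
Qed.

Lemma ae_inL2_section n (u : R -> R -> 'cV[R]_n) :
  (forall i, sqfield (fun x t => u x t i ord0)) ->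
  \forall t \ae mu, timeI T t -> inL2 l (u ^~ t).
Proof.
move=> su.
have : \forall t \ae mu, forall i : 'I_n, timeI T t ->
    mu.-integrable (Omega l) (EFin \o (fun x => u x t i ord0 ^+ 2)).
  apply: filter_forall => i; apply: (@ae_integrable_section (fun x t => u x t i ord0 ^+ 2)).
  have := (su i).2; apply: eq_integrable => // p _; rewrite /cut /= !patchE.
  by case: ifP => //; rewrite expr0n.
apply: filterS => t ti tT; apply/inL2P; split.
  by move=> i; exact: measurable_section (su i).1 tT.
under eq_fun do rewrite dotvE.
by apply: integrable_EFin_sum => // i; under eq_fun do rewrite -expr2; exact: ti.
Qed.

Lemma sqfield_dominated n (u : R -> R -> 'cV[R]_n) (F : R -> R -> R) i :
  joint_meas l T u ->
  (mu \x mu)%E.-integrable setT (EFin \o cut F) ->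
  (forall x t, Omega l x -> timeI T t -> dotv (u x t) (u x t) <= F x t) ->
  sqfield (fun x t => u x t i ord0).
Proof.
move=> ju Fi uF; split; first exact: ju.
apply: (le_integrable_EFin _ _ _ Fi) => //.
  by apply: measurable_funX; apply: measurable_cut; exact: ju.
move=> [x t] _; rewrite ger0_norm ?sqr_ge0//.
have [[xl tT]|out] := pselect (Omega l x /\ timeI T t); last by rewrite !cut_out// expr0n.
rewrite !cutE//; apply: le_trans (uF x t xl tT).
by rewrite dotvE (bigD1 i)//= -expr2 lerDl sumr_ge0// => j _; rewrite -expr2 sqr_ge0.
Qed.

Lemma measurable_fun_fst_Omega (g : R -> R) : measurable_fun (Omega l) g ->
  measurable_fun D (fun p => g p.1).
Proof.
move=> mg; apply: (measurable_comp (F := Omega l)) => //.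
  by move=> _ [p [pl _] <-].
by apply: measurable_funS measurableT _ _ => //; exact: measurable_fst.
Qed.

Lemma in_L2H1_sqfield n (u : R -> R -> 'cV[R]_n) i : in_L2H1 l T u ->
  sqfield (fun x t => u x t i ord0).
Proof.
move=> [ju [ux [jux _] uoo]].
apply: (@sqfield_dominated _ _ (fun x t => dotv (u x t) (u x t) + dotv (ux x t) (ux x t))) => //.
  apply: integrable_cut uoo.
    by apply: measurable_funD; apply: measurable_dotv => j; [exact: ju..|exact: jux|exact: jux].
  by move=> x t _ _; rewrite addr_ge0 ?dotv_ge0.
by move=> x t _ _; rewrite lerDl dotv_ge0.
Qed.

Lemma wnorm2_ae_eq n (A : R -> 'M[R]_n) (f g : R -> 'cV[R]_n) :
  (forall i j, measurable_fun (Omega l) (fun x => A x i j)) ->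
  (forall i, measurable_fun (Omega l) (fun x => f x i ord0)) ->
  (forall i, measurable_fun (Omega l) (fun x => g x i ord0)) ->
  f = g %[ae mu in Omega l] -> wnorm2 l A f = wnorm2 l A g.
Proof.
move=> mA mf mg fg; apply: ae_eq_Rintegral => //.
- by apply: measurable_dotv => // i; exact: measurable_mulmx.
- by apply: measurable_dotv => // i; exact: measurable_mulmx.
- by apply: filterS fg => x + xl => /(_ xl) ->.
Qed.

(** The equations are given on the open interval while integrals run over the closed one; the two
    endpoints form a null set. *)
Lemma ae_slice (P : R -> R -> Prop) :
  (\forall p \ae (mu \x mu)%E, (`]0, l[ `*` timeI T) p -> P p.1 p.2) ->
  \forall t \ae mu, timeI T t -> \forall x \ae mu, Omega l x -> P x t.
Proof.
move=> PD; have : \forall t \ae mu, \forall x \ae mu, (`]0, l[ `*` timeI T) (x, t) -> P x t.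
  exact: ae_prod_ysection PD.
apply: filterS => t H tT.
have ae_neq (z : R) : \forall x \ae mu, x != z.
  exists [set z]; split => //; first exact: lebesgue_measure_set1.
  by move=> x /=; apply: contra_notP => /eqP.
apply: filterS3 H (ae_neq 0) (ae_neq l) => x + x0 xl; rewrite /Omega/= in_itv/=.
move=> H /andP[x0' xl']; apply: H; split => //=.
have [h0 h1] : 0 <= x /\ x <= l by [].
by rewrite !lt_neqAle h0 h1 xl eq_sym x0.
Qed.

Lemma Rintegral_itv_oo_cc (a b : R) (f : R -> R) : mu.-integrable `[a, b] (EFin \o f) ->
  \int[mu]_(x in `]a, b[) f x = \int[mu]_(x in `[a, b]) f x.
Proof.
move=> fi; rewrite Rintegral_itv_obnd_cbnd ?Rintegral_itv_bndo_bndc//;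
  by apply: integrableS fi => //; apply: subset_itv; rewrite bnd_simp.
Qed.

End sections.

(** Every index lies in one of the two classes, so in each summand either the velocity or the
    traction factor vanishes. *)
Lemma homogeneous_bc_dotv (R : realType) (l T : R) (u1 u2 r : R -> R -> 'cV[R]_6) (xd : R) :
  homogeneous_bc l T u1 u2 r xd ->
  \forall t \ae @lebesgue_measure R, timeI T t ->
    dotv (trace l (u1 ^~ t) xd) (trace l (fun x => u2 x t + r x t) xd) = 0.
Proof.
move=> [Iv [It [IvIt _ H]]]; apply: filterS H => t + tT => /(_ tT)[Hv Ht].
rewrite dotvE big1// => i _.
have : i \in (Iv :|: It)%SET by rewrite IvIt finset.in_setT.
by rewrite finset.in_setU => /orP[/Hv|/Ht] ->; rewrite ?mul0r ?mulr0.
Qed.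

Theorem theorem3p1 (R : realType) (l T : R) (hl : 0 < l) (hT : 0 < T)
    (M C Ctau : R -> 'M[R]_6) (kappa0 : R -> 'cV[R]_3)
    (cM : {within Omega l, continuous M})
    (cC : {within Omega l, continuous C})
    (cCtau : {within Omega l, continuous Ctau})
    (ckappa0 : {within Omega l, continuous kappa0})
    (spdM : unif_spd (Omega l) M)
    (spdC : unif_spd (Omega l) C)
    (spdH : unif_spd (Omega l) (fun x => Hmx (C x) (Ctau x)))
    (fe : R -> R -> 'cV[R]_6)
    (u ut ux : R -> R -> 'cV[R]_(6 + 6)) (r rx : R -> R -> 'cV[R]_6)
    (u0 : R -> 'cV[R]_(6 + 6)) :
  let mu := @lebesgue_measure R in
  let Gam x := Gammamx (M x) (C x) in
  let H x := Hmx (C x) (Ctau x) in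
  let q := qext fe in
  let w := time_rep l T u in
  inL2L2w l T (fun x => invmx (Gam x)) q ->
  in_XT l T u -> in_YT l T r ->
  time_deriv l T u ut -> space_deriv l T u ux -> space_deriv l T r rx ->
  (\forall p \ae (mu \x mu)%E, (`]0, l[ `*` timeI T) p ->
     field_eq1 (M p.1) (C p.1) (Emx (kappa0 p.1))
       (fst6 u p.1 p.2) (snd6 u p.1 p.2) (r p.1 p.2) (fe p.1 p.2)
       (fst6 ut p.1 p.2) (snd6 ut p.1 p.2)
       (fst6 ux p.1 p.2) (snd6 ux p.1 p.2) (rx p.1 p.2)) ->
  (\forall p \ae (mu \x mu)%E, (`]0, l[ `*` timeI T) p ->
     field_eq2 (C p.1) (Emx (kappa0 p.1)) (H p.1)
       (fst6 u p.1 p.2) (snd6 u p.1 p.2) (r p.1 p.2) (fst6 ux p.1 p.2)) ->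
  inL2 l u0 -> w ^~ 0 = u0 %[ae mu in Omega l] ->
  let E t := energy l M C (fst6 w ^~ t) (snd6 w ^~ t) in
  let normG2 t := wnorm2 l Gam (w ^~ t) in
  let dissip t := ip l (fun x => invmx (H x) *m r x t) (r ^~ t) in
  let bdry t x := dotv (trace l (fst6 u ^~ t) x)
                       (trace l (fun y => snd6 u y t + r y t) x) in
  [/\ forall t, t \in `[0, T] -> E t = 2^-1 * normG2 t,
      abs_cont 0 T E,
      \forall t \ae mu, timeI T t ->
        derivable normG2 t 1 /\
        2^-1 * derive1 normG2 t + dissip t =
          (bdry t l - bdry t 0) + ip l (q ^~ t) (u ^~ t) &
      homogeneous_bc l T (fst6 u) (snd6 u) r 0 ->
      homogeneous_bc l T (fst6 u) (snd6 u) r l ->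
      normG2 T + 2 * \int[mu]_(t in timeI T) dissip t <=
        expR T * (wnorm2 l Gam u0 +
                  \int[mu]_(t in timeI T)
                     wnorm2 l (fun x => invmx (Gam x)) (q ^~ t))].
Proof.
move=> mu Gam H q w hq [[uL2 _] _] rY hut hux hr e1 e2 [mu0 _] wu0 E normG2 dissip bdry.
have l0 := ltW hl; have T0 := ltW hT.
have mM i j := measurable_within_coord i j cM.
have mC i j := measurable_within_coord i j cC.
have mCtau i j := measurable_within_coord i j cCtau.
have mGam i j : measurable_fun (Omega l) (fun x => Gam x i j) by exact: measurable_Gammamx.
have [K1 MK] := within_continuous_mx_bounded cM.
have [K2 CK] := within_continuous_mx_bounded cC.
have GamK := Gammamx_bounded MK CK.
have [GamT [cG cG0 Gamc]] := Gammamx_spd spdM spdC.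
have [HT [cH cH0 Hc]] := spdH.
have Cu x : Omega l x -> C x \in unitmx.
  by case: spdC => _ [c c0 Cc] xl; exact: spd_unit c0 (Cc x xl).
have miG i j : measurable_fun (Omega l) (fun x => invmx (Gam x) i j).
  by apply: measurable_invmx => // x xl; exact: spd_unit cG0 (Gamc x xl).
have mH i j : measurable_fun (Omega l) (fun x => H x i j).
  rewrite /H /Hmx; under eq_fun do rewrite mxE.
  by apply: measurable_sum => k; apply: measurable_funM => //; exact: measurable_invmx.
have miH i j : measurable_fun (Omega l) (fun x => invmx (H x) i j).
  by apply: measurable_invmx => // x xl; exact: spd_unit cH0 (Hc x xl).
have su i : sqfield l T (fun x t => u x t i ord0) by exact: inL2L2_sqfield.
have sut i : sqfield l T (fun x t => ut x t i ord0) by apply: inL2L2_sqfield; exact: hut.1.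
have sr i : sqfield l T (fun x t => r x t i ord0) by exact: in_L2H1_sqfield.
have [jq qoo] := hq.
pose F x t := dotv (q x t) (invmx (Gam x) *m q x t).
have F0 x t : Omega l x -> timeI T t -> 0 <= F x t.
  move=> xl _; rewrite /F dotvC.
  by have /andP[] := spd_inv_bounds (q x t) cG0 (Gamc x xl).
have Fi : (mu \x mu)%E.-integrable setT (EFin \o cut l T F).
  apply: integrable_cut => //.
  apply: measurable_dotv; first exact: jq.
  move=> i; apply: measurable_mulmx; last exact: jq.
  by move=> i' j'; apply: (@measurable_fun_fst_Omega R l T (fun x => invmx (Gam x) i' j')); exact: miG.
(* The dissipation density lies between 0 and [|r|^2 / cH] by coercivity of [H]; this yields both
   its sign and its integrability on the rectangle. *)
pose G x t := dotv (invmx (H x) *m r x t) (r x t).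
have Gb x t : Omega l x -> 0 <= G x t <= cH^-1 * dotv (r x t) (r x t).
  by move=> xl; exact: spd_inv_bounds cH0 (Hc x xl).
have mG : measurable_fun (Omega l `*` timeI T : set (measurableTypeR R * measurableTypeR R))
    (fun p => G p.1 p.2).
  apply: measurable_dotv; last by move=> i; exact: (sr i).1.
  move=> i; apply: measurable_mulmx; last by move=> j; exact: (sr j).1.
  by move=> i' j'; apply: (@measurable_fun_fst_Omega R l T (fun x => invmx (H x) i' j')); exact: miH.
have Gi : (mu \x mu)%E.-integrable setT (EFin \o cut l T G).
  apply: (@le_integrable_EFin _ _ _ (mu \x mu)%E setT _ _
     (fun p => cH^-1 * \sum_i cut l T (fun x t => r x t i ord0) p ^+ 2)) => //.
  - exact: measurable_cut.
  - move=> [x t] _; have [[xl tT]|out] := pselect (Omega l x /\ timeI T t).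
      have /andP[G0 Gle] := Gb x t xl.
      rewrite cutE// ger0_norm// (le_trans Gle)// dotvE ler_pM2l ?invr_gt0//.
      by apply: ler_sum => i _; rewrite cutE// expr2.
    rewrite cut_out// normr0 mulr_ge0//; first by rewrite invr_ge0 ltW.
    by apply: sumr_ge0 => i _; exact: sqr_ge0.
  - apply: integrable_EFinZl => //; apply: integrable_EFin_sum => // i.
    exact: (sr i).2.
pose W := ac_rep l T u ut.
have Wrep : is_time_rep l T u W by exact: ac_rep_is_time_rep.
(* The choice behind [w] meets its specification because the explicit [W] does. *)
have wrep : is_time_rep l T u w by apply: xgetPex; exists W.
have [wu wL _] := wrep; have [_ WL _] := Wrep.
have [h [hi hE hae]] := wnorm2_ac_rep hT mGam GamK uL2 hut.
pose y0 := wnorm2 l Gam (W ^~ 0).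
(* At every time [w] and [W] agree a.e. in x, so their weighted norms coincide for all [t] and not
   just for almost all. *)
have yE t : 0 <= t <= T -> normG2 t = y0 + \int[mu]_(s in `[0, t]) h s.
  move=> t0T; rewrite /y0 -hE// /normG2.
  have tT : t \in `[0, T] by rewrite in_itv.
  apply: wnorm2_ae_eq => //; [exact: (wL t tT).1|exact: (WL t tT).1|].
  exact: is_time_rep_unique wrep Wrep _ tT.
have hiT : mu.-integrable `[0, T] (EFin \o h) by exact: integrableS hi.
have EE t : E t = 2^-1 * normG2 t.
  by congr (_ * _); apply: eq_Rintegral => x _; rewrite dotv_Gammamx.
(* The balance is stated for the integrable rate [h]: the inequality part integrates it as it
   stands, and only the differential identity has to know that [h] is a derivative. *)
have balance : \forall t \ae mu, timeI T t ->
    2^-1 * h t + dissip t = (bdry t l - bdry t 0) + ip l (q ^~ t) (u ^~ t).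
  have aeu := ae_inL2_section su; have aeut := ae_inL2_section sut.
  have aer := ae_inL2_section sr.
  have aeF := ae_integrable_section Fi; have aeG := ae_integrable_section Gi.
  have [aeux aerx] := (hux.2, hr.2).
  have aee1 := @ae_slice R l T (fun x t => field_eq1 (M x) (C x) (Emx (kappa0 x))
       (fst6 u x t) (snd6 u x t) (r x t) (fe x t)
       (fst6 ut x t) (snd6 ut x t) (fst6 ux x t) (snd6 ux x t) (rx x t)) e1.
  have aee2 := @ae_slice R l T (fun x t => field_eq2 (C x) (Emx (kappa0 x)) (H x)
       (fst6 u x t) (snd6 u x t) (r x t) (fst6 ux x t)) e2.
  near=> t; move=> tT.
  have uL : inL2 l (u ^~ t) by move: tT; near: t; exact: aeu.
  have utL : inL2 l (ut ^~ t) by move: tT; near: t; exact: aeut.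
  have rL : inL2 l (r ^~ t) by move: tT; near: t; exact: aer.
  have FiT : mu.-integrable (Omega l) (EFin \o (F ^~ t)) by move: tT; near: t; exact: aeF.
  have GiT : mu.-integrable (Omega l) (EFin \o (G ^~ t)) by move: tT; near: t; exact: aeG.
  have [uxL wux] : inL2 l (ux ^~ t) /\ forall i,
      weak_deriv 0 l (fun x => u x t i ord0) (fun x => ux x t i ord0).
    by move: tT; near: t; exact: aeux.
  have [rxL wrx] : inL2 l (rx ^~ t) /\ forall i,
      weak_deriv 0 l (fun x => r x t i ord0) (fun x => rx x t i ord0).
    by move: tT; near: t; exact: aerx.
  have -> : h t = \int[mu]_(x in Omega l)
      (dotv (ut x t) (Gam x *m u x t) + dotv (u x t) (Gam x *m ut x t)).
    by move: tT; near: t; exact: hae.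
  have f1 : \forall x \ae mu, Omega l x -> field_eq1 (M x) (C x) (Emx (kappa0 x))
       (fst6 u x t) (snd6 u x t) (r x t) (fe x t)
       (fst6 ut x t) (snd6 ut x t) (fst6 ux x t) (snd6 ux x t) (rx x t).
    by move: tT; near: t; exact: aee1.
  have f2 : \forall x \ae mu, Omega l x -> field_eq2 (C x) (Emx (kappa0 x)) (H x)
       (fst6 u x t) (snd6 u x t) (r x t) (fst6 ux x t).
    by move: tT; near: t; exact: aee2.
  have mfe i : measurable_fun (Omega l) (fun x => fe x t i ord0).
    have := @measurable_section R l T (fun x t => q x t (lshift 6 i) ord0) t (jq _) tT.
    by congr measurable_fun; apply/funext => x; rewrite /q /qext col_mxEu.
  apply: (energy_balance_slice hl mGam GamK cG0 GamT Gamc uL utL uxL rL rxL mfe FiT GiT wux wrx).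
  by apply: filterS2 f1 f2 => x g1 g2 xl; split; [exact: g1|exact: g2].
split.
- by move=> t _; exact: EE.
- apply: (@abs_cont_primitive _ T (2^-1 * y0) (fun s => 2^-1 * h s)).
    exact: integrable_EFinZl.
  move=> t t0T; rewrite EE yE// mulrDr RintegralZl//.
  by apply: integrableS hi.
(* The primitive of [h] is differentiable with derivative [h t] at each Lebesgue point of [h], hence
   at a.e. t. *)
- have aeL : \forall t \ae mu, lebesgue_pt h t.
    by apply: lebesgue_differentiation; exact: locally_integrableT.
  apply: filterS2 aeL balance => t Lt bal tT.
  move: (tT); rewrite /timeI/= in_itv/= => /andP[t0 tT'].
  have [dF dFE] := @FTC1_lebesgue_pt R h (BLeft 0) t T tT' hiT t0 Lt.
  (* The formula for [normG2] is known only on [[0, T]]; an interior [t] has a neighbourhood there,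
     which is enough for the derivative. *)
  have nearE : \forall s \near t, y0 + \int[mu]_(x in `[0, s]) h x = normG2 s.
    near=> s; rewrite yE//; apply/andP; split.
      by apply: ltW; near: s; exact: lt_nbhsr.
    by apply: ltW; near: s; exact: lt_nbhsl.
  have dy : is_derive t 1 normG2 (h t).
    apply: near_eq_is_derive nearE _.
    have dF' : is_derive t 1 (fun s => \int[mu]_(x in `[0, s]) h x) (h t).
      by rewrite -dFE derive1E; exact/derivableP.
    have := is_deriveD (is_derive_cst y0 t 1) dF'.
    by rewrite add0r.
  split; first exact: ex_derive.
  by rewrite derive1E (derive_val (f := normG2)); exact: bal.
- move=> bc0 bcl.
  (* [d] and [g] equal the dissipation and the squared load norm inside []0, T[]. Built from fields
     extended by zero, they are nonnegative at every time, and Fubini makes them integrable on the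
     line. *)
  pose d t := \int[mu]_x cut l T G (x, t).
  pose g t := \int[mu]_x cut l T F (x, t).
  have di : mu.-integrable setT (EFin \o d) by exact: integrable_Rintegral2 Gi.
  have gi : mu.-integrable setT (EFin \o g) by exact: integrable_Rintegral2 Fi.
  have d0 t : 0 <= d t.
    apply: Rintegral_ge0 => x _; rewrite /cut patchE; case: ifPn => // /set_mem[xl _].
    by have /andP[] := Gb x t xl.
  have g0 t : 0 <= g t.
    apply: Rintegral_ge0 => x _; rewrite /cut patchE; case: ifPn => // /set_mem[xl tT].
    exact: F0.
  pose y t := y0 + \int[mu]_(s in `[0, t]) h s.
  pose z t := y t + 2 * \int[mu]_(s in `[0, t]) d s.
  have diT : mu.-integrable `[0, T] (EFin \o d) by exact: integrableS di.
  have giT : mu.-integrable `[0, T] (EFin \o g) by exact: integrableS gi.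
  have yc : {within `[0, T], continuous y}.
    have hc := continuous_primitive T0 hiT.
    by move=> t; apply: cvgD; [exact: cvg_cst|exact: hc].
  have zc : {within `[0, T], continuous z}.
    have dc := continuous_primitive T0 diT.
    by move=> t; apply: cvgD; [exact: yc|apply: cvgM; [exact: cvg_cst|exact: dc]].
  have yi : mu.-integrable `[0, T] (EFin \o y).
    by apply: continuous_compact_integrable => //; exact: segment_compact.
  have zi : mu.-integrable `[0, T] (EFin \o z).
    by apply: continuous_compact_integrable => //; exact: segment_compact.
  (* Young's inequality leaves [y] on the right-hand side; since the dissipation is nonnegative it
     may be replaced by [z], which closes the Gronwall inequality. *)
  have yz t : y t <= z t by rewrite lerDl mulr_ge0// Rintegral_ge0.
  (* Without boundary terms the doubled balance reads [h + 2 d = 2 (q, u)], and Young's inequality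
     in the [Gam] norm bounds the right-hand side with coefficient 1 in front of [y]. *)
  have diff_ineq : \forall t \ae mu, timeI T t -> h t + 2 * d t <= g t + y t.
    have b0 := homogeneous_bc_dotv bc0; have bl := homogeneous_bc_dotv bcl.
    have aeW := ae_ac_rep hT uL2 hut.
    have aeu := ae_inL2_section su; have aeF := ae_integrable_section Fi.
    near=> t; move=> tT.
    have bal : 2^-1 * h t + dissip t = (bdry t l - bdry t 0) + ip l (q ^~ t) (u ^~ t).
      by move: tT; near: t; exact: balance.
    have bt0 : bdry t 0 = 0 by move: tT; near: t; exact: b0.
    have btl : bdry t l = 0 by move: tT; near: t; exact: bl.
    have uL : inL2 l (u ^~ t) by move: tT; near: t; exact: aeu.
    have FiT : mu.-integrable (Omega l) (EFin \o (F ^~ t)) by move: tT; near: t; exact: aeF.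
    have Wu : W ^~ t = u ^~ t %[ae mu in Omega l] by move: tT; near: t; exact: aeW.
    have dE : d t = dissip t by rewrite /d Rintegral_cut_section.
    have gE : g t = wnorm2 l (fun x => invmx (Gam x)) (q ^~ t) by rewrite /g Rintegral_cut_section.
    have t0T : 0 <= t <= T by move: tT; rewrite /timeI/= in_itv/= => /andP[/ltW -> /ltW].
    have yu : y t = wnorm2 l Gam (u ^~ t).
      have tT' : t \in `[0, T] by rewrite in_itv.
      rewrite /y /y0 -hE//; apply: wnorm2_ae_eq => //; first exact: (WL t tT').1.
      exact: uL.1.
    have mq i : measurable_fun (Omega l) (fun x => q x t i ord0).
      exact: (@measurable_section R l T (fun x t => q x t i ord0) t (jq i) tT).
    have := ip_young mGam GamK cG0 GamT Gamc mq FiT uL.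
    rewrite -gE -yu dE; move: bal; rewrite bt0 btl subrr add0r => bal; lra.
  have gronwall t : 0 <= t <= T -> z t <= (y0 + \int[mu]_(s in `[0, T]) g s) +
      \int[mu]_(s in `[0, t]) z s.
    move=> /andP[t0 tT].
    have sub : `[0, t] `<=` `[0, T] by apply: subset_itv; rewrite bnd_simp.
    have hit : mu.-integrable `[0, t] (EFin \o h) by exact: integrableS hi.
    have dit : mu.-integrable `[0, t] (EFin \o d) by exact: integrableS di.
    have git : mu.-integrable `[0, t] (EFin \o g) by exact: integrableS gi.
    have yit : mu.-integrable `[0, t] (EFin \o y) by exact: integrableS yi.
    have zit : mu.-integrable `[0, t] (EFin \o z) by exact: integrableS zi.
    have d2it : mu.-integrable `[0, t] (EFin \o (fun s => 2 * d s)) by exact: integrable_EFinZl.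
    have -> : z t = y0 + \int[mu]_(s in `[0, t]) (h s + 2 * d s).
      by rewrite (RintegralD _ hit d2it)// (RintegralZl _ _ dit)// addrA.
    rewrite -addrA lerD2l.
    have le1 : \int[mu]_(s in `[0, t]) (h s + 2 * d s) <= \int[mu]_(s in `[0, t]) (g s + y s).
      (* The differential inequality is available only in the open time interval, so the endpoints
         are removed first. *)
      rewrite -!(@Rintegral_itv_oo_cc R 0 t); [|exact: integrable_EFinD..].
      apply: ae_le_Rintegral => //.
      - by apply: integrableS (integrable_EFinD _ hit d2it) => //; exact: subset_itv_oo_cc.
      - by apply: integrableS (integrable_EFinD _ git yit) => //; exact: subset_itv_oo_cc.
      - apply: filterS diff_ineq => s + st; apply.
        move: st; rewrite /timeI/= !in_itv/= => /andP[-> st].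
        exact: lt_le_trans tT.
    apply: (le_trans le1); rewrite (RintegralD _ git yit)//.
    apply: lerD; last exact: le_Rintegral.
    (* Since [g] is nonnegative, its integral up to [t] is at most the one up to [T], which provides
       the constant of Gronwall's lemma. *)
    rewrite [leLHS]Rintegral_mkcond [leRHS]Rintegral_mkcond; apply: le_Rintegral => //.
    - by rewrite -restrict_EFin; apply/integrable_restrict => //; rewrite setTI.
    - by rewrite -restrict_EFin; apply/integrable_restrict => //; rewrite setTI.
    - move=> s _; rewrite !patchE; case: ifPn => [/set_mem/sub st|_]; first by rewrite mem_set.
      by case: ifP.
  have := gronwall_integral hT zc gronwall.
  have -> : z T = normG2 T + 2 * \int[mu]_(t in timeI T) dissip t.
    rewrite (yE T); last by rewrite lexx T0.
    rewrite /z -(Rintegral_itv_oo_cc diT); congr (_ + 2 * _).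
    by apply: eq_Rintegral => t /set_mem tT; rewrite /d Rintegral_cut_section.
  have -> : \int[mu]_(s in `[0, T]) g s =
     \int[mu]_(t in timeI T) wnorm2 l (fun x => invmx (Gam x)) (q ^~ t).
    rewrite -(Rintegral_itv_oo_cc giT).
    by apply: eq_Rintegral => t /set_mem tT; rewrite /g Rintegral_cut_section.
  (* Uniqueness at time 0 identifies the initial value of [W] with that of [w], which is [u0]
     a.e. *)
  suff -> : y0 = wnorm2 l Gam u0 by [].
  have z0T : (0 : R) \in `[0, T] by rewrite in_itv/= lexx.
  rewrite /y0; apply: wnorm2_ae_eq => //; first exact: (WL 0 z0T).1.
  have := is_time_rep_unique hT wrep Wrep z0T => H1.
  by apply: filterS2 H1 wu0 => x + + xl => /(_ xl) <- /(_ xl).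
Unshelve. all: by end_near. Qed.
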